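(* Let $n=2\widetilde{n}=2p_1\cdots p_t$ with primes $p_i\neq 2,3$. Then the Monsky matrix of $E_n$ is $$M_n=B_1=\begin{pmatrix} 1 & 0 & 0 & 1 & 0 & 0 & O & O\\ 0 & 0 & 0 & 1 & [\frac{-1}{\widetilde{n}}] & 1 & O & r_{-1}\\ 0 & 1 & 0 & 0 & [\frac{2}{\widetilde{n}}] & 1 & O & r_{2}\\ 1 & 1 & 0 & 0 & 0 & [\frac{-3}{\widetilde{n}}] & r_{-3} & O\\ 0 & 0 & 1 & 0 & 0 & 0 & O & O\\ O & O & O & r_{-1}^T & r_{2}^T & r_{3}^T & D_{-3} & A+D_{2}\\ r_{-1}^T & r_{2}^T & r_{3}^T & O & O & O & A+D_{-2} & O \end{pmatrix}.$$
   Context: Let $n$ be a nonzero squarefree integer and $E_n: y^2=x(x+3n)(x-n)$ (the curve attached to $\pi/3$-congruent numbers, twisted by $n$). Write $\widetilde{n}=|n/\gcd(6,n)|=p_1\cdots p_t$ with primes $p_i\neq 2,3$. Every element of $\mathrm{Sel}_2(E_n)$ is represented by a pair $(b_1,b_2)$ with $b_1=(-1)^{\gamma_1}2^{\gamma_2}3^{\gamma_3}\prod_i p_i^{x_i}$, $b_2=(-1)^{\xi_1}2^{\xi_2}3^{\xi_3}\prod_i p_i^{y_i}$, exponents in $\{0,1\}$, encoded by $v^T=(\xi_1,\xi_2,\xi_3,\gamma_1,\gamma_2,\gamma_3,y_1,\dots,y_t,x_1,\dots,x_t)\in\mathbb{F}_2^{2t+6}$. A Monsky matrix of $E_n$ is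 a matrix $M_n$ over $\mathbb{F}_2$ such that this encoding is a bijection between $\mathrm{Sel}_2(E_n)$ and $\{v: M_nv=0\}$. $[\frac{a}{p}]=\frac12(1-(\frac{a}{p}))\in\mathbb{F}_2$ is the additive Legendre symbol, $[\frac{a}{\widetilde n}]=\sum_i[\frac{a}{p_i}]$. For $d$ coprime to $\widetilde{n}$, $r_d=([\frac{d}{p_1}],\dots,[\frac{d}{p_t}])$ (row vector) and $D_d=\mathrm{diag}(r_d)$. $A=(a_{ij})$ is the $t\times t$ matrix over $\mathbb{F}_2$ with $a_{ij}=[\frac{p_j}{p_i}]$ for $i\neq j$, $a_{ii}=\sum_{j\neq i}a_{ij}$. $O$ denotes a zero block. *)

(* Defs.v *)
From HB Require Import structures.
From mathcomp Require Import all_boot all_order all_algebra.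
From mathcomp Require Import fraction.
From mathcomp Require Import boolp classical_sets functions reals.

Set Implicit Arguments.
Unset Strict Implicit.
Unset Printing Implicit Defensive.

Import Order.TTheory GRing.Theory Num.Theory.
Local Open Scope ring_scope.

(* Z_p as the inverse limit of the Z/p^k: the k-th component is the residue in
   [0, p^k), and the single equation below expresses both that it is reduced
   and that it is compatible with the next component. *)

Definition primeT := {p : nat | prime p}.

Record padic_int (p : primeT) := PadicInt {
  padic_seq :> nat -> int;
  _ : forall k, padic_seq k = (padic_seq k.+1 %% ((val p) ^ k)%N%:Z)%Z }.

HB.instance Definition _ (p : primeT) := gen_eqMixin (padic_int p).
HB.instance Definition _ (p : primeT) := gen_choiceMixin (padic_int p).

Section PadicInt.
Variable p : primeT.
Local Notation pow k := (((val p) ^ k)%N%:Z).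
Implicit Types a b c : padic_int p.

Lemma padic_coh a k : a k = (a k.+1 %% pow k)%Z.
Proof. by case: a. Qed.

Lemma padicP a b : (forall k, a k = b k) -> a = b.
Proof.
case: a b => [a Ha] [b Hb] /= eq_ab.
have {}eq_ab : a = b by apply/funext.
by subst b; congr PadicInt; apply: Prop_irrelevance.
Qed.

Lemma modz_pow_trunc (x : int) k : ((x %% pow k.+1)%Z %% pow k)%Z = (x %% pow k)%Z.
Proof.
have /dvdzP[q ->] : (pow k %| pow k.+1)%Z by rewrite dvdzE /= dvdn_exp2l.
by rewrite {2}(divz_eq x (q * pow k)) mulrA modzMDl.
Qed.

Lemma padic_mod a k : (a k %% pow k)%Z = a k.
Proof. by rewrite {1}padic_coh modz_mod -padic_coh. Qed.

Fact padic_of_int_subproof (x : int) k :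
  (x %% pow k)%Z = ((x %% pow k.+1)%Z %% pow k)%Z.
Proof. by rewrite modz_pow_trunc. Qed.
Definition padic_of_int (x : int) : padic_int p :=
  PadicInt (padic_of_int_subproof x).

Fact padic_add_subproof a b k :
  ((a k + b k) %% pow k)%Z = (((a k.+1 + b k.+1) %% pow k.+1)%Z %% pow k)%Z.
Proof. by rewrite modz_pow_trunc (padic_coh a) (padic_coh b) modzDm. Qed.
Definition padic_add a b : padic_int p := PadicInt (padic_add_subproof a b).

Fact padic_opp_subproof a k :
  ((- a k) %% pow k)%Z = (((- a k.+1) %% pow k.+1)%Z %% pow k)%Z.
Proof. by rewrite modz_pow_trunc (padic_coh a) modzNm. Qed.
Definition padic_opp a : padic_int p := PadicInt (padic_opp_subproof a).

Fact padic_mul_subproof a b k :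
  ((a k * b k) %% pow k)%Z = (((a k.+1 * b k.+1) %% pow k.+1)%Z %% pow k)%Z.
Proof. by rewrite modz_pow_trunc (padic_coh a) (padic_coh b) modzMm. Qed.
Definition padic_mul a b : padic_int p := PadicInt (padic_mul_subproof a b).

Fact padic_addA : associative padic_add.
Proof. by move=> a b c; apply: padicP => k /=; rewrite modzDml modzDmr addrA. Qed.
Fact padic_addC : commutative padic_add.
Proof. by move=> a b; apply: padicP => k /=; rewrite addrC. Qed.
Fact padic_add0 : left_id (padic_of_int 0) padic_add.
Proof. by move=> a; apply: padicP => k /=; rewrite modzDml add0r padic_mod. Qed.
Fact padic_addN : left_inverse (padic_of_int 0) padic_opp padic_add.
Proof. by move=> a; apply: padicP => k /=; rewrite modzDml addNr. Qed.

HB.instance Definition _ := GRing.isZmodule.Build (padic_int p)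
  padic_addA padic_addC padic_add0 padic_addN.

Fact padic_mulA : associative padic_mul.
Proof. by move=> a b c; apply: padicP => k /=; rewrite modzMml modzMmr mulrA. Qed.
Fact padic_mulC : commutative padic_mul.
Proof. by move=> a b; apply: padicP => k /=; rewrite mulrC. Qed.
Fact padic_mul1 : left_id (padic_of_int 1) padic_mul.
Proof. by move=> a; apply: padicP => k /=; rewrite modzMml mul1r padic_mod. Qed.
Fact padic_mulD : left_distributive padic_mul padic_add.
Proof.
by move=> a b c; apply: padicP => k /=; rewrite modzMml modzDml modzDmr mulrDl.
Qed.
Fact padic_1_neq0 : padic_of_int 1 != 0.
Proof.
apply/eqP => /(congr1 (fun a : padic_int p => a 1%N)) /=.
have p_gt1 := prime_gt1 (valP p).
by rewrite expn1 mod0z modz_small //= ltz_nat p_gt1.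
Qed.

HB.instance Definition _ := GRing.Zmodule_isComNzRing.Build (padic_int p)
  padic_mulA padic_mulC padic_mul1 padic_mulD padic_1_neq0.

Definition padic_unit : {pred padic_int p} := fun a => `[< exists b, b * a = 1 >].
Definition padic_inv a : padic_int p :=
  if pselect (exists b, b * a = 1) is left ex_b then projT1 (cid ex_b) else a.

Fact padic_mulVx : {in padic_unit, left_inverse 1 padic_inv *%R}.
Proof.
move=> a /asboolP a_unit; rewrite /padic_inv.
by case: pselect => // ex_b; case: (cid ex_b).
Qed.
Fact padic_unitPl a b : b * a = 1 -> padic_unit a.
Proof. by move=> ba1; apply/asboolP; exists b. Qed.
Fact padic_inv_out : {in [predC padic_unit], padic_inv =1 id}.
Proof.
move=> a /negP Ha; rewrite /padic_inv; case: pselect => // ex_b.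
by case: Ha; apply/asboolP.
Qed.

HB.instance Definition _ := GRing.ComNzRing_hasMulInverse.Build (padic_int p)
  padic_mulVx padic_unitPl padic_inv_out.

Lemma padic_trunc a k l : (a (k + l)%N %% pow k)%Z = a k.
Proof.
elim: l => [|l IHl]; first by rewrite addn0 padic_mod.
rewrite -[RHS]IHl (padic_coh a (k + l)) addnS.
have /dvdzP[q ->] : (pow k %| pow (k + l)%N)%Z.
  by rewrite dvdzE /= dvdn_exp2l ?leq_addr.
by rewrite {1}(divz_eq (a (k + l).+1) (q * pow k)) mulrA modzMDl.
Qed.

Lemma padic_neq0 a : a != 0 -> exists k, forall l, ~~ (pow k %| a (k + l)%N)%Z.
Proof.
move=> a_neq0; apply: contrapT => noK; case/eqP: a_neq0.
apply: padicP => k /=; rewrite mod0z; apply: contrapT => ak_neq0.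
apply: noK; exists k => l; apply/negP => /dvdz_mod0P.
by rewrite padic_trunc.
Qed.

Fact padic_integral : GRing.integral_domain_axiom (padic_int p).
Proof.
move=> a b ab0; case: eqVneq => //= a_neq0.
apply: contraT => b_neq0.
have [k Hk] := padic_neq0 a_neq0; have [l Hl] := padic_neq0 b_neq0.
have /= := congr1 (fun c : padic_int p => c (k + l)%N) ab0; rewrite mod0z.
move=> /dvdz_mod0P; move: (Hk l) (Hl k); rewrite (addnC l k) !dvdzE abszM /=.
set x := `|a _|%N; set y := `|b _|%N => Hx Hy.
have p_pr := valP p.
have x_gt0 : (0 < x)%N by case: (posnP x) Hx => // ->; rewrite dvdn0.
have y_gt0 : (0 < y)%N by case: (posnP y) Hy => // ->; rewrite dvdn0.
move: Hx Hy; rewrite !pfactor_dvdn ?muln_gt0 ?x_gt0 // lognM // -!ltnNge.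
move=> Hx Hy; rewrite leqNgt => /negP[].
by rewrite -addSn leq_add // ltnW.
Qed.

HB.instance Definition _ := GRing.ComUnitRing_isIntegral.Build (padic_int p)
  padic_integral.

End PadicInt.

Definition padic (p : primeT) : fieldType := {fraction (padic_int p)}.

(* An element of Q^*/Q^*2 is represented by the coset b Q^*2 itself. *)
Definition sqclass (b : rat) : set rat :=
  [set c | exists2 s : rat, s != 0 & c = b * s ^+ 2].

(* The 2-covering of y^2 = (x - e1)(x - e2)(x - e3) attached to (b1, b2),
   through which (x - e1, x - e2) = (b1, b2) modulo squares, as a curve in P^3:
   with x = e1 + b1 (z1/z0)^2, it reads x - e2 = b2 (z2/z0)^2 and
   x - e3 = b1 b2 (z3/z0)^2. *)
Definition covering_has_point (K : fieldType) (e1 e2 e3 b1 b2 : rat) : Prop :=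
  exists z0 z1 z2 z3 : K,
    [/\ [|| z0 != 0, z1 != 0, z2 != 0 | z3 != 0],
        ratr b1 * z1 ^+ 2 - ratr b2 * z2 ^+ 2 = ratr (e2 - e1) * z0 ^+ 2
      & ratr b1 * z1 ^+ 2 - ratr (b1 * b2) * z3 ^+ 2
          = ratr (e3 - e1) * z0 ^+ 2].

(* The 2-Selmer group of y^2 = (x - e1)(x - e2)(x - e3), for rational e1, e2,
   e3, as a subset of H^1(Q, E[2]) = (Q^*/Q^*2)^2. *)
Definition Sel2_split (R : realType) (e1 e2 e3 : rat) : set (set rat * set rat) :=
  [set c | exists b1 b2 : rat,
     [/\ b1 != 0, b2 != 0, c = (sqclass b1, sqclass b2),
         covering_has_point R e1 e2 e3 b1 b2
       & forall p : primeT, covering_has_point (padic p) e1 e2 e3 b1 b2]].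

(* E_n : y^2 = x (x + 3n) (x - n), with b1 and b2 the classes of x and x - n. *)
Definition Sel2 (R : realType) (n : int) : set (set rat * set rat) :=
  Sel2_split R 0 n%:~R (- 3 * n%:~R).

(* [legendre a q] is only meant for an odd prime q. *)
Definition legendre (a : int) (q : nat) : int :=
  if (q%:Z %| a)%Z then 0
  else if [exists x : 'I_q, (x%:Z ^+ 2 == a %[mod q%:Z])%Z] then 1 else -1.

Definition addlegendre (a : int) (q : nat) : 'F_2 :=
  ((1 - legendre a q) %/ 2)%Z%:~R.

Section Monsky.
Variables (t : nat) (p : 'I_t -> nat).

(* The coordinates of v are (xi1, xi2, xi3, gamma1, gamma2, gamma3, y, x). *)
Section Decode.
Variable v : 'cV['F_2]_(6 + (t + t)).

Definition xi_exp (k : nat) : nat := usubmx v (inord k.-1) 0.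
Definition gamma_exp (k : nat) : nat := usubmx v (inord (k + 2)%N) 0.
Definition y_exp (i : 'I_t) : nat := usubmx (dsubmx v) i 0.
Definition x_exp (i : 'I_t) : nat := dsubmx (dsubmx v) i 0.

Definition decode1 : int :=
  (-1) ^+ gamma_exp 1 * 2 ^+ gamma_exp 2 * 3 ^+ gamma_exp 3
  * \prod_i (p i)%:Z ^+ x_exp i.
Definition decode2 : int :=
  (-1) ^+ xi_exp 1 * 2 ^+ xi_exp 2 * 3 ^+ xi_exp 3
  * \prod_i (p i)%:Z ^+ y_exp i.
Definition decode : set rat * set rat :=
  (sqclass decode1%:~R, sqclass decode2%:~R).
End Decode.

(* The encoding of Sel2 is stated through its inverse. *)
Definition is_Monsky_matrix (R : realType) (n : int) (m : nat)
    (M : 'M['F_2]_(m, 6 + (t + t))) : Prop :=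
  set_bij [set v : 'cV['F_2]_(6 + (t + t)) | M *m v = 0] (Sel2 R n) decode.

Definition addlegendre_prod (a : int) : 'F_2 := \sum_i addlegendre a (p i).

Definition rvec (d : int) : 'rV['F_2]_t := \row_i addlegendre d (p i).
Definition Dmat (d : int) : 'M['F_2]_t := diag_mx (rvec d).
Definition Amat : 'M['F_2]_t :=
  \matrix_(i, j) if i == j then \sum_(k | k != i) addlegendre (p k)%:Z (p i)
                 else addlegendre (p j)%:Z (p i).

Definition scalar_row (a1 a2 a3 a4 a5 a6 : 'F_2) (u w : 'rV['F_2]_t) :
    'rV['F_2]_(6 + (t + t)) :=
  row_mx (\row_j [:: a1; a2; a3; a4; a5; a6]`_j) (row_mx u w).

Definition block_row (c1 c2 c3 c4 c5 c6 : 'cV['F_2]_t) (U W : 'M['F_2]_t) :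
    'M['F_2]_(t, 6 + (t + t)) :=
  row_mx (\matrix_(i, j) ([:: c1; c2; c3; c4; c5; c6]`_j) i 0) (row_mx U W).

Definition B1 : 'M['F_2]_(5 + (t + t), 6 + (t + t)) :=
  let L := addlegendre_prod in
  let r := rvec in
  let rT d := (rvec d)^T in
  let D := Dmat in
  let A := Amat in
  col_mx
    (\matrix_(i < 5)
       [:: scalar_row 1 0 0 1 0        0        0        0;
           scalar_row 0 0 0 1 (L (-1)) 1        0        (r (-1));
           scalar_row 0 1 0 0 (L 2)    1        0        (r 2);
           scalar_row 1 1 0 0 0        (L (-3)) (r (-3)) 0;
           scalar_row 0 0 1 0 0        0        0        0]`_i)
    (col_mx
       (block_row 0 0 0 (rT (-1)) (rT 2) (rT 3) (D (-3)) (A + D 2))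
       (block_row (rT (-1)) (rT 2) (rT 3) 0 0 0 (A + D (-2)) 0)).

End Monsky.

(* Main.v *)
Require Import Defs.
From mathcomp Require Import all_boot all_order all_fingroup all_algebra.
From mathcomp Require Import all_solvable all_field fraction generic_quotient.
From mathcomp Require Import ring lra zify.
From mathcomp Require Import boolp classical_sets functions reals.

(* A pair (b1, b2) lies in the 2-Selmer group iff its 2-covering has points over
   R and over every Q_q.  Over a local field the classes of the torsion points
   (n, 1) and (-3, -n) come for free, since translation by torsion is linear on
   coverings; for the remaining points one compares the valuations of x, x - n
   and x + 3n, whose product is a square, and Hensel's lemma identifies the
   classes.  At p_k the local image is exactly the torsion image, at 3 it is
   {(b, (-n)^v(b))}, at a prime not dividing 6n it consists of the unramified
   classes (solvability follows from a count of points modulo q), and at R it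
   is b1 b2 > 0.  At 2 it has order 8 and is cut out by three conditions; the
   first two are rows 2 and 3 of the matrix, and the third one,
   the triviality of the Hilbert symbol (b2, n), follows from the other rows by
   the product formula, that is, by quadratic reciprocity.  Writing all residue
   conditions with additive Legendre symbols gives the rows of the matrix. *)

Set Implicit Arguments.
Unset Strict Implicit.
Unset Printing Implicit Defensive.

Import Order.TTheory GRing.Theory Num.Theory.
Local Open Scope ring_scope.

(** * Square classes and 2-coverings over a field *)

(** The Hilbert condition at 2 is never extracted from a point over Q_2: [local_image_2] yields rows
    2 and 3 alone, and the third condition is used only in the converse direction, where the rows at
    all the p_k hold together and their sum supplies it. This is why the matrix has no row for it.
    No index count and no duality enter: at each place a class satisfying the conditions is given a
    point directly. Beyond torsion, the explicit points are x = 1 at 2, of class (1, 1 - n), and x =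
    -1 at 3 when n is 1 modulo 3. The local arguments run over an arbitrary field satisfying
    [padic_like], which collects the few properties of Q_q in use. The same valuations read the
    exponents of an integer off its square class, whence the injectivity of [decode]. For
    surjectivity, unramifiedness away from 6n allows every other prime to be dropped from an integer
    representative. *)

Ltac nonzero :=
  repeat (apply/andP; split);
  do 4?rewrite ?oppr_eq0 ?invr_eq0 ?mulf_neq0 ?expf_neq0 //.

Section SquareClasses.
Variable K : fieldType.
Implicit Types a b c d x y s : K.

Definition sim a b := exists2 s : K, s != 0 & a = b * s ^+ 2.

Lemma sim_refl a : sim a a.
Proof. by exists 1; rewrite ?oner_neq0 // expr1n mulr1. Qed.

Lemma sim_sym a b : sim a b -> sim b a.
Proof.
case=> s s0 ->; exists s^-1; first by rewrite invr_eq0.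
by rewrite exprVn mulfK ?expf_neq0.
Qed.

Lemma sim_trans a b c : sim a b -> sim b c -> sim a c.
Proof.
move=> [s s0 ->] [r r0 ->]; exists (r * s); first by rewrite mulf_neq0.
by rewrite exprMn -mulrA.
Qed.

Lemma simM a b c d : sim a b -> sim c d -> sim (a * c) (b * d).
Proof.
move=> [s s0 ->] [r r0 ->]; exists (s * r); first by rewrite mulf_neq0.
by rewrite exprMn mulrACA.
Qed.

Lemma sim_sqr a s : s != 0 -> sim (a * s ^+ 2) a.
Proof. by move=> s0; exists s. Qed.

Lemma sim1_sqr s : s != 0 -> sim (s ^+ 2) 1.
Proof. by move=> s0; exists s; rewrite ?mul1r. Qed.

Lemma sim_neq0 a b : sim a b -> b != 0 -> a != 0.
Proof. by case=> s s0 -> b0; rewrite mulf_neq0 ?expf_neq0. Qed.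

Lemma sim_div a b c : c != 0 -> sim (a * c) b -> sim a (b * c).
Proof.
move=> c0 [s s0 E]; exists (s / c); first by rewrite mulf_neq0 ?invr_eq0.
apply: (mulIf c0); rewrite E; field; exact: c0.
Qed.

Lemma sim_quot a b c d : b != 0 -> sim a b -> sim (a * c) d -> sim c (b * d).
Proof.
move=> b0 Sab Sacd; have a0 := sim_neq0 Sab b0.
have S : sim c (a * (a * c)).
  exists a^-1; first by rewrite invr_eq0.
  by rewrite exprVn mulrA -expr2 mulrAC mulfV ?mul1r ?expf_neq0.
exact: sim_trans S (simM Sab Sacd).
Qed.

(** This is [covering_has_point] for the roots 0, n, -3n, but with coefficients in K itself: b1 and
    b2 can then be moved within their square classes of K, not only of Q. The link is made by
    [covering_cov]. *)
Definition cov n b1 b2 := exists z0 z1 z2 z3 : K,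
  [/\ [|| z0 != 0, z1 != 0, z2 != 0 | z3 != 0],
      b1 * z1 ^+ 2 - b2 * z2 ^+ 2 = n * z0 ^+ 2
    & b1 * z1 ^+ 2 - b1 * b2 * z3 ^+ 2 = (- 3 * n) * z0 ^+ 2].

Lemma cov_sim n b1 b2 c1 c2 :
  sim b1 c1 -> sim b2 c2 -> cov n c1 c2 -> cov n b1 b2.
Proof.
move=> [s s0 ->] [r r0 ->] [z0 [z1 [z2 [z3 [nz E1 E2]]]]].
exists z0, (z1 / s), (z2 / r), (z3 / (s * r)); split.
- by rewrite !mulf_eq0 !invr_eq0 mulf_eq0 (negPf s0) (negPf r0) !orbF.
- by rewrite -E1; field; apply/andP.
- by rewrite -E2; field; apply/andP.
Qed.

(** The point with z0 = 0 lies above the point at infinity of the curve. *)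
Lemma cov11 n : cov n 1 1.
Proof. by exists 0, 1, 1, 1; split; [rewrite oner_neq0 /= orbT | ring | ring]. Qed.

Lemma cov_eqs n b1 b2 z0 z1 z2 z3 : b1 != 0 -> b2 != 0 ->
  b1 * z1 ^+ 2 - b2 * z2 ^+ 2 = n * z0 ^+ 2 ->
  b1 * z1 ^+ 2 - b1 * b2 * z3 ^+ 2 = (- 3 * n) * z0 ^+ 2 ->
  z2 ^+ 2 = (b1 * z1 ^+ 2 - n * z0 ^+ 2) / b2 /\
  z3 ^+ 2 = (b1 * z1 ^+ 2 + 3 * n * z0 ^+ 2) / (b1 * b2).
Proof.
move=> b10 b20 E1 E2; split.
  by apply: (canRL (mulfK b20)); rewrite -E1; ring.
apply: (canRL (mulfK _)); first by rewrite mulf_neq0.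
have -> : 3 * n * z0 ^+ 2 = - (- 3 * n * z0 ^+ 2) by ring.
by rewrite -E2; ring.
Qed.

(* Translation by the torsion points (n, 0) and (0, 0) acts linearly on the
   2-coverings. *)
Lemma cov_translate_n n b1 b2 : (2 : K) != 0 -> n != 0 -> b1 != 0 -> b2 != 0 ->
  cov n b1 b2 -> cov n (n * b1) b2.
Proof.
move=> h2 n0 b10 b20 [z0 [z1 [z2 [z3 [nz E1 E2]]]]].
have [e2 e3] := cov_eqs b10 b20 E1 E2.
(* Translation by (n, 0) sends x to x' with (x - n)(x' - n) = 4n^2. Hence x' = n (x + 3n) / (x - n)
   and x' + 3n = 4n x / (x - n), which in terms of the z's gives these coordinates. Being linear,
   they make sense also above the torsion points. *)
exists z2, z3, (2 * n * z0 / b2), (2 * z1 / b2); split.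
- rewrite !mulf_eq0 !invr_eq0 (negPf h2) (negPf n0) (negPf b20) !orbF /=.
  by case/or4P: nz => ->; rewrite ?orbT.
- by rewrite !exprMn e2 e3; field; rewrite ?b10 ?b20.
- by rewrite !exprMn e2 e3; field; rewrite ?b10 ?b20.
Qed.

Lemma cov_translate_0 n b1 b2 : n != 0 -> b1 != 0 -> b2 != 0 ->
  cov n b1 b2 -> cov n (- 3 * b1) (- n * b2).
Proof.
move=> n0 b10 b20 [z0 [z1 [z2 [z3 [nz E1 E2]]]]].
have [e2 e3] := cov_eqs b10 b20 E1 E2.
(* Translation by (0, 0) sends x to -3n^2 / x, so z0 and z1 are exchanged up to a scalar, and so are
   z2 and z3. *)
exists z1, (n * z0 / b1), z3, (z2 / b1); split.
- rewrite !mulf_eq0 !invr_eq0 (negPf n0) (negPf b10) !orbF /=.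
  by case/or4P: nz => ->; rewrite ?orbT.
- by rewrite !exprMn e3; field; rewrite ?b10 ?b20.
- by rewrite !exprMn e2; field; rewrite ?b10 ?b20.
Qed.

Lemma cov_torsion n b1 b2 c1 c2 (i j : bool) : (2 : K) != 0 -> (3 : K) != 0 ->
    n != 0 -> c1 != 0 -> c2 != 0 -> cov n c1 c2 ->
  sim b1 (n ^+ i * (- 3) ^+ j * c1) -> sim b2 ((- n) ^+ j * c2) -> cov n b1 b2.
Proof.
move=> h2 h3 n0 c10 c20 C S1 S2; apply: cov_sim S1 S2 _.
case: j; rewrite ?expr0 ?expr1 ?mulr1 ?mul1r; last first.
  by case: i; rewrite ?expr0 ?expr1 ?mul1r //; apply: cov_translate_n.
have {}C := cov_translate_0 n0 c10 c20 C.
case: i; rewrite ?expr0 ?expr1 ?mul1r // -mulrA; apply: cov_translate_n => //.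
  by rewrite mulf_neq0 // oppr_eq0.
by rewrite mulf_neq0 // oppr_eq0.
Qed.

Lemma cov_point n b1 b2 x : b1 != 0 -> b2 != 0 ->
  sim x b1 -> sim (x - n) b2 -> sim (x + 3 * n) (b1 * b2) -> cov n b1 b2.
Proof.
move=> b10 b20 [z1 _ E1] [z2 _ E2] [z3 _ E3]; exists 1, z1, z2, z3.
by rewrite oner_neq0 -E1 -E2 -E3; split=> //; ring.
Qed.

(** The hyperplanes z0 = 0, z1 = 0, z2 = 0, z3 = 0 cut out the points above infinity, (0, 0), (n,
    0), (-3n, 0), whose classes are (1, 1), (-3, -n), (n, 1), (-3n, -n). Off these hyperplanes x =
    b1 (z1 / z0)^2 and none of its three factors vanishes. *)
Lemma cov_cases n b1 b2 : (2 : K) != 0 -> (3 : K) != 0 ->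
    n != 0 -> b1 != 0 -> b2 != 0 -> cov n b1 b2 ->
  (exists i j : bool,
     sim b1 (n ^+ i * (- 3) ^+ j) /\ sim b2 ((- n) ^+ j)) \/
  (exists x, [/\ sim x b1, sim (x - n) b2 & sim (x + 3 * n) (b1 * b2)]).
Proof.
move=> h2 h3 n0 b10 b20 [z0 [z1 [z2 [z3 [nz E1 E2]]]]].
have h4 : (4 : K) != 0 by rewrite (natrM _ 2 2) mulf_neq0.
have [e2 e3] := cov_eqs b10 b20 E1 E2.
have [z00|z00] := eqVneq z0 0; first left.
  have z10 : z1 != 0.
    apply: contraTneq nz => z10.
    rewrite z10 z00 expr0n /= !mulr0 ?subr0 ?addr0 !mul0r in e2 e3 *.
    by rewrite -(sqrf_eq0 z2) -(sqrf_eq0 z3) e2 e3 eqxx.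
  rewrite z00 expr0n /= !mulr0 subr0 addr0 in e2 e3.
  have z20 : z2 != 0.
    by rewrite -sqrf_eq0 e2 !mulf_neq0 ?invr_eq0 ?expf_neq0.
  have z30 : z3 != 0.
    by rewrite -sqrf_eq0 e3 !mulf_neq0 ?invr_eq0 ?expf_neq0 ?mulf_neq0.
  exists false, false; rewrite !expr0 mulr1; split.
    exists (z2 / z3); first by rewrite mulf_neq0 ?invr_eq0.
    rewrite exprMn exprVn e2 e3 mul1r; field; nonzero.
  exists (z1 / z3); first by rewrite mulf_neq0 ?invr_eq0.
  by rewrite exprMn exprVn e3 mul1r; field; nonzero.
have [z10|z10] := eqVneq z1 0; first left.
  rewrite z10 expr0n /= mulr0 sub0r add0r in e2 e3.
  have z20 : z2 != 0.
    rewrite -sqrf_eq0 e2 mulf_neq0 ?invr_eq0 ?oppr_eq0 //.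
    by rewrite mulf_neq0 ?expf_neq0.
  have z30 : z3 != 0.
    by rewrite -sqrf_eq0 e3 !mulf_neq0 ?invr_eq0 ?expf_neq0 ?mulf_neq0.
  exists false, true; rewrite !expr0 expr1 mul1r; split.
    exists (z2 / z3); first by rewrite mulf_neq0 ?invr_eq0.
    by rewrite exprMn exprVn e2 e3; field; nonzero.
  exists (z0 / z2); first by rewrite mulf_neq0 ?invr_eq0.
  by rewrite exprMn exprVn e2; field; nonzero.
have [z20|z20] := eqVneq z2 0; first left.
  have e1 : z1 ^+ 2 = n * z0 ^+ 2 / b1.
    by apply: (canRL (mulfK b10)); rewrite -E1 z20; ring.
  have {}e3 : z3 ^+ 2 = 4 * n * z0 ^+ 2 / (b1 * b2).
    by rewrite e3 e1; field; nonzero.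
  have z30 : z3 != 0.
    by rewrite -sqrf_eq0 e3; nonzero.
  exists true, false; rewrite !expr0 expr1 mulr1; split.
    exists (z0 / z1); first by rewrite mulf_neq0 ?invr_eq0.
    by rewrite exprMn exprVn e1; field; nonzero.
  exists (2 * z1 / z3); first by rewrite !mulf_neq0 ?invr_eq0.
  by rewrite !exprMn exprVn e1 e3; field; nonzero.
have [z30|z30] := eqVneq z3 0; first left.
  have e1 : z1 ^+ 2 = - 3 * n * z0 ^+ 2 / b1.
    by apply: (canRL (mulfK b10)); rewrite -E2 z30; ring.
  have {}e2 : z2 ^+ 2 = - 4 * n * z0 ^+ 2 / b2.
    by rewrite e2 e1; field; nonzero.
  exists true, true; rewrite !expr1; split.
    exists (z0 / z1); first by rewrite mulf_neq0 ?invr_eq0.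
    by rewrite exprMn exprVn e1; field; nonzero.
  exists (2 * z0 / z2); first by rewrite !mulf_neq0 ?invr_eq0.
  by rewrite !exprMn exprVn e2; field; nonzero.
right; exists (b1 * (z1 / z0) ^+ 2); split.
- by apply: sim_sqr; rewrite mulf_neq0 ?invr_eq0.
- exists (z2 / z0); first by rewrite mulf_neq0 ?invr_eq0.
  by rewrite !exprMn e2 exprVn; field; nonzero.
- exists (z3 / z0); first by rewrite mulf_neq0 ?invr_eq0.
  by rewrite !exprMn e3 exprVn; field; nonzero.
Qed.

End SquareClasses.

(** * Henselian valued fields with prime residue field *)

(** The value [v 0] is arbitrary, so 0 is put into every ball by hand. *)
Definition vge (K : fieldType) (v : K -> int) (k : int) (x : K) :=
  x = 0 \/ k <= v x.

(** The threshold in [pl_hensel] reflects that a unit is a square as soon as it is 1 modulo 8 for q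
    = 2, or 1 modulo q for odd q. The approximation of units by integers encodes that the residue
    field is the prime field. *)
Record padic_like (K : fieldType) (q : nat) (v : K -> int) : Prop := PadicLike {
  pl_prime : prime q;
  pl_int_eq0 : forall m : int, (m%:~R == 0 :> K) = (m == 0);
  pl_valM : forall x y, x != 0 -> y != 0 -> v (x * y) = v x + v y;
  pl_vgeD : forall k x y, vge v k x -> vge v k y -> vge v k (x + y);
  pl_val_int : forall m : int, m != 0 -> v m%:~R = logn q `|m|;
  pl_hensel : forall x y, x != 0 ->
    vge v (v x + if q == 2%N then 3 else 1) (y - x) -> sim y x;
  pl_approx : forall (k : nat) x, x != 0 -> v x = 0 ->
    exists m : int, vge v k (x - m%:~R) }.

Section PadicLike.
Variables (K : fieldType) (q : nat) (v : K -> int).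
Hypothesis Kv : padic_like q v.
Implicit Types (x y z : K) (k l : int).

Let q_pr := pl_prime Kv.

Lemma pl_nat_eq0 (m : nat) : (m%:R == 0 :> K) = (m == 0%N).
Proof. exact: (pl_int_eq0 Kv m). Qed.

Lemma pl_val1 : v 1 = 0.
Proof.
by have := pl_valM Kv (oner_neq0 K) (oner_neq0 K); rewrite mulr1; set a := v _; lia.
Qed.

Lemma pl_valN x : v (- x) = v x.
Proof.
have [->|x0] := eqVneq x 0; first by rewrite oppr0.
have m10 : (-1 : K) != 0 by rewrite oppr_eq0 oner_neq0.
have := pl_valM Kv m10 m10; rewrite mulrNN mulr1 pl_val1 => v1.
by rewrite -mulN1r (pl_valM Kv m10 x0); lia.
Qed.

Lemma pl_valX x n : x != 0 -> v (x ^+ n) = v x *+ n.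
Proof.
move=> x0; elim: n => [|n IHn]; first exact: pl_val1.
by rewrite exprS (pl_valM Kv) ?expf_neq0 // IHn mulrS.
Qed.

Lemma vge_val x : vge v (v x) x.
Proof. by right. Qed.

Lemma vgeP k x : x != 0 -> vge v k x <-> k <= v x.
Proof. by move=> x0; split=> [[x00|//]|]; [rewrite x00 eqxx in x0 | right]. Qed.

Lemma vge_le k l x : k <= l -> vge v l x -> vge v k x.
Proof. by move=> le_kl [->|le_l]; [left | right; apply: le_trans le_l]. Qed.

Lemma vgeN k x : vge v k x -> vge v k (- x).
Proof. by case=> [->|le_k]; [rewrite oppr0; left | right; rewrite pl_valN]. Qed.

Lemma vgeB k x y : vge v k x -> vge v k y -> vge v k (x - y).
Proof. by move=> kx /vgeN; apply: (pl_vgeD Kv). Qed.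

Lemma vgeM k l x y : vge v k x -> vge v l y -> vge v (k + l) (x * y).
Proof.
move=> kx ly; have [->|x0] := eqVneq x 0; first by rewrite mul0r; left.
have [->|y0] := eqVneq y 0; first by rewrite mulr0; left.
right; rewrite (pl_valM Kv) //; apply: lerD; exact/vgeP.
Qed.

Lemma vge_add k x y : vge v k (x - y) -> vge v k y -> vge v k x.
Proof. by move=> V /(pl_vgeD Kv V); rewrite subrK. Qed.

Lemma val_exact k x : vge v k x -> ~ vge v (k + 1) x -> x != 0 /\ v x = k.
Proof.
move=> kx nV; have x0 : x != 0 by apply/eqP => x0; apply: nV; left.
split=> //; apply/eqP; rewrite eq_le; apply/andP; split; last exact/vgeP.
by rewrite -ltzD1 ltNge; apply/negP => /(vgeP _ x0)/nV.
Qed.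

Lemma val_close x y : x != 0 -> vge v (v x + 1) (y - x) -> y != 0 /\ v y = v x.
Proof.
move=> x0 V; apply: val_exact.
  apply: (vge_add (y := x)); last exact: vge_val.
  by apply: vge_le V; lia.
by move=> V'; have := vgeB V' V; rewrite subKr => /(vgeP _ x0); lia.
Qed.

Lemma hensel_odd x y : q != 2%N -> x != 0 -> vge v (v x + 1) (y - x) -> sim y x.
Proof. by move=> /negPf q2 x0 V; apply: (pl_hensel Kv) => //; rewrite q2. Qed.

Lemma hensel_2 x y : q = 2%N -> x != 0 -> vge v (v x + 3) (y - x) -> sim y x.
Proof. by move=> q2 x0 V; apply: (pl_hensel Kv) => //; rewrite q2. Qed.

Lemma vge_int (k : nat) (m : int) : vge v k m%:~R <-> ((q ^ k)%N%:Z %| m)%Z.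
Proof.
have [->|m0] := eqVneq m 0; first by rewrite dvdz0; split=> // _; left.
rewrite vgeP ?(pl_int_eq0 Kv) // (pl_val_int Kv) // dvdzE /=.
by rewrite pfactor_dvdn ?absz_gt0.
Qed.

Lemma val_int_unit (m : int) : ~~ (q%:Z %| m)%Z -> v m%:~R = 0.
Proof.
move=> ndvd; have m0 : m != 0 by apply: contraNneq ndvd => ->; rewrite dvdz0.
rewrite (pl_val_int Kv) //; congr Posz; apply/eqP.
by rewrite -leqn0 leqNgt -pfactor_dvdn ?absz_gt0 // expn1 -(@dvdzE q).
Qed.

(** The part of the valuation that a square class retains; the absolute value only turns an integer
    into a natural number. *)
Definition par x : bool := odd `|v x|.

Lemma parM x y : x != 0 -> y != 0 -> par (x * y) = par x (+) par y.
Proof. by move=> x0 y0; rewrite /par (pl_valM Kv) //; lia. Qed.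

Lemma par_sim x y : y != 0 -> sim x y -> par x = par y.
Proof.
move=> y0 [s s0 ->]; rewrite parM ?expf_neq0 // /par pl_valX //.
by rewrite [X in _ (+) X](_ : _ = false) ?addbF //; lia.
Qed.

End PadicLike.

(** * The p-adic numbers *)

Lemma frac_div (R : idomainType) (x : {fraction R}) :
  exists a b : R, b != 0 /\ x = FracField.tofrac a / FracField.tofrac b.
Proof.
elim/quotW: x => y; exists (\n_y), (\d_y); split; first exact: denom_ratioP.
apply: (canRL (mulfK _)); first by rewrite tofrac_eq0 denom_ratioP.
have tofracE z : FracField.tofrac z = (\pi_(FracField.type R) (Ratio z 1))%qT.
  by unlock FracField.tofrac.
rewrite !tofracE; transitivity (FracField.mul (\pi_(FracField.type R) y)%qT
  (\pi_(FracField.type R) (Ratio \d_y 1))%qT) => //.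
rewrite -FracField.pi_mul; apply/eqmodP; rewrite /= FracField.equivfE.
rewrite /FracField.mulf !numden_Ratio ?mulr1 ?oner_neq0 ?denom_ratioP //.
by rewrite mulrC.
Qed.

Section PadicIntegers.
Variable p : primeT.
Local Notation q := (val p).
Local Notation Z := (padic_int p).
Implicit Types a b d u x y : Z.

Let p_pr : prime q := valP p.
Let p_gt1 : (1 < q)%N := prime_gt1 p_pr.

Lemma padic_intE (m : int) k : (m%:~R : Z) k = (m %% (q ^ k)%N%:Z)%Z.
Proof.
suff <- : padic_of_int p m = m%:~R by [].
have natE n : padic_of_int p n%:Z = n%:R.
  elim: n => [|n IHn]; first by apply: padicP.
  by rewrite mulrS -IHn; apply: padicP => j /=; rewrite modzDm.
case: m => n; first exact: natE.
rewrite NegzE mulrNz -[(n.+1 : int)%:~R]natE; apply: padicP => j /=.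
by rewrite modzNm.
Qed.

Lemma padic_natE (n k : nat) : (n%:R : Z) k = (n%:Z %% (q ^ k)%N%:Z)%Z.
Proof. by rewrite -padic_intE. Qed.

Lemma padic_0E k : (0 : Z) k = 0.
Proof. exact: mod0z. Qed.

Lemma padic_at0 a : a 0%N = 0.
Proof. by rewrite padic_coh expn0 modz1. Qed.

Lemma padic_at_eq a b k : (a k == b k) = ((a - b) k == 0).
Proof.
rewrite -[RHS]/(((a k + (- b k %% (q ^ k)%N%:Z)%Z) %% (q ^ k)%N%:Z)%Z == 0).
by rewrite modzDmr (sameP eqP dvdz_mod0P) -eqz_mod_dvd !padic_mod.
Qed.

(** Dividing by q^k costs k places of precision: component j of the quotient comes from component k
    + j of [a]. *)
Lemma padic_at_eq0P a k : reflect (exists d, a = q%:R ^+ k * d) (a k == 0).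
Proof.
have q_gt0 j : (q ^ j)%N%:Z != 0 by rewrite -lt0n expn_gt0 ltnW.
apply: (iffP eqP) => [ak0|[d ->]]; last first.
  rewrite -natrX -[LHS]/((_ * _ %% _)%Z) padic_natE modzz.
  by rewrite mul0r mod0z.
have dvd j : ((q ^ k)%N%:Z %| a (k + j)%N)%Z.
  by apply/dvdz_mod0P; rewrite padic_trunc.
have coh j : (a (k + j)%N %/ (q ^ k)%N%:Z)%Z
           = ((a (k + j.+1)%N %/ (q ^ k)%N%:Z)%Z %% (q ^ j)%N%:Z)%Z.
  have /dvdzP[e Ee] := dvd j.+1.
  have -> : a (k + j)%N = (e * (q ^ k)%N%:Z %% ((q ^ j)%N%:Z * (q ^ k)%N%:Z))%Z.
    by rewrite padic_coh -Ee addnS -PoszM -expnD (addnC j).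
  by rewrite -mulz_modl ?Ee ?mulzK // ltz_nat expn_gt0 ltnW.
exists (PadicInt coh); apply: padicP => j.
rewrite -natrX -[RHS]/((_ * _ %% _)%Z) padic_natE modzMml /=.
by rewrite mulrC divzK // addnC padic_trunc.
Qed.

(** The contraction principle: each application of F gains one place, so the k-th iterate of 0 is
    correct modulo q^k, and the diagonal of the iterates is the fixed point. *)
Lemma padic_fixpoint (F : Z -> Z) :
    (forall a b k, a k = b k -> F a k.+1 = F b k.+1) ->
  exists a, F a = a.
Proof.
move=> F_contr; pose s k := iter k F 0.
have sE k : s k k = s k.+1 k.
  elim: k => [|k IHk]; first by rewrite !padic_at0.
  exact: F_contr IHk.
have coh k : s k k = (s k.+1 k.+1 %% (q ^ k)%N%:Z)%Z by rewrite sE padic_coh.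
pose L : Z := PadicInt coh; exists L; apply: padicP => -[|k].
  by rewrite !padic_at0.
by rewrite (F_contr L (s k)).
Qed.

(** The cofactor is a function of a + b because the maps in view are affine or quadratic, and a^2 -
    b^2 = (a - b)(a + b). *)
Lemma padic_contract (F G : Z -> Z) :
    (forall a b, F a - F b = q%:R * (a - b) * G (a + b)) ->
  exists a, F a = a.
Proof.
move=> FG; apply: padic_fixpoint => a b k /eqP.
rewrite padic_at_eq => /padic_at_eq0P[d ab]; apply/eqP; rewrite padic_at_eq.
by apply/padic_at_eq0P; exists (d * G (a + b)); rewrite FG ab exprS; ring.
Qed.

Lemma padic_unitP u : reflect (u 1%N <> 0) (u \is a GRing.unit).
Proof.
apply: (iffP idP) => [u_unit u10|u10].
  have /eqP/padic_at_eq0P[d ud] := u10.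
  have := congr1 (fun a : Z => a 1%N) (mulVr u_unit).
  rewrite ud mulrCA expr1 -[LHS]/((_ * _ %% _)%Z) !padic_natE expn1 modzz mul0r.
  by rewrite mod0z -[RHS]/((1 %% (q ^ 1)%N%:Z)%Z) expn1 modz_small ?ltz_nat.
have [c cu] : exists c : Z, (c * u - 1) 1%N == 0.
  have co : coprimez (u 1%N) q%:Z.
    rewrite coprimezE coprime_sym prime_coprime //.
    apply/negP => q_dvd; apply: u10; rewrite -(padic_mod u 1) expn1.
    exact/dvdz_mod0P.
  have [[c e] /= ce] := coprimezP _ _ co; exists c%:~R.
  rewrite -(padic_at_eq (c%:~R * u) 1) -[X in X == _]/((c%:~R : Z) 1%N * u 1%N %% _)%Z.
  rewrite -[X in _ == X]/(1 %% _)%Z padic_intE modzMml expn1.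
  by rewrite -(modzMDl e) addrC ce.
have /padic_at_eq0P[d {}cu] := cu.
(* The Bezout coefficient c inverts u modulo q, so c u = 1 + q d; the fixed point x is the inverse
   of 1 + q d. *)
have [x Fx] : exists x : Z, 1 - q%:R * d * x = x.
  by apply: (@padic_contract _ (fun _ => - d)) => a b; ring.
apply/unitrPr; exists (x * c).
have -> : u * (x * c) = x * (c * u - 1) + x by ring.
by rewrite cu -[X in _ + X]Fx; ring.
Qed.

(* y = q t turns y^2 + y = q w into t = w - q t^2, whose right-hand side is
   a contraction. *)
Lemma padic_sqrt w : exists2 y : Z, y != 0 & y ^+ 2 = 1 + 4 * q%:R * w.
Proof.
suff [y yE] : exists y : Z, y ^+ 2 = 1 + 4 * q%:R * w.
  exists y => //; apply/eqP => y0.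
  have /padic_unitP := unitr1 Z; apply; apply/eqP/padic_at_eq0P.
  exists (- 4 * w); rewrite -[LHS](addrK (4 * q%:R * w)) -yE y0; ring.
have [t tE] : exists t : Z, w - q%:R * t ^+ 2 = t.
  by apply: (@padic_contract _ (fun s => - s)) => a b; ring.
exists (1 + 2 * q%:R * t).
have -> : w = t + q%:R * t ^+ 2 by rewrite -[X in X + _]tE subrK.
by ring.
Qed.

Lemma padic_int_neq0 (m : int) : m != 0 -> (m%:~R : Z) != 0.
Proof.
move=> m0; apply/eqP => /(congr1 (fun a : Z => a `|m|%N)).
rewrite padic_intE padic_0E => /dvdz_mod0P; rewrite dvdzE /= => /dvdn_leq.
by rewrite absz_gt0 => /(_ m0); rewrite leqNgt ltn_expl.
Qed.

Lemma padic_decomp a : a != 0 ->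
  exists k u, u \is a GRing.unit /\ a = q%:R ^+ k * u.
Proof.
move=> a0; have ex_k : exists k, a k != 0.
  apply: contrapT => no_k; case/eqP: a0; apply: padicP => k.
  by rewrite padic_0E; apply/eqP/contraT => ak; case: no_k; exists k.
(* The least precision at which [a] is visibly nonzero is one more than its valuation k, since
   component 0 always vanishes. *)
case: (ex_minnP ex_k) => -[|k] ak min_k; first by rewrite padic_at0 in ak.
have /padic_at_eq0P[u au] : a k == 0.
  by apply: contraT => /min_k; rewrite ltnn.
exists k, u; split=> //; apply/padic_unitP => u1; case/negP: ak.
have /eqP/padic_at_eq0P[d ud] := u1.
by apply/padic_at_eq0P; exists d; rewrite au ud mulrA expr1 exprSr.
Qed.

End PadicIntegers.

Section PadicField.
Variable p : primeT.
Local Notation q := (val p).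
Local Notation Z := (padic_int p).
Local Notation K := (padic p).
Local Notation "x %:F" := (@FracField.tofrac Z x).
Implicit Types (x y z : K) (u w : Z) (k l : int).

Let p_pr : prime q := valP p.
Let p_gt1 : (1 < q)%N := prime_gt1 p_pr.

Lemma padic_intF (m : int) : m%:~R = (m%:~R : Z)%:F.
Proof. by rewrite rmorph_int. Qed.

Lemma padic_int_eq0 (m : int) : ((m%:~R : K) == 0) = (m == 0).
Proof.
apply/idP/idP => [|/eqP->//]; apply: contraTT => m0.
by rewrite padic_intF tofrac_eq0 padic_int_neq0.
Qed.

Lemma padic_nat_eq0 (n : nat) : ((n%:R : K) == 0) = (n == 0%N).
Proof. exact: padic_int_eq0 n. Qed.

Local Notation pi := (q%:R : K).

Let pi0 : pi != 0.
Proof. by rewrite padic_nat_eq0 -lt0n ltnW. Qed.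

Let piX0 k : pi ^ k != 0.
Proof. exact: expfz_neq0. Qed.

Lemma padic_field_decomp x : x != 0 ->
  exists k u, u \is a GRing.unit /\ x = pi ^ k * u%:F.
Proof.
move=> x0; have [a [b [b0 xE]]] := frac_div x.
have a0 : a != 0.
  by apply: contraNneq x0 => a0; rewrite xE a0 rmorph0 mul0r.
have [k [u [uU aE]]] := padic_decomp a0; have [l [w [wU bE]]] := padic_decomp b0.
exists (k%:Z - l%:Z), (u / w); split; first by rewrite unitrM unitrV uU.
have w0 : w%:F != 0 by rewrite tofrac_eq0; apply: contraTneq wU => ->; rewrite unitr0.
have [c cE] : exists c, c = (u / w)%:F by eexists.
have uE : u%:F = c * w%:F by rewrite cE -tofracM divrK.
rewrite -cE xE aE bE !(tofracM, tofracXn) uE !rmorph_nat expfzDr // -exprnN.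
by rewrite invfM mulrACA -[c * _ * _]mulrA divff // mulr1.
Qed.

(** The exponent is picked by choice and is unique by [pval_uniq]; at 0 no decomposition exists and
    the default 0 is returned. *)
Definition pval x : int :=
  if pselect (exists k u, u \is a GRing.unit /\ x = pi ^ k * u%:F) is left ex
  then projT1 (cid ex) else 0.

Lemma pvalP x : x != 0 ->
  exists2 u, u \is a GRing.unit & x = pi ^ pval x * u%:F.
Proof.
move=> /padic_field_decomp ex; rewrite /pval; case: pselect => // ex'.
by case: (cid ex') => k [u [uU xE]] /=; exists u.
Qed.

Lemma pval_uniq k l u a : k < l -> u \is a GRing.unit -> pi ^ k * u%:F <> pi ^ l * a%:F.
Proof.
move=> lt_kl /padic_unitP u1 E; apply: u1.
have [j jE] : exists j : nat, l = k + j.+1%:Z.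
  by exists `|l - k|%N.-1; lia.
suff -> : u = q%:R ^+ 1 * (q%:R ^+ j * a).
  by apply/eqP/padic_at_eq0P; exists (q%:R ^+ j * a).
apply/eqP; rewrite -tofrac_eq; apply/eqP; apply: (mulfI (piX0 k)).
by rewrite E jE expfzDr // mulrA -exprD -mulrA !rmorphM rmorphXn rmorph_nat.
Qed.

Lemma pval_eq k u : u \is a GRing.unit -> pval (pi ^ k * u%:F) = k.
Proof.
move=> uU; have u0 : u%:F != 0.
  by rewrite tofrac_eq0; apply: contraTneq uU => ->; rewrite unitr0.
have [w wU E] := pvalP (mulf_neq0 (piX0 k) u0).
have [/pval_uniq lt|/pval_uniq gt|//] := ltgtP (pval (pi ^ k * u%:F)) k.
  by have := lt w u wU; rewrite -E.
by have := gt u w uU; rewrite -E.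
Qed.

Lemma pvalM x y : x != 0 -> y != 0 -> pval (x * y) = pval x + pval y.
Proof.
move=> /pvalP[u uU xE] /pvalP[w wU yE].
by rewrite {1}xE {1}yE mulrACA -expfzDr // -rmorphM pval_eq // unitrM uU.
Qed.

(** Membership in q^k Z_q, which needs no separate case for 0 and makes closure under addition
    immediate; it agrees with [vge pval]. *)
Definition pvge k x := exists a, x = pi ^ k * a%:F.

Lemma pvge0 k : pvge k 0.
Proof. by exists 0; rewrite rmorph0 mulr0. Qed.

Lemma pvgeD k x y : pvge k x -> pvge k y -> pvge k (x + y).
Proof. by move=> [a ->] [b ->]; exists (a + b); rewrite rmorphD mulrDr. Qed.

Lemma pvgeN k x : pvge k x -> pvge k (- x).
Proof. by move=> [a ->]; exists (- a); rewrite rmorphN mulrN. Qed.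

Lemma pvge_le k l x : k <= l -> pvge l x -> pvge k x.
Proof.
move=> le_kl [a ->]; exists (q%:R ^+ `|l - k|%N * a).
rewrite rmorphM rmorphXn rmorph_nat mulrA -[_ ^+ _]/(_ ^ `|l - k|%N%:Z).
by rewrite -expfzDr // gez0_abs ?subr_ge0 // subrKC.
Qed.

Lemma pvge_pval x : pvge (pval x) x.
Proof.
have [->|/pvalP[u _ xE]] := eqVneq x 0; first exact: pvge0.
by exists u.
Qed.

Lemma pvge_pvalP k x : x != 0 -> pvge k x <-> k <= pval x.
Proof.
move=> x0; split=> [[a xE]|le_k]; last exact: pvge_le le_k (pvge_pval x).
have [u uU xE'] := pvalP x0; rewrite leNgt; apply/negP => /pval_uniq lt.
by apply: (lt u a uU); rewrite -xE.
Qed.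

(** The quotient y / x is 1 + 4 q c with c integral, a square by [padic_sqrt]. The threshold is
    evaluated in [pval4]. *)
Lemma sim_close x y : x != 0 -> pvge (pval x + pval (4 * pi)) (y - x) -> sim y x.
Proof.
move=> x0 [a E].
have [w wU] := pvalP x0; move: E.
have [|w4 w4U] := @pvalP (4 * pi).
  by apply: mulf_neq0; [rewrite padic_nat_eq0 | exact: pi0].
move: (pval (4 * pi)) (pval x) => k4 k E4 E xE.
have {E}[c yE] : exists c, y - x = pi ^ (k + k4) * (c * w4 * w)%:F.
  by exists (a / (w4 * w)); rewrite -mulrA divrK // unitrM w4U.
have [s s0 sE] := padic_sqrt c.
exists s%:F; first by rewrite tofrac_eq0.
rewrite -tofracXn sE tofracD tofrac1 !tofracM !rmorph_nat -[y](subrK x) yE.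
rewrite expfzDr // !tofracM E4 xE.
move: (c%:F : K) (w4%:F : K) (w%:F : K) (pi ^ k : K) (pi ^ k4 : K).
by move=> c' f g h e; ring.
Qed.

Lemma pvge_int (k : nat) (m : int) :
  pvge k m%:~R <-> ((q ^ k)%N%:Z %| m)%Z.
Proof.
have atE : ((m%:~R : Z) k == 0) = ((q ^ k)%N%:Z %| m)%Z.
  by rewrite padic_intE (sameP eqP dvdz_mod0P).
split=> [[a]|].
  have qF : (q%:R : Z)%:F = pi by rewrite rmorph_nat.
  rewrite padic_intF -[pi ^ k]/(pi ^+ k) -qF -tofracXn -tofracM.
  by move/eqP; rewrite tofrac_eq -atE => /eqP ->; apply/padic_at_eq0P; exists a.
rewrite -atE => /padic_at_eq0P[d dE]; exists d.
by rewrite padic_intF dE rmorphM rmorphXn rmorph_nat.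
Qed.

Lemma pval_int (m : int) : m != 0 -> pval m%:~R = logn q `|m|%N.
Proof.
move=> m0; have m0' : (m%:~R : K) != 0 by rewrite padic_int_eq0.
have dvd (k : nat) : (k%:Z <= pval m%:~R) = (k <= logn q `|m|)%N.
  rewrite -pfactor_dvdn ?absz_gt0 //; apply/idP/idP.
    by move/(pvge_pvalP _ m0')/pvge_int; rewrite dvdzE.
  by move=> dv; apply/(pvge_pvalP _ m0')/pvge_int; rewrite dvdzE.
apply/eqP; rewrite eq_le dvd leqnn andbT.
have pos : 0 <= pval m%:~R by rewrite (dvd 0%N).
by rewrite -(gez0_abs pos) lez_nat -dvd gez0_abs.
Qed.

Lemma pval4 : pval (4 * pi) = if q == 2%N then 3 else 1.
Proof.
have q0 : (0 < q)%N by exact: ltnW.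
have -> : 4 * pi = ((4 * q)%N%:Z)%:~R by rewrite -pmulrn natrM.
rewrite pval_int; last by rewrite -lt0n muln_gt0.
rewrite absz_nat lognM // (@logn_prime q q p_pr) eqxx (_ : 4%N = (2 ^ 2)%N) //.
by rewrite lognX (@logn_prime q 2) //; case: (q == 2%N).
Qed.

Lemma unit_int_approx (n : nat) x : x != 0 -> pval x = 0 ->
  exists m : int, pvge n (x - m%:~R).
Proof.
move=> x0 vx; have [u uU] := pvalP x0; rewrite vx expr0z mul1r => ->.
have /padic_at_eq0P[d dE] : (u - (u n)%:~R) n == 0.
  by rewrite -padic_at_eq padic_intE padic_mod.
by exists (u n), d; rewrite padic_intF -rmorphB dE rmorphM rmorphXn rmorph_nat.
Qed.

Lemma padic_padic_like : padic_like q pval.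
Proof.
have vgeE k x : vge pval k x <-> pvge k x.
  have [->|x0] := eqVneq x 0; first by split=> _; [exact: pvge0 | left].
  by rewrite pvge_pvalP //; split=> [[x00|//]|]; [rewrite x00 eqxx in x0 | right].
split=> //.
- exact: padic_int_eq0.
- exact: pvalM.
- by move=> k x y /vgeE kx /vgeE ky; apply/vgeE/pvgeD.
- exact: pval_int.
- by move=> x y x0 /vgeE V; apply: sim_close => //; rewrite pval4.
- by move=> k x x0 /(unit_int_approx k x0)[m V]; exists m; apply/vgeE.
Qed.

End PadicField.

(** * The quadratic character of a finite field *)

Section QuadraticCharacter.
Variable F : finFieldType.
Implicit Types x y z a b c d g : F.

Lemma finField_generator : exists g, [/\ g != 0, forall x, x != 0 -> exists k, x = g ^+ k
  & forall k, (g ^+ k == 1) = (#|F|.-1 %| k)%N].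
Proof.
have /cyclicP[u uE] := field_unit_group_cyclic [set: {unit F}]%G.
have u_order : #[u]%g = #|F|.-1 by rewrite -card_finField_unit uE.
exists (FinRing.uval u); split=> [|x x0|k].
- by have := valP u; rewrite unitfE.
- have : finField_unit x0 \in <[u]>%g by rewrite -uE inE.
  by case/cycleP=> k /(congr1 FinRing.uval) /= ->; exists k; rewrite FinRing.val_unitX.
- by rewrite -FinRing.val_unitX -FinRing.val_unit1 (inj_eq val_inj) -u_order order_dvdn.
Qed.

Definition chi x : int :=
  if x == 0 then 0 else if [exists y : F, y ^+ 2 == x] then 1 else -1.

Lemma chi0 : chi 0 = 0.
Proof. by rewrite /chi eqxx. Qed.

Lemma chi_sqr x : x != 0 -> chi (x ^+ 2) = 1.
Proof.
move=> x0; rewrite /chi expf_eq0 (negPf x0) /=.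
by case: existsP => // -[]; exists x.
Qed.

Lemma chi1 : chi 1 = 1.
Proof. by rewrite -[1](expr1n _ 2) chi_sqr ?oner_neq0. Qed.

Lemma chi_eq1 x : chi x = 1 -> exists2 y, y != 0 & x = y ^+ 2.
Proof.
rewrite /chi; case: eqVneq => // x0; case: existsP => // -[y /eqP yx] _.
by exists y => //; apply: contraNneq x0 => y0; rewrite -yx y0 expr0n.
Qed.

Lemma chi_pm1 x : x != 0 -> chi x = 1 \/ chi x = -1.
Proof. by rewrite /chi => /negPf ->; case: existsP; [left | right]. Qed.

Hypothesis F_odd : (2 : F) != 0.

Lemma card_finField_odd : odd #|F|.
Proof.
apply: contraNT F_odd => F_even.
have := expf_card (-1 : F); rewrite -signr_odd (negPf F_even) expr0 => N1.
by rewrite (natrD _ 1 1) [X in _ + X]N1 subrr.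
Qed.

Local Notation m := (#|F|.-1./2).

Lemma card_finField_half : #|F|.-1 = (m.*2)%N.
Proof.
have := card_finField_odd; have := finNzRing_gt1 F; case: #|F| => // n _ /= n_even.
by rewrite even_halfK.
Qed.

Lemma half_gt0 : (0 < m)%N.
Proof. by rewrite -double_gt0 -card_finField_half -subn1 subn_gt0 finNzRing_gt1. Qed.

(** Only nonsquares need an argument. Their power is 1 or -1, and for x = g^k with g a generator,
    x^m = 1 would make 2m divide km, so k would be even and x a square. *)
Lemma chi_euler x : x ^+ m = (chi x)%:~R.
Proof.
have [->|x0] := eqVneq x 0.
  by rewrite chi0 expr0n -leqn0 leqNgt half_gt0.
have xm_sqr y : y != 0 -> (y ^+ 2) ^+ m = 1.
  move=> y0; rewrite -exprM mul2n -card_finField_half; apply: (mulIf y0).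
  by rewrite -exprSr mul1r prednK ?expf_card // ltnW ?finNzRing_gt1.
have [m1|m1] := eqVneq (chi x) 1.
  by have [y y0 ->] := chi_eq1 m1; rewrite xm_sqr // chi_sqr.
have -> : chi x = -1 by case: (chi_pm1 x0) m1 => ->.
have : (x ^+ m) ^+ 2 == 1 by rewrite exprAC xm_sqr.
rewrite sqrf_eq1 => /orP[/eqP xm1|/eqP-> //]; case/eqP: m1.
have [g [g0 gen ord]] := finField_generator; have [k xE] := gen x x0.
move: card_finField_half half_gt0 xm1; move: m => M E M_gt0 /eqP.
rewrite xE -exprM ord E -mul2n dvdn_pmul2r // => k2.
by rewrite -(divnK k2) exprM chi_sqr // expf_neq0.
Qed.

Lemma chiM x y : chi (x * y) = chi x * chi y.
Proof.
have [->|x0] := eqVneq x 0; first by rewrite mul0r chi0 mul0r.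
have [->|y0] := eqVneq y 0; first by rewrite mulr0 chi0 mulr0.
have /eqP : (chi (x * y))%:~R = (chi x * chi y)%:~R :> F.
  by rewrite -chi_euler exprMn !chi_euler intrM.
have neq11 : (1 == -1 :> F) = false by rewrite -subr_eq0 opprK (negPf F_odd).
case: (chi_pm1 x0) => ->; case: (chi_pm1 y0) => ->;
  case: (chi_pm1 (mulf_neq0 x0 y0)) => -> //;
  by rewrite ?mulr1 ?mul1r ?mulrNN ?rmorphN ?rmorph1 ?neq11 // eq_sym neq11.
Qed.

Lemma chi_ge x : -1 <= chi x.
Proof. by rewrite /chi; case: eqP => // _; case: existsP. Qed.

Lemma sum_chi_neq1 g : chi g = -1 -> \sum_x chi x = 0.
Proof.
move=> g1; have g0 : g != 0 by apply: contra_eq_neq g1 => ->; rewrite chi0.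
have : \sum_x chi x = - \sum_x chi x.
  rewrite {1}(reindex_inj (mulfI g0)) -sumrN; apply: eq_bigr => x _.
  by rewrite chiM g1 mulN1r.
lia.
Qed.

Lemma sum_chi : \sum_x chi x = 0.
Proof.
have [g [g0 gen ord]] := finField_generator.
apply: (@sum_chi_neq1 g).
have [g1|//] := chi_pm1 g0; have := chi_euler g; rewrite g1 => /eqP.
rewrite ord; move: card_finField_half half_gt0; move: m => M -> M_gt0.
by move/(dvdn_leq M_gt0); rewrite -addnn; lia.
Qed.


Lemma sum_chi_linear c : \sum_x chi (x + c) = 0.
Proof. by rewrite -[RHS]sum_chi [RHS](reindex_inj (addIr c)). Qed.

Lemma sum_chi_quadratic c d : c != d -> \sum_x chi ((x + c) * (x + d)) = -1.
Proof.
move=> cd; pose e := d - c; have e0 : e != 0 by rewrite subr_eq0 eq_sym.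
rewrite (reindex_inj (addIr (- c))) /=.
(* Dividing x (x + e) by the square x^2 does not change its character. As x runs over the nonzero
   elements, 1 + e / x takes every value except 1, so the sum is -chi 1. *)
transitivity (\sum_(x | x != 0) chi (1 + e * x^-1)).
  rewrite (bigD1 0) //= sub0r addNr mul0r chi0 add0r.
  apply: eq_bigr => x x0; rewrite subrK -[RHS]mul1r -(chi_sqr x0) -chiM.
  by congr (chi _); rewrite /e; field.
have : \sum_x chi (1 + e * x^-1) = 0.
  rewrite -[RHS](sum_chi_linear 1) [RHS](reindex_inj (mulfI e0)).
  by rewrite [RHS](reindex_inj invr_inj); apply: eq_bigr => x _; rewrite addrC.
by rewrite (bigD1 0) //= invr0 mulr0 addr0 chi1 addrC => /eqP; rewrite addr_eq0 => /eqP.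
Qed.

(* If the 2-covering had no point, each term of the sum of the
   (1 + chi (b1 x)) (1 + chi (b2 (x - n))) (1 + chi (b1 b2 (x + 3n))) would vanish,
   but the sum is at least [#|F| + 1 + \sum_x chi (x (x - n) (x + 3n)) >= 1]. *)
Lemma cov_finField n b1 b2 : (3 : F) != 0 -> n != 0 -> b1 != 0 -> b2 != 0 ->
  cov n b1 b2.
Proof.
move=> F_3 n0 b10 b20.
have b120 : b1 * b2 != 0 by rewrite mulf_neq0.
pose f x := (1 + chi (b1 * x)) * (1 + chi (b2 * (x - n)))
            * (1 + chi (b1 * b2 * (x + 3 * n))).
have f_cov x : f x != 0 -> cov n b1 b2.
  have sqr b y : b != 0 -> 1 + chi (b * y) != 0 -> exists z, y = b * z ^+ 2.
    move=> bn0; have [->|y0] := eqVneq y 0; first by exists 0; ring.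
    case: (chi_pm1 (mulf_neq0 bn0 y0)) => [/chi_eq1[z _ zE] _|-> //].
    by exists (z / b); rewrite expr_div_n -zE; field.
  rewrite !mulf_eq0 !negb_or => /andP[/andP[/(sqr _ _ b10)[z1 E1]]].
  move=> /(sqr _ _ b20)[z2 E2] /(sqr _ _ b120)[z3 E3].
  exists 1, z1, z2, z3; rewrite oner_neq0; split=> //.
    by rewrite -E1 -E2; ring.
  by rewrite -E1 -E3; ring.
(* The trivial class has the point at infinity. Otherwise (1 + chi b1)(1 + chi b2) = 0, and the
   three quadratic sums, each equal to -1, contribute +1 in total; for the trivial class they would
   contribute -3. *)
have [[b11 b21]|ab] :
    (chi b1 = 1 /\ chi b2 = 1) \/ chi b1 + chi b2 + chi b1 * chi b2 = -1.
- by case: (chi_pm1 b10) => ->; case: (chi_pm1 b20) => ->; [left|right|right|right].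
- have [[s s0 ->] [r r0 ->]] := (chi_eq1 b11, chi_eq1 b21).
  by apply: cov_sim (cov11 n); apply: sim1_sqr.
apply: contrapT => no_cov.
have : \sum_x f x = 0 by apply: big1 => x _; apply/eqP/contraT => /f_cov.
have fE x : f x = 1 + chi b1 * chi (x + 0) + chi b2 * chi (x - n)
    + (chi b1 * chi b2) * chi (x + 3 * n)
    + (chi b1 * chi b2) * chi ((x + 0) * (x - n))
    + chi b2 * chi ((x + 0) * (x + 3 * n))
    + chi b1 * chi ((x - n) * (x + 3 * n)) + chi (x * (x - n) * (x + 3 * n)).
  rewrite /f !chiM addr0.
  move: (chi x) (chi (x - n)) (chi (x + _)) => X Y Z.
  by case: (chi_pm1 b10) => ->; case: (chi_pm1 b20) => ->; ring.
rewrite (eq_bigr _ (fun x _ => fE x)) !big_split /= -!mulr_sumr.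
have n30 : 3 * n != 0 by rewrite mulf_neq0.
have n40 : 4 * n != 0 by rewrite mulf_neq0 // (natrM _ 2 2) mulf_neq0.
rewrite !sum_chi_linear !sum_chi_quadratic ?(eq_sym 0) ?oppr_eq0 //; last first.
  by rewrite -subr_eq0 -opprD oppr_eq0 (_ : n + 3 * n = 4 * n) //; ring.
have : \sum_x (1 + chi (x * (x - n) * (x + 3 * n))) >= 0.
  by apply: sumr_ge0 => x _; rewrite addrC -lerBlDr sub0r chi_ge.
rewrite big_split /=; move: (chi b1) (chi b2) ab => a b ab.
set C := (\sum_x 1); set S := (\sum_x chi (x * _ * _)) => S_ge /eqP.
have -> : C + a * 0 + b * 0 + a * b * 0 + a * b * -1 + b * -1 + a * -1 + S
   = (C + S) - (a + b + a * b) by ring.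
by rewrite ab; lia.
Qed.

End QuadraticCharacter.

(** * Quadratic reciprocity *)

Lemma Fp_nat_eq0 (p n : nat) : prime p -> ((n%:R : 'F_p) == 0) = (p %| n)%N.
Proof. by move=> p_pr; rewrite -(dvdn_pcharf (pchar_Fp p_pr)). Qed.

Lemma pcharf_int_eq0 (L : fieldType) (q : nat) (m : int) : q \in [pchar L] ->
  (m%:~R == 0 :> L) = (q%:Z %| m)%Z.
Proof.
move=> qL; rewrite dvdzE /= (dvdn_pcharf qL).
by case: m => n //; rewrite NegzE mulrNz oppr_eq0.
Qed.

Lemma Fp_int_eq0 (p : nat) (m : int) : prime p ->
  ((m%:~R : 'F_p) == 0) = (p%:Z %| m)%Z.
Proof. by move/pchar_Fp/pcharf_int_eq0. Qed.

Lemma Fp_two_neq0 p : prime p -> p != 2%N -> (2 : 'F_p) != 0.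
Proof.
by move=> p_pr p2; rewrite (Fp_nat_eq0 _ p_pr) dvdn_prime2.
Qed.

Lemma finField_unity_root (F : finFieldType) (k : nat) : (0 < k)%N ->
  (k %| #|F|.-1)%N -> exists2 z : F, z ^+ k = 1 & forall j, z ^+ j = 1 -> (k %| j)%N.
Proof.
move=> k0 /dvdnP[d dE]; have [g [g0 gen ord]] := finField_generator F.
have d0 : (0 < d)%N.
  rewrite lt0n; apply: contraTneq (finNzRing_gt1 F) => d0.
  by rewrite -leqNgt -[#|F|]prednK ?dE ?d0 // ltnW ?finNzRing_gt1.
exists (g ^+ d); first by apply/eqP; rewrite -exprM ord dE.
by move=> j /eqP; rewrite -exprM ord dE dvdn_pmul2l.
Qed.

Section GaussSum.
Variables (p : nat) (L : fieldType) (z : L).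
Hypotheses (p_pr : prime p) (p_odd : p != 2%N) (zp : z ^+ p = 1) (z1 : z != 1).
Implicit Types a b c : 'F_p.

Let e a : L := z ^+ a.

Let e_nat (n : nat) : e n%:R = z ^+ n.
Proof. by rewrite /e val_Fp_nat // expr_mod. Qed.

Let eD a b : e (a + b) = e a * e b.
Proof. by rewrite -[a]natr_Zp -[b]natr_Zp -natrD !e_nat exprD. Qed.

Let sum_e : \sum_a e a = 0.
Proof.
have : (z - 1) * \sum_a e a = 0.
  rewrite mulrBl mul1r {2}(reindex_inj (addIr 1)) mulr_sumr -sumrB big1 // => a _.
  by rewrite eD -[e 1]/(e 1%:R) e_nat expr1 mulrC subrr.
by move/eqP; rewrite mulf_eq0 subr_eq0 (negPf z1) => /eqP.
Qed.

Let sum_eM c : \sum_a e (a * c) = if c == 0 then p%:R else 0.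
Proof.
have [->|c0] := eqVneq c 0.
  under eq_bigr do rewrite mulr0 -[e 0]/(e 0%:R) e_nat.
  by rewrite sumr_const card_Fp.
by rewrite -[RHS]sum_e [RHS](reindex_inj (mulIf c0)).
Qed.

Definition gauss_sum : L := \sum_a (chi a)%:~R * e a.

Lemma gauss_sum_sqr : gauss_sum ^+ 2 = (chi (-1 : 'F_p))%:~R * p%:R.
Proof.
have F2 := Fp_two_neq0 p_pr p_odd.
(* In the double sum over a and b put b = a c: the characters combine to chi (a^2 c) = chi c, and
   the additive sum over all a survives only at c = -1. The subtracted 1 is the term a = 0. *)
transitivity (\sum_c (chi c)%:~R * (\sum_a e (a * (1 + c)) - 1)).
  under [RHS]eq_bigr => c _.
    rewrite (bigD1 0) //= mul0r -[e 0]/(e 0%:R) e_nat expr0 addrC addrK mulr_sumr.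
    over.
  rewrite exchange_big /= /gauss_sum expr2 mulr_suml (bigD1 0) //= chi0 !mul0r add0r.
  apply: eq_bigr => a a0; rewrite mulr_sumr (reindex_inj (mulfI a0)).
  apply: eq_bigr => c _; rewrite mulrACA -intrM -chiM // (mulrA a a) chiM // -expr2.
  by rewrite chi_sqr // mul1r -eD mulrDr mulr1.
under eq_bigr do rewrite mulrBr mulr1 sum_eM.
rewrite sumrB (bigD1 (-1)) //= subrr eqxx big1 => [|c cN1]; last first.
  by rewrite addrC addr_eq0 (negPf cN1) mulr0.
by rewrite addr0 -rmorph_sum /= sum_chi // subr0.
Qed.

(** Frobenius fixes the integer coefficients and replaces [e a] by [e (a q)]; reindexing pulls out
    chi q, its own inverse. *)
Lemma gauss_sum_frobenius (q : nat) : q \in [pchar L] -> (q%:R : 'F_p) != 0 ->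
  gauss_sum ^+ q = (chi (q%:R : 'F_p))%:~R * gauss_sum.
Proof.
move=> qL q0; have F2 := Fp_two_neq0 p_pr p_odd.
rewrite -(pFrobenius_autE qL) rmorph_sum mulr_sumr.
rewrite [RHS](reindex_inj (mulIf q0)); apply: eq_bigr => a _.
rewrite rmorphM rmorph_int /= pFrobenius_autE -exprM mulrA -intrM chiM // mulrCA.
rewrite -chiM // -expr2 chi_sqr // mulr1; congr (_ * _).
by rewrite -e_nat natrM natr_Zp.
Qed.

End GaussSum.

(** Frobenius acts on a square root t of P by the sign s, so P^((q-1)/2) = s in L. This is a
    congruence of integers modulo q, hence Euler's criterion applies in F_q. Both reciprocity and
    the character of 2 reduce to it by choosing t. *)
Lemma euler_transfer (q : nat) (L : fieldType) (P s : int) (t : L) :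
    prime q -> q != 2%N -> q \in [pchar L] ->
    t ^+ 2 = P%:~R -> ~~ (q%:Z %| P)%Z -> (s = 1 \/ s = -1) -> t ^+ q = s%:~R * t ->
  chi (P%:~R : 'F_q) = s.
Proof.
move=> q_pr q2 qL tP qP s1 tq; have F2 := Fp_two_neq0 q_pr q2.
have P0 : (P%:~R : L) != 0 by rewrite (pcharf_int_eq0 _ qL).
have t0 : t != 0 by rewrite -sqrf_eq0 tP.
have q_odd : odd q by case: (even_prime q_pr) q2 => [->|].
have PE : (P ^+ q.-1./2)%:~R = s%:~R :> L.
  apply: (mulIf t0); rewrite -tq rmorphXn /= -tP -exprM mul2n -exprSr.
  by congr (_ ^+ _); lia.
have : ((P ^+ q.-1./2 - s)%:~R : 'F_q) == 0.
  by rewrite Fp_int_eq0 // -(pcharf_int_eq0 _ qL) rmorphB /= PE subrr.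
have := chi_euler F2 P%:~R; rewrite card_Fp // => PE'.
rewrite rmorphB rmorphXn /= subr_eq0 PE' {PE PE'}.
have P0' : (P%:~R : 'F_q) != 0 by rewrite Fp_int_eq0.
have neq11 : (1 == -1 :> 'F_q) = false by rewrite -subr_eq0 opprK (negPf F2).
by case: (chi_pm1 P0') => ->; case: s1 => -> //;
  rewrite rmorphN rmorph1 ?neq11 // eq_sym neq11.
Qed.

Lemma quadratic_reciprocity (p q : nat) :
  prime p -> prime q -> p != 2%N -> q != 2%N -> p != q ->
  chi ((chi (-1 : 'F_p) * p%:Z)%:~R : 'F_q) = chi (q%:R : 'F_p).
Proof.
move=> p_pr q_pr p2 q2 pq.
have p1_gt0 : (0 < p.-1)%N by have := prime_gt1 p_pr; lia.
(* In the field with q^(p-1) elements p divides the order of the unit group, so there is a primitive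
   p-th root of unity. *)
have [L qL cardL] := pPrimePowerField q_pr p1_gt0.
have qp0 : (q%:R : 'F_p) != 0 by rewrite Fp_nat_eq0 // dvdn_prime2.
have [|z zp zj] := @finField_unity_root L p (prime_gt0 p_pr).
  rewrite cardL -subn1 -eqn_mod_dvd ?expn_gt0 ?prime_gt0 //.
  rewrite -(totient_prime p_pr) Euler_exp_totient ?eqxx //.
  by rewrite coprime_sym prime_coprime // dvdn_prime2.
have z1 : z != 1.
  apply/eqP => z1; have := zj 1%N; rewrite expr1 dvdn1 => /(_ z1)/eqP p1.
  by rewrite p1 in p_pr.
have N1 : (-1 : 'F_p) != 0 by rewrite oppr_eq0 oner_neq0.
apply: (@euler_transfer q L _ _ (gauss_sum p z)) => //.
- by rewrite gauss_sum_sqr // intrM.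
- case: (chi_pm1 N1) => ->; rewrite ?mul1r ?mulN1r dvdzE ?abszN /= dvdn_prime2 // eq_sym //.
- exact: chi_pm1.
- exact: gauss_sum_frobenius.
Qed.

(** Since 8 divides q^2 - 1, the field with q^2 elements contains a primitive eighth root of unity
    z. From z^4 = -1 one gets (z + 1/z)^2 = 2, and z^q depends only on q modulo 8. *)
Lemma chi_two (q : nat) : prime q -> q != 2%N ->
  chi (2 : 'F_q) = if (q %% 8 == 1)%N || (q %% 8 == 7)%N then 1 else -1.
Proof.
move=> q_pr q2; have [L qL cardL] := pPrimePowerField q_pr (isT : 0 < 2)%N.
have q_odd : odd q by case: (even_prime q_pr) q2 => [->|].
have q8odd : odd (q %% 8) by rewrite odd_mod.
have [|z z8 zj] := @finField_unity_root L 8 isT.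
  rewrite cardL -subn1 -eqn_mod_dvd ?expn_gt0 ?prime_gt0 //.
  by rewrite -modnXm; move: (q %% 8)%N (ltn_pmod q (isT : 0 < 8)%N) q8odd; do 8 case=> //.
have z4 : z ^+ 4 = -1.
  have : (z ^+ 4) ^+ 2 == 1 by rewrite -exprM z8.
  by rewrite sqrf_eq1 => /orP[/eqP/zj //|/eqP].
have z0 : z != 0.
  by apply/eqP => z0; move: z8; rewrite z0 expr0n => /eqP; rewrite eq_sym oner_eq0.
apply: (@euler_transfer q L 2 _ (z + z^-1)) => //.
- have -> : (z + z^-1) ^+ 2 = (z ^+ 4 + 2 * z ^+ 2 + 1) / z ^+ 2 by field.
  by rewrite z4 addrAC addNr add0r mulfK // sqrf_eq0.
- by rewrite dvdzE /= dvdn_prime2.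
- by case: ifP; [left|right].
rewrite -(pFrobenius_autE qL) rmorphD fmorphV /= pFrobenius_autE -(expr_mod _ z8).
have zE k : z ^+ (4 + k) = - z ^+ k by rewrite exprD z4 mulN1r.
have z3 : z ^+ 3 = - z^-1 by apply: (mulIf z0); rewrite -exprSr z4; field.
move: (q %% 8)%N (ltn_pmod q (isT : 0 < 8)%N) q8odd.
case=> [|[|[|[|[|[|[|[|//]]]]]]]] //= _ _.
- by rewrite expr1 mulr1z mul1r.
- by rewrite z3 invrN invrK mulrN1z mulN1r opprD addrC.
- by rewrite (zE 1%N : z ^+ 5 = _) expr1 invrN mulrN1z mulN1r opprD.
- by rewrite (zE 3 : z ^+ 7 = _) z3 opprK invrK mulr1z mul1r addrC.
Qed.

(** * Necessary local conditions *)

Section LocalImage.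
Variables (K : fieldType) (q : nat) (v : K -> int).
Hypothesis Kv : padic_like q v.
Local Notation par := (par v).
Implicit Types (x y z n b c : K).

Let two0 : (2 : K) != 0. Proof. by rewrite (pl_nat_eq0 Kv). Qed.
Let three0 : (3 : K) != 0. Proof. by rewrite (pl_nat_eq0 Kv). Qed.

(** Modulo squares b1 = b2 = b1 b2 forces both classes to be trivial. This settles the points near
    infinity, where n is negligible against x. *)
Lemma sim_trivial b1 b2 x y z : b1 != 0 -> b2 != 0 ->
    sim x b1 -> sim y b2 -> sim z (b1 * b2) -> sim y x -> sim z x ->
  sim b1 1 /\ sim b2 1.
Proof.
move=> b10 b20 S1 S2 S3 Sy Sz.
have S31 := sim_trans (sim_sym S3) (sim_trans Sz S1).
have Sb2 : sim b2 1.
  apply: sim_trans (sim_quot b10 (sim_refl b1) S31) _.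
  by rewrite -expr2; apply: sim1_sqr.
split=> //; apply: sim_trans Sb2.
exact: sim_trans (sim_sym S1) (sim_trans (sim_sym Sy) S2).
Qed.

(** For v x < 1 the point is near infinity, for v x > 1 it is near (0, 0), and for v x = 1 with x -
    n or x + 3n of valuation at least 2 it is near (n, 0) or (-3n, 0). Hensel's lemma then gives the
    class of the nearby torsion point. In the remaining case all three factors have valuation 1, and
    their product cannot be a square. *)
Lemma local_image_additive n b1 b2 : q != 2%N -> v 3 = 0 ->
    n != 0 -> v n = 1 -> b1 != 0 -> b2 != 0 -> cov n b1 b2 ->
  exists i j : bool, sim b1 (n ^+ i * (- 3) ^+ j) /\ sim b2 ((- n) ^+ j).
Proof.
move=> q2 v3 n0 vn b10 b20 C.
have [//|[x [S1 S2 S3]]] := cov_cases two0 three0 n0 b10 b20 C.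
have x0 := sim_neq0 S1 b10; have y0 := sim_neq0 S2 b20.
have b120 := mulf_neq0 b10 b20; have z0 := sim_neq0 S3 b120.
have V1 : vge v 1 n by rewrite -vn; apply: vge_val.
have n30 : 3 * n != 0 by apply: mulf_neq0.
have vn3 : v (3 * n) = 1 by rewrite (pl_valM Kv) // v3 vn.
have V3 : vge v 1 (3 * n) by rewrite -vn3; apply: vge_val.
have Nn0 : - n != 0 by rewrite oppr_eq0.
have vNn : v (- n) = 1 by rewrite (pl_valN Kv).
have [lt1|ge2|v1] := ltgtP (v x) 1.
- have le1 : v x + 1 <= 1 by rewrite lezD1.
  have Sy : sim (x - n) x.
    apply: (hensel_odd Kv) => //; apply: vge_le le1 _.
    by rewrite addrC addKr; apply: (vgeN Kv).
  have Sz : sim (x + 3 * n) x.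
    apply: (hensel_odd Kv) => //; apply: vge_le le1 _.
    by rewrite addrC addKr.
  by exists false, false; rewrite !expr0 mulr1; apply: sim_trivial S1 S2 S3 Sy Sz.
- have V2 : vge v 2 x by right; clear -ge2; lia.
  exists false, true; rewrite expr0 !expr1 mul1r.
  have Sb2 : sim b2 (- n).
    apply: sim_trans (sim_sym S2) _; apply: (hensel_odd Kv) => //.
    by rewrite vNn opprK subrK.
  have S3' : sim (b2 * b1) (3 * n).
    rewrite mulrC; apply: sim_trans (sim_sym S3) _; apply: (hensel_odd Kv) => //.
    by rewrite vn3 addrK.
  split=> //; apply: sim_trans (sim_quot Nn0 Sb2 S3') _.
  by exists n => //; ring.
have v4 : v 4 = 0.
  rewrite (pl_val_int Kv (m := 4)) // (_ : `|4| = 2 ^ 2)%N // lognX.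
  by rewrite (@logn_prime q 2) // (negPf q2).
have four0 : (4 : K) != 0 by rewrite (pl_nat_eq0 Kv).
have n40 : 4 * n != 0 by apply: mulf_neq0.
have S4 c : sim (4 * c) c by exists 2 => //; ring.
have vn4 : v (4 * n) = 1 by rewrite (pl_valM Kv) // v4 vn.
have [V2|nV2] := pselect (vge v 2 (x - n)).
  exists true, false; rewrite expr0 !expr1 mulr1.
  have Sb1 : sim b1 n.
    apply: sim_trans (sim_sym S1) _; apply: (hensel_odd Kv) => //.
    by rewrite vn.
  have S3' : sim (b1 * b2) n.
    apply: sim_trans (sim_sym S3) _; apply: sim_trans (S4 n).
    apply: (hensel_odd Kv) => //.
    by rewrite vn4 (_ : _ - _ = x - n) //; ring.
  split=> //; apply: sim_trans (sim_quot n0 Sb1 S3') _.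
  by rewrite -expr2; apply: sim1_sqr.
have [V2'|nV2'] := pselect (vge v 2 (x + 3 * n)).
  exists true, true; rewrite !expr1; split.
    apply: sim_trans (sim_sym S1) _; apply: (hensel_odd Kv) => //.
      by rewrite mulrN oppr_eq0 mulrC.
    by rewrite mulrN (pl_valN Kv) opprK (mulrC n) vn3.
  apply: sim_trans (sim_sym S2) _; apply: sim_trans (S4 _).
  apply: (hensel_odd Kv) => //; first by rewrite mulrN oppr_eq0.
  by rewrite mulrN (pl_valN Kv) vn4 (_ : _ - _ = x + 3 * n) //; ring.
have Vx : vge v 1 x by rewrite -v1; apply: vge_val.
have [|_ vy] := val_exact (x := x - n) (k := 1) _ nV2; first exact: (vgeB Kv).
have [|_ vz] := val_exact (x := x + 3 * n) (k := 1) _ nV2'; first exact: (pl_vgeD Kv).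
have := par_sim Kv b120 S3; rewrite (parM Kv) //.
by rewrite -(par_sim Kv b10 S1) -(par_sim Kv b20 S2) /par v1 vy vz.
Qed.

Lemma par_unit x : v x = 0 -> par x = false.
Proof. by rewrite /par => ->. Qed.

(** The trace left on valuations by the equation of the curve: x (x - n)(x + 3n) is a square. *)
Lemma par_cov_point n b1 b2 x : b1 != 0 -> b2 != 0 ->
    sim x b1 -> sim (x - n) b2 -> sim (x + 3 * n) (b1 * b2) ->
  par (x + 3 * n) = par x (+) par (x - n).
Proof.
move=> b10 b20 S1 S2 S3; rewrite (par_sim Kv (mulf_neq0 b10 b20) S3).
by rewrite (parM Kv) // (par_sim Kv b10 S1) (par_sim Kv b20 S2).
Qed.

(** If v x < 0 the three factors have the same valuation, which is even because its triple is.
    Otherwise n, 3n and 4n are units, so at most one factor is not a unit, and its valuation is even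
    because the product is a square. *)
Lemma local_image_good n b1 b2 : q != 2%N -> v 3 = 0 ->
    n != 0 -> v n = 0 -> b1 != 0 -> b2 != 0 -> cov n b1 b2 ->
  par b1 = false /\ par b2 = false.
Proof.
move=> q2 v3 n0 vn b10 b20 C.
have Nn0 : - n != 0 by rewrite oppr_eq0.
have vNn : v (- n) = 0 by rewrite (pl_valN Kv).
have N30 : (- 3 : K) != 0 by rewrite oppr_eq0.
have vN3 : v (- 3) = 0 by rewrite (pl_valN Kv).
have parX b (i : bool) : b != 0 -> v b = 0 -> par (b ^+ i) = false.
  by move=> b0 vb; rewrite par_unit // (pl_valX Kv) // vb mul0rn.
have [[i [j [S1 S2]]]|[x [S1 S2 S3]]] := cov_cases two0 three0 n0 b10 b20 C.
  rewrite (par_sim Kv _ S1) ?mulf_neq0 ?expf_neq0 // (parM Kv) ?expf_neq0 //.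
  by rewrite (par_sim Kv _ S2) ?expf_neq0 // !parX.
have x0 := sim_neq0 S1 b10; have y0 := sim_neq0 S2 b20.
have n30 : 3 * n != 0 by apply: mulf_neq0.
have vn3 : v (3 * n) = 0 by rewrite (pl_valM Kv) // v3 vn.
have := par_cov_point b10 b20 S1 S2 S3.
rewrite -(par_sim Kv b10 S1) -(par_sim Kv b20 S2).
have [lt0|gt0|v0] := ltgtP (v x) 0.
- have le1 : v x + 1 <= 0 by rewrite lezD1.
  have [|_ vy] := val_close Kv (x := x) (y := x - n) x0.
    by rewrite [x - n]addrC addrK; right; rewrite vNn.
  have [|_ vz] := val_close Kv (x := x) (y := x + 3 * n) x0.
    by rewrite [x + _]addrC addrK; right; rewrite vn3.
  by rewrite /par vy vz; case: odd.
- have [|_ vy] := val_close Kv (x := - n) (y := x - n) Nn0.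
    by rewrite addrK; right; rewrite vNn -gtz0_ge1.
  have [|_ vz] := val_close Kv (x := 3 * n) (y := x + 3 * n) n30.
    by rewrite addrK; right; rewrite vn3 -gtz0_ge1.
  have py : par (x - n) = false by rewrite par_unit ?vy.
  have pz : par (x + 3 * n) = false by rewrite par_unit ?vz.
  by rewrite py pz addbF.
rewrite (par_unit v0) addFb => E; split=> //.
have [V1|nV1] := pselect (vge v 1 (x - n)); last first.
  have [|_ vy] := val_exact (x := x - n) (k := 0) _ nV1; last exact: par_unit.
  by apply: (vgeB Kv); right; rewrite ?v0 ?vn.
have v4 : v 4 = 0.
  rewrite (pl_val_int Kv (m := 4)) // (_ : `|4| = 2 ^ 2)%N // lognX.
  by rewrite (@logn_prime q 2) // (negPf q2).
have four0 : (4 : K) != 0 by rewrite (pl_nat_eq0 Kv).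
have vn4 : v (4 * n) = 0 by rewrite (pl_valM Kv) // v4 vn.
rewrite -E par_unit //; rewrite -vn4.
have [||//] := val_close Kv (x := 4 * n) (y := x + 3 * n); first exact: mulf_neq0.
by rewrite vn4 (_ : _ - _ = x - n) //; ring.
Qed.

(** The roots 0 and -3n meet modulo 3. If v x > 0 then x - n is close to -n, so b2 is the class of
    -n, and v x must be odd. If v x <= 0 then x + 3n is close to x, so b2 is trivial, and v x is
    even. *)
Lemma local_image_3 n b1 b2 : q = 3%N ->
    n != 0 -> v n = 0 -> b1 != 0 -> b2 != 0 -> cov n b1 b2 ->
  par b2 = false /\ sim b2 ((- n) ^+ par b1).
Proof.
move=> q3 n0 vn b10 b20 C.
have q2 : q != 2%N by rewrite q3.
have v3 : v 3 = 1 by rewrite (pl_val_int Kv (m := 3)) // q3.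
have Nn0 : - n != 0 by rewrite oppr_eq0.
have vNn : v (- n) = 0 by rewrite (pl_valN Kv).
have N30 : (- 3 : K) != 0 by rewrite oppr_eq0.
have parX b (i : bool) : b != 0 -> v b = 0 -> par (b ^+ i) = false.
  by move=> b0 vb; rewrite par_unit // (pl_valX Kv) // vb mul0rn.
have [[i [j [S1 S2]]]|[x [S1 S2 S3]]] := cov_cases two0 three0 n0 b10 b20 C.
  rewrite (par_sim Kv _ S1) ?mulf_neq0 ?expf_neq0 // (parM Kv) ?expf_neq0 //.
  rewrite (par_sim Kv _ S2) ?expf_neq0 // (parX n) // (parX (- n)) //; split=> //.
  suff -> : par ((- 3) ^+ j) = j by [].
  by case: j {S1 S2}; rewrite /par ?expr0 ?expr1 ?(pl_val1 Kv) // (pl_valN Kv) v3.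
have x0 := sim_neq0 S1 b10; have y0 := sim_neq0 S2 b20.
have n30 : 3 * n != 0 by apply: mulf_neq0.
have vn3 : v (3 * n) = 1 by rewrite (pl_valM Kv) // v3 vn.
have := par_cov_point b10 b20 S1 S2 S3.
rewrite -(par_sim Kv b10 S1) -(par_sim Kv b20 S2).
have [gt0|le0] := ltP 0 (v x).
  have Sy : sim (x - n) (- n).
    by apply: (hensel_odd Kv) => //; rewrite opprK subrK vNn; right; rewrite -gtz0_ge1.
  rewrite (par_sim Kv Nn0 Sy) (par_unit vNn) addbF => E; split=> //.
  suff -> : par x = true by apply: sim_trans (sim_sym S2) Sy.
  (* An even positive v x is at least 2, which leaves x + 3n with the odd valuation of 3n while x
     and x - n have even valuation. *)
  apply: contraT => /negPf px.
  have ge2 : 2 <= v x by move: px gt0; rewrite /par; clear; lia.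
  have [|_ vz] := val_close Kv (x := 3 * n) (y := x + 3 * n) n30.
    by rewrite addrK vn3; right.
  by move: E; rewrite px /par vz vn3.
have Sz : sim (x + 3 * n) x.
  apply: (hensel_odd Kv) => //; rewrite [x + _]addrC addrK; right.
  by rewrite vn3 gerDr.
have S12 := sim_trans (sim_sym S3) (sim_trans Sz S1).
have Sb2 : sim b2 1.
  apply: sim_trans (sim_quot b10 (sim_refl b1) S12) _.
  by rewrite -expr2; apply: sim1_sqr.
have p2 : par b2 = false.
  by rewrite (par_sim Kv _ Sb2) ?oner_neq0 // par_unit ?(pl_val1 Kv).
move=> _; suff -> : par x = false by rewrite (par_sim Kv b20 S2).
move: le0; rewrite le_eqVlt => /orP[/eqP v0|lt0]; first exact: par_unit.
have Sy : sim (x - n) x.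
  apply: (hensel_odd Kv) => //; rewrite [x - n]addrC addrK; right.
  by rewrite vNn lezD1.
have [Sb1 _] := sim_trivial b10 b20 S1 S2 S3 Sy Sz.
rewrite (par_sim Kv _ (sim_trans S1 Sb1)) ?oner_neq0 // par_unit //.
exact: pl_val1 Kv.
Qed.

(** The residue field has two elements, so the unit x / y is 1 modulo 2. The digit gained over the
    ultrametric inequality is what brings the estimates at 2 up to the threshold of Hensel's
    lemma. *)
Lemma same_val_2 x y : q = 2%N -> x != 0 -> y != 0 -> v x = v y ->
  vge v (v x + 1) (x - y).
Proof.
move=> q2 x0 y0 vxy; pose u := x / y.
have u0 : u != 0 by rewrite mulf_neq0 ?invr_eq0.
have xE : x = u * y by rewrite divfK.
have vu : v u = 0.
  by apply: (addIr (v y)); rewrite -(pl_valM Kv) // -xE add0r.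
have [m Vm] := pl_approx Kv 1 u0 vu.
have m_odd : ~~ (q%:Z %| m)%Z.
  apply/negP => dv; have Vm' : vge v 1 m%:~R by apply/(vge_int Kv 1); rewrite expn1.
  by have /(vgeP _ _ u0) := vge_add Kv Vm Vm'; rewrite vu.
have Vu : vge v 1 (u - 1).
  have -> : u - 1 = (u - m%:~R) + (m - 1)%:~R by rewrite rmorphB /=; ring.
  apply: (pl_vgeD Kv) => //; apply/(vge_int Kv 1).
  by move: m_odd; rewrite q2; clear; lia.
rewrite (_ : x - y = y * (u - 1)); last by rewrite xE; ring.
by rewrite vxy; apply: (vgeM Kv) => //; apply: vge_val.
Qed.

(** Both x - 1 and x + 1 are divisible by 2, and one of them by 4. *)
Lemma sqr_unit_2 x : q = 2%N -> x != 0 -> v x = 0 -> vge v 3 (x ^+ 2 - 1).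
Proof.
move=> q2 x0 vx; have v2 : v 2 = 1 by rewrite (pl_val_int Kv (m := 2)) // q2.
have V1 : vge v 1 (x - 1).
  have := same_val_2 q2 x0 (oner_neq0 K); rewrite vx (pl_val1 Kv); exact.
rewrite (_ : _ - 1 = (x - 1) * (x + 1)); last by ring.
have [V2|nV2] := pselect (vge v 2 (x - 1)).
  apply: (vgeM Kv V2 (l := 1)); rewrite (_ : x + 1 = (x - 1) + 2); last by ring.
  by apply: (pl_vgeD Kv) => //; right; rewrite v2.
have [x10 vx1] := val_exact V1 nV2.
have Nv2 : v (- 2) = 1 by rewrite (pl_valN Kv).
apply: (vgeM Kv V1 (l := 2)).
have := same_val_2 q2 x10 (y := - 2); rewrite vx1 Nv2 oppr_eq0 => /(_ two0 erefl).
by rewrite (_ : _ - - 2 = x + 1) //; ring.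
Qed.

Lemma local_image_2 n b1 b2 : q = 2%N ->
    n != 0 -> v n = 1 -> b1 != 0 -> b2 != 0 -> cov n b1 b2 ->
  sim b1 (n ^+ par b1 * (- 3) ^+ par b2).
Proof.
move=> q2 n0 vn b10 b20 C.
have v2 : v 2 = 1 by rewrite (pl_val_int Kv (m := 2)) // q2.
have v3 : v 3 = 0 by rewrite (pl_val_int Kv (m := 3)) // q2.
have v4 : v 4 = 2 by rewrite (pl_val_int Kv (m := 4)) // q2.
have Nn0 : - n != 0 by rewrite oppr_eq0.
have vNn : v (- n) = 1 by rewrite (pl_valN Kv).
have N30 : (- 3 : K) != 0 by rewrite oppr_eq0.
have vN3 : v (- 3) = 0 by rewrite (pl_valN Kv).
have four0 : (4 : K) != 0 by rewrite (pl_nat_eq0 Kv).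
have n30 : 3 * n != 0 by apply: mulf_neq0.
have vn3 : v (3 * n) = 1 by rewrite (pl_valM Kv) // v3 vn.
have n40 : 4 * n != 0 by apply: mulf_neq0.
have vn4 : v (4 * n) = 3 by rewrite (pl_valM Kv) // v4 vn.
have n20 : 2 * n != 0 by apply: mulf_neq0.
have vn2 : v (2 * n) = 2 by rewrite (pl_valM Kv) // v2 vn.
have [[i [j [S1 S2]]]|[x [S1 S2 S3]]] := cov_cases two0 three0 n0 b10 b20 C.
  have parX b (k : bool) : b != 0 -> par (b ^+ k) = par b && k.
    by case: k => _; rewrite ?andbT // andbF par_unit // (pl_val1 Kv).
  have -> : par b1 = i.
    rewrite (par_sim Kv _ S1) ?mulf_neq0 ?expf_neq0 // (parM Kv) ?expf_neq0 //.
    by rewrite !parX // (par_unit vN3) addbF /par vn.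
  by rewrite (_ : par b2 = j) // (par_sim Kv _ S2) ?expf_neq0 // parX // /par vNn.
have x0 := sim_neq0 S1 b10; have y0 := sim_neq0 S2 b20.
have b120 := mulf_neq0 b10 b20; have z0 := sim_neq0 S3 b120.
apply: sim_trans (sim_sym S1) _.
have := par_cov_point b10 b20 S1 S2 S3.
rewrite -(par_sim Kv b10 S1) -(par_sim Kv b20 S2).
(* The class of x can also be read off the product of the other two factors. This decides the cases
   v x = 0 and v x >= 2, where x itself need not be close to a known class. *)
have Syz : sim x ((x - n) * (x + 3 * n)).
  apply: sim_sym; apply: sim_trans (simM S2 S3) _.
  apply: sim_trans (sim_sym S1).
  by exists b2 => //; ring.
have yE : x - n - x = - n by rewrite addrC addrA addNr add0r.
have zE : x + 3 * n - x = 3 * n by rewrite addrC addrA addNr add0r.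
have [le_m2|ge_m1] := leP (v x) (- 2).
  have le1 : v x + 3 <= 1 by clear -le_m2; lia.
  have Sy : sim (x - n) x.
    by apply: (hensel_2 Kv) => //; rewrite yE; right; rewrite vNn.
  have Sz : sim (x + 3 * n) x.
    by apply: (hensel_2 Kv) => //; rewrite zE; right; rewrite vn3.
  have [Sb1 Sb2] := sim_trivial b10 b20 S1 S2 S3 Sy Sz.
  have p1 : par 1 = false by rewrite par_unit // (pl_val1 Kv).
  have px : par x = false.
    by rewrite (par_sim Kv (oner_neq0 K) (sim_trans S1 Sb1)).
  have py : par (x - n) = false.
    by rewrite (par_sim Kv (oner_neq0 K) (sim_trans S2 Sb2)).
  by rewrite px py !expr0 mulr1 => _; apply: sim_trans S1 Sb1.
have [lt0|gt0|v0] := ltgtP (v x) 0.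
- have vx : v x = -1 by clear -lt0 ge_m1; lia.
  have [|_ vy] := val_close Kv (x := x) (y := x - n) x0.
    by rewrite yE; right; rewrite vNn vx.
  have [|_ vz] := val_close Kv (x := x) (y := x + 3 * n) x0.
    by rewrite zE; right; rewrite vn3 vx.
  by rewrite /par vy vz vx.
- have [v1|ge2] := leP (v x) 1; last first.
    have ge2' : 2 <= v x by clear -ge2; lia.
    have [|_ vy] := val_close Kv (x := - n) (y := x - n) Nn0.
      by rewrite opprK subrK; right; rewrite vNn.
    have [|_ vz] := val_close Kv (x := 3 * n) (y := x + 3 * n) n30.
      by rewrite addrK; right; rewrite vn3.
    have py : par (x - n) = true by rewrite /par vy vNn.
    have pz : par (x + 3 * n) = true by rewrite /par vz vn3.
    rewrite py pz; case px: (par x) => // _; rewrite expr0 expr1 mul1r.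
    apply: sim_trans Syz _; apply: sim_trans (sim_sqr (- 3) n0).
    apply: (hensel_2 Kv) => //; first by rewrite mulf_neq0 ?expf_neq0.
    rewrite (pl_valM Kv) ?expf_neq0 // vN3 (pl_valX Kv) // vn.
    (* The target -3n^2 has valuation 2, so x (x + 2n) must reach 5. For v x = 2 the second factor
       gains a digit by [same_val_2]; v x = 3 is excluded by parity; from 4 on the estimate is
       immediate. *)
    rewrite (_ : _ - _ = x * (x - - (2 * n))); last by ring.
    have [le2|ge3] := leP (v x) 2.
      have vx2 : v x = 2 by apply/eqP; rewrite eq_le le2.
      apply: (vgeM Kv (k := 2) (l := 3)); first by right; rewrite vx2.
      have := same_val_2 q2 x0 (y := - (2 * n)); rewrite vx2 (pl_valN Kv) vn2 oppr_eq0.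
      by move=> /(_ n20 erefl).
    have ge4 : 4 <= v x by move: px ge3; rewrite /par; clear; lia.
    apply: (vgeM Kv (k := 4) (l := 1)); first by right.
    apply: (vgeB Kv); first by right; apply: le_trans ge4.
    by right; rewrite (pl_valN Kv) vn2.
  have vx : v x = 1 by apply/eqP; rewrite eq_le v1 -gtz0_ge1.
  have Vy : vge v 2 (x - n) by have := same_val_2 q2 x0 n0; rewrite vx vn; apply.
  have px : par x = true by rewrite /par vx.
  have yz : x + 3 * n - (x - n) = 4 * n by ring.
  have ge2 : 2 <= v (x - n) by apply/vgeP.
  rewrite px expr1; have [le2|ge3] := leP (v (x - n)) 2.
    have vy : v (x - n) = 2 by apply/eqP; rewrite eq_le le2.
    have [|_ vz] := val_close Kv (x := x - n) (y := x + 3 * n) y0.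
      by rewrite yz vy; right; rewrite vn4.
    by rewrite /par vz vy.
  have [le3|ge4] := leP (v (x - n)) 3.
    have vy : v (x - n) = 3 by apply/eqP; rewrite eq_le le3.
    have -> : par (x - n) = true by rewrite /par vy.
    move=> _; rewrite expr1; apply: (hensel_2 Kv) => //; first exact: mulf_neq0.
    rewrite (pl_valM Kv) // vn vN3.
    (* Both x - n and 4n have valuation 3, so x + 3n reaches 4, which suffices near -3n of valuation
       1. *)
    rewrite (_ : _ - _ = (x - n) - - (4 * n)); last by ring.
    have := same_val_2 q2 y0 (y := - (4 * n)); rewrite vy (pl_valN Kv) vn4 oppr_eq0.
    by move=> /(_ n40 erefl).
  have [|_ vz] := val_close Kv (x := 4 * n) (y := x + 3 * n) n40.
    by rewrite (_ : _ - _ = x - n); [rewrite vn4; right | ring].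
  have -> : par (x + 3 * n) = true by rewrite /par vz vn4.
  case: (par (x - n)) => // _; rewrite expr0 mulr1.
  by apply: (hensel_2 Kv) => //; rewrite vn; right.
have [|_ vy] := val_close Kv (x := x) (y := x - n) x0.
  by rewrite yE; right; rewrite vNn v0.
rewrite (par_unit v0) (par_unit (x := x - n)) ?vy // !expr0 mulr1 => _.
apply: sim_trans Syz _; apply: (hensel_2 Kv); rewrite ?oner_neq0 // (pl_val1 Kv).
(* Here 2x and 3n both have valuation 1, so their difference reaches 2, and n contributes the third
   digit needed for a square. *)
rewrite (_ : _ - 1 = (x ^+ 2 - 1) + n * (2 * x - 3 * n)); last by ring.
apply: (pl_vgeD Kv); first exact: sqr_unit_2.
apply: (vgeM Kv (k := 1) (l := 2)); first by right; rewrite vn.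
have x20 : 2 * x != 0 by apply: mulf_neq0.
have vx2 : v (2 * x) = 1 by rewrite (pl_valM Kv) // v2 v0.
by have := same_val_2 q2 x20 n30; rewrite vx2 vn3; apply.
Qed.

End LocalImage.

(** * Additive Legendre symbols and sufficient local conditions *)

Lemma F2P (x : 'F_2) : x = 0 \/ x = 1.
Proof. by case: x => -[|[|//]] ?; [left|right]; apply: val_inj. Qed.

Lemma F2_addrr (x : 'F_2) : x + x = 0.
Proof. by case: (F2P x) => ->; apply: val_inj. Qed.

Lemma F2_addr_eq0 (x y : 'F_2) : x + y = 0 <-> x = y.
Proof. by split=> [|->]; [case: (F2P x) (F2P y) => -> [] -> | exact: F2_addrr]. Qed.

Definition res8 (a : int) : nat := `|(a %% 8)%Z|%N.
(* For odd a, [eps a] and [om a] are (a - 1) / 2 and (a ^ 2 - 1) / 8 modulo 2. *)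
Definition eps (a : int) : 'F_2 := (res8 a \in [:: 3; 7])%:R.
Definition om (a : int) : 'F_2 := (res8 a \in [:: 3; 5])%:R.

Lemma res8M a b : res8 (a * b) = (res8 a * res8 b %% 8)%N.
Proof. by rewrite /res8 -modzMm; lia. Qed.

Lemma res8_odd a : ~~ (2 %| a)%Z -> res8 a \in [:: 1; 3; 5; 7].
Proof.
move=> a_odd; rewrite !inE /res8; lia.
Qed.

Lemma epsM a b : ~~ (2 %| a)%Z -> ~~ (2 %| b)%Z -> eps (a * b) = eps a + eps b.
Proof.
move=> /res8_odd Ha /res8_odd Hb; rewrite /eps res8M.
move: Ha Hb; rewrite !inE => /or4P[] /eqP-> /or4P[] /eqP->; exact: val_inj.
Qed.

Lemma omM a b : ~~ (2 %| a)%Z -> ~~ (2 %| b)%Z -> om (a * b) = om a + om b.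
Proof.
move=> /res8_odd Ha /res8_odd Hb; rewrite /om res8M.
move: Ha Hb; rewrite !inE => /or4P[] /eqP-> /or4P[] /eqP->; exact: val_inj.
Qed.

Lemma eps_om_eq0 a : ~~ (2 %| a)%Z ->
  eps a = 0 /\ om a = 0 <-> (8 %| a - 1)%Z.
Proof.
move=> /res8_odd Ha; have -> : (8 %| a - 1)%Z = (res8 a == 1%N) by rewrite /res8; lia.
rewrite /eps /om; move: Ha; rewrite !inE => /or4P[] /eqP->; split=> //.
- by case=> /eqP.
- by case=> _ /eqP.
- by case=> /eqP.
Qed.

Lemma legendre_chi (a : int) (q : nat) : prime q ->
  legendre a q = chi (a%:~R : 'F_q).
Proof.
move=> q_pr; rewrite /legendre /chi Fp_int_eq0 //; case: ifP => // qa.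
have sqrE (n : nat) : (n%:Z ^+ 2 == a %[mod q%:Z])%Z = (n%:R ^+ 2 == a%:~R :> 'F_q).
  by rewrite eqz_mod_dvd -(Fp_int_eq0 _ q_pr) rmorphB rmorphXn /= subr_eq0.
congr (if _ then _ else _); apply/existsP/existsP => [[x]|[y]].
  by rewrite sqrE; exists (x : nat)%:R.
have yq : (y < q)%N by rewrite -[X in (_ < X)%N](Fp_cast q_pr).
by move=> yE; exists (Ordinal yq); rewrite sqrE /= natr_Zp.
Qed.

Lemma addlegendreE (a : int) (q : nat) : prime q ->
  addlegendre a q = (chi (a%:~R : 'F_q) == -1)%:R.
Proof.
move=> q_pr; rewrite /addlegendre legendre_chi // /chi.
by case: eqP => // _; case: existsP.
Qed.

Section AddLegendre.
Variable q : nat.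
Hypotheses (q_pr : prime q) (q_odd : q != 2%N).
Local Notation L a := (addlegendre a q).

Let F2 := Fp_two_neq0 q_pr q_odd.

Lemma addlegendre_eq0 (a : int) : ~~ (q%:Z %| a)%Z ->
  L a = 0 <-> chi (a%:~R : 'F_q) = 1.
Proof.
move=> qa; have a0 : (a%:~R : 'F_q) != 0 by rewrite Fp_int_eq0.
by rewrite addlegendreE //; case: (chi_pm1 a0) => ->.
Qed.

Lemma addlegendreM (a b : int) : ~~ (q%:Z %| a)%Z -> ~~ (q%:Z %| b)%Z ->
  L (a * b) = L a + L b.
Proof.
move=> qa qb; rewrite !addlegendreE // intrM chiM //.
have a0 : (a%:~R : 'F_q) != 0 by rewrite Fp_int_eq0.
have b0 : (b%:~R : 'F_q) != 0 by rewrite Fp_int_eq0.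
by case: (chi_pm1 a0) => ->; case: (chi_pm1 b0) => ->; apply: val_inj.
Qed.

Lemma q_res8 : res8 q \in [:: 1; 3; 5; 7].
Proof.
apply: res8_odd; rewrite dvdzE /= dvdn_prime2 // eq_sym //.
Qed.

Lemma addlegendreN1 : L (-1) = eps q.
Proof.
have := chi_euler F2 (-1); rewrite card_Fp // addlegendreE //.
have N10 : (-1 : 'F_q) != 0 by rewrite oppr_eq0 oner_neq0.
have neq11 : (1 == -1 :> 'F_q) = false by rewrite -subr_eq0 opprK (negPf F2).
rewrite -signr_odd rmorphN1 /eps.
have -> : odd q.-1./2 = (res8 q \in [:: 3; 7]).
  by have := q_res8; rewrite !inE /res8; lia.
case: (chi_pm1 N10) => ->; case: (_ \in _) => //= /eqP.
  by rewrite eq_sym neq11.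
by rewrite neq11.
Qed.

Lemma addlegendre2 : L 2 = om q.
Proof.
rewrite addlegendreE // (chi_two q_pr q_odd) /om /res8 modz_nat absz_nat.
have := q_res8; rewrite /res8 modz_nat absz_nat !inE.
by case/or4P=> /eqP ->.
Qed.

End AddLegendre.

Lemma ndvd_primes (p q : nat) : prime p -> prime q -> p != q -> ~~ (q%:Z %| p%:Z)%Z.
Proof. by move=> p_pr q_pr pq; rewrite dvdzE /= dvdn_prime2 // eq_sym. Qed.

Lemma ndvdN1 (q : nat) : prime q -> ~~ (q%:Z %| (-1)%R)%Z.
Proof. by move=> q_pr; rewrite dvdzE /= dvdn1 neq_ltn prime_gt1 ?orbT. Qed.

Lemma addlegendre_reciprocity (p q : nat) : prime p -> prime q ->
    p != 2%N -> q != 2%N -> p != q ->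
  addlegendre p q + addlegendre q p = eps p * eps q.
Proof.
move=> p_pr q_pr p2 q2 pq; have Q := quadratic_reciprocity p_pr q_pr p2 q2 pq.
have L' : addlegendre q p = addlegendre (chi (-1 : 'F_p) * p%:Z) q.
  by rewrite !addlegendreE // Q.
have N10 : (-1 : 'F_p) != 0 by rewrite oppr_eq0 oner_neq0.
rewrite L' -(addlegendreN1 p_pr p2) (addlegendreE (-1) p_pr) rmorphN1.
case: (chi_pm1 N10) => ->; first by rewrite mul1r mul0r F2_addrr.
rewrite addlegendreM ?ndvdN1 ?ndvd_primes // addlegendreN1 // mul1r addrC.
by rewrite -addrA F2_addrr addr0.
Qed.

(** The sign term of reciprocity with 3 is the symbol of -1, which cancels. This is how the
    condition at 3 comes to be written with r_{-3}. *)
Lemma addlegendreN3 (q : nat) : prime q -> q != 2%N -> q != 3%N ->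
  addlegendre (-3) q = addlegendre q 3.
Proof.
move=> q_pr q2 q3; rewrite (_ : -3 = -1 * 3%:Z) //.
rewrite addlegendreM ?ndvdN1 ?ndvd_primes // 1?eq_sym // addlegendreN1 //.
have := @addlegendre_reciprocity 3 q isT q_pr isT q2; rewrite eq_sym => /(_ q3).
rewrite (_ : eps 3 = 1) ?mul1r; last exact: val_inj.
by move=> <-; rewrite addrAC F2_addrr add0r.
Qed.

Section LocalInt.
Variables (K : fieldType) (q : nat) (v : K -> int).
Hypothesis Kv : padic_like q v.
Implicit Types (a b m n : int) (x y : K).

Let q_pr := pl_prime Kv.
Let int0 m : (m%:~R != 0 :> K) = (m != 0). Proof. by rewrite (pl_int_eq0 Kv). Qed.

Lemma ndvd_neq0 m : ~~ (q%:Z %| m)%Z -> m != 0.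
Proof. by apply: contraNneq => ->; rewrite dvdz0. Qed.

Lemma sim_lift a b : q != 2%N -> ~~ (q%:Z %| b)%Z ->
  sim (a%:~R : 'F_q) b%:~R -> sim (a%:~R : K) b%:~R.
Proof.
move=> q2 qb [s s0 E]; pose c : int := (s : nat)%:Z.
have cE : c%:~R = s by rewrite -pmulrn natr_Zp.
have qc : ~~ (q%:Z %| c)%Z by rewrite -Fp_int_eq0 // cE.
have qbc : ~~ (q%:Z %| b * c ^+ 2)%Z.
  by rewrite -Fp_int_eq0 // rmorphM rmorphXn /= cE mulf_neq0 ?expf_neq0 ?Fp_int_eq0.
have bc0 : ((b * c ^+ 2)%:~R : K) != 0 by rewrite int0 ndvd_neq0.
have S : sim (a%:~R : K) (b * c ^+ 2)%:~R.
  apply: (hensel_odd Kv) => //; rewrite (val_int_unit Kv) // -rmorphB.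
  apply/(vge_int Kv 1); rewrite expn1 -(Fp_int_eq0 _ q_pr).
  by rewrite rmorphB rmorphM rmorphXn /= cE E subrr.
apply: sim_trans S _; rewrite rmorphM rmorphXn; apply: sim_sqr.
by rewrite int0 ndvd_neq0.
Qed.

Lemma sim1_addlegendre a : q != 2%N -> ~~ (q%:Z %| a)%Z ->
  sim (a%:~R : K) 1 <-> addlegendre a q = 0.
Proof.
move=> q2 qa; rewrite addlegendre_eq0 //; split=> [[s s0]|/chi_eq1[s s0 E]]; last first.
  apply: (sim_lift (b := 1)) => //; first by rewrite -Fp_int_eq0 // oner_neq0.
  by exists s; rewrite ?mul1r.
rewrite mul1r => E; have vs : v s = 0.
  by have := val_int_unit Kv qa; rewrite E (pl_valX Kv) //; lia.
have [c Vc] := pl_approx Kv 1 s0 vs.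
have : (q%:Z %| a - c ^+ 2)%Z.
  rewrite -[q]expn1; apply/(vge_int Kv 1); rewrite rmorphB rmorphXn /= E subr_sqr.
  apply: (vgeM Kv (k := 1) (l := 0)) => //.
  have c0 : vge v 0 c%:~R by apply/(vge_int Kv 0); rewrite expn0 dvd1z.
  by apply: (pl_vgeD Kv) => //; right; rewrite vs.
rewrite -Fp_int_eq0 // rmorphB rmorphXn subr_eq0 => /eqP aE.
rewrite aE chi_sqr //; apply: contraNneq qa => c0.
by rewrite -Fp_int_eq0 // aE /= c0 expr0n.
Qed.

Lemma sim1_eps_om a : q = 2%N -> ~~ (2 %| a)%Z ->
  sim (a%:~R : K) 1 <-> eps a = 0 /\ om a = 0.
Proof.
move=> q2 a_odd; have qa : ~~ (q%:Z %| a)%Z by rewrite q2.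
have vgeE : vge v 3 (a%:~R - 1) <-> (8 %| a - 1)%Z.
  have -> : a%:~R - 1 = (a - 1)%:~R :> K by rewrite rmorphB.
  by rewrite (vge_int Kv 3) q2.
rewrite eps_om_eq0 // -vgeE; split=> [[s s0]|V].
  rewrite mul1r => E; have vs : v s = 0.
    by have := val_int_unit Kv qa; rewrite E (pl_valX Kv) //; lia.
  by rewrite E; apply: (sqr_unit_2 Kv).
by apply: (hensel_2 Kv); rewrite ?oner_neq0 ?(pl_val1 Kv).
Qed.

Let two0 : (2 : K) != 0. Proof. by rewrite (pl_nat_eq0 Kv). Qed.
Let three0 : (3 : K) != 0. Proof. by rewrite (pl_nat_eq0 Kv). Qed.

(** The dichotomy of [cov_cases] is applied over F_q: either b1, b2 are torsion classes modulo q, or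
    some x has its three factors nonzero in the required classes. Square classes of units lift from
    F_q to K, so either alternative lifts. *)
Lemma cov_good n b1 b2 : q != 2%N -> q != 3%N -> ~~ (q%:Z %| n)%Z ->
  ~~ (q%:Z %| b1)%Z -> ~~ (q%:Z %| b2)%Z -> cov (n%:~R : K) b1%:~R b2%:~R.
Proof.
move=> q2 q3 qn qb1 qb2.
have F2 := Fp_two_neq0 q_pr q2.
have F3 : (3 : 'F_q) != 0 by rewrite (Fp_nat_eq0 _ q_pr) dvdn_prime2.
have [Fn Fb1 Fb2] : [/\ (n%:~R : 'F_q) != 0, (b1%:~R : 'F_q) != 0 & (b2%:~R : 'F_q) != 0].
  by rewrite !Fp_int_eq0.
have [Kn Kb1 Kb2] : [/\ (n%:~R : K) != 0, (b1%:~R : K) != 0 & (b2%:~R : K) != 0].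
  by rewrite !int0 !ndvd_neq0.
case: (cov_cases F2 F3 Fn Fb1 Fb2 (cov_finField F2 F3 Fn Fb1 Fb2)).
  move=> [i [j [S1 S2]]].
  have FX m (k : bool) : (m%:~R : 'F_q) != 0 -> ((m ^+ k)%:~R : 'F_q) != 0.
    by move=> m0; rewrite rmorphXn expf_neq0.
  apply: (@cov_torsion _ _ _ _ 1 1 i j); rewrite ?oner_neq0 ?mulr1 //; first exact: cov11.
    rewrite (_ : _ * _ = (n ^+ i * (- 3) ^+ j)%:~R); last by rewrite rmorphM !rmorphXn.
    apply: sim_lift => //; last by rewrite rmorphM !rmorphXn.
    by rewrite -Fp_int_eq0 // rmorphM !rmorphXn mulf_neq0 // expf_neq0 // rmorphN oppr_eq0.
  rewrite (_ : _ ^+ _ = ((- n) ^+ j)%:~R); last by rewrite rmorphXn rmorphN.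
  apply: sim_lift => //; last by rewrite rmorphXn rmorphN.
  by rewrite -Fp_int_eq0 // rmorphXn expf_neq0 // rmorphN oppr_eq0.
move=> [x [S1 S2 S3]]; pose c : int := (x : nat)%:Z.
have cE : c%:~R = x by rewrite -pmulrn natr_Zp.
apply: (cov_point (x := c%:~R)) => //.
- by apply: sim_lift; rewrite ?cE.
- by rewrite -rmorphB; apply: sim_lift; rewrite // rmorphB /= cE.
rewrite -(rmorphM _ b1) (_ : _ + _ = (c + 3 * n)%:~R); last by rewrite rmorphD rmorphM.
apply: sim_lift; rewrite // ?rmorphD ?rmorphM /= ?cE //.
by rewrite -Fp_int_eq0 // rmorphM mulf_neq0.
Qed.

(** Torsion reduces to the class (c, 1) with c a unit, that is, to (1, 1) or (-1, 1). The latter is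
    the torsion class (n, 1) if n is -1 modulo 3. If n is 1 modulo 3 it comes from x = -1, since
    then -1 - n is 1 modulo 3. *)
Lemma cov_at_3 n c b1 b2 (j : bool) : q = 3%N -> ~~ (3 %| n)%Z -> ~~ (3 %| c)%Z ->
    sim (b1%:~R : K) ((- 3) ^+ j * c%:~R) -> sim (b2%:~R : K) ((- n%:~R) ^+ j) ->
  cov (n%:~R : K) b1%:~R b2%:~R.
Proof.
move=> q3 n3 c3 S1 S2; have q2 : q != 2%N by rewrite q3.
have [Kn Kc] : (n%:~R : K) != 0 /\ (c%:~R : K) != 0.
  by split; rewrite int0; [apply: contraNneq n3 | apply: contraNneq c3] => ->; rewrite dvdz0.
have sim1 m : (3 %| m - 1)%Z -> sim (m%:~R : K) 1.
  move=> m1; apply: (hensel_odd Kv); rewrite ?oner_neq0 // (pl_val1 Kv).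
  have -> : m%:~R - 1 = (m - 1)%:~R :> K by rewrite rmorphB.
  by apply/(vge_int Kv 1); rewrite q3.
have simN1 m : (3 %| m + 1)%Z -> sim (m%:~R : K) (-1).
  move=> m1; apply: (hensel_odd Kv) => //.
    by rewrite oppr_eq0 oner_neq0.
  rewrite (pl_valN Kv) (pl_val1 Kv) opprK.
  have -> : m%:~R + 1 = (m + 1)%:~R :> K by rewrite rmorphD.
  by apply/(vge_int Kv 1); rewrite q3.
suff C : cov (n%:~R : K) c%:~R 1.
  by apply: (@cov_torsion _ _ _ _ c%:~R 1 false j); rewrite ?oner_neq0 ?expr0 ?mul1r ?mulr1.
have C11 := cov11 (n%:~R : K).
have [/sim1 Sc|/simN1 Sc] : (3 %| c - 1)%Z \/ (3 %| c + 1)%Z by lia.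
  exact: cov_sim Sc (sim_refl 1) C11.
have [n1|/simN1 Sn] : (3 %| n - 1)%Z \/ (3 %| n + 1)%Z by lia.
  apply: (cov_point (x := -1)); rewrite ?oner_neq0 //; first exact: sim_sym.
    have -> : -1 - n%:~R = (-1 - n)%:~R :> K by rewrite rmorphB rmorphN1.
    by apply: sim1; lia.
  rewrite mulr1; apply: sim_trans (sim_sym Sc).
  rewrite (_ : _ + _ = (-1 + 3 * n)%:~R); first by apply: simN1; lia.
  by rewrite rmorphD rmorphM rmorphN1.
apply: (@cov_torsion _ _ _ _ 1 1 true false); rewrite ?oner_neq0 ?expr0 ?expr1 ?mulr1 //.
  exact: sim_trans Sc (sim_sym Sn).
exact: sim_refl.
Qed.

(** The class (1, 1 - n), which supplements torsion, comes from x = 1: for even n the numbers 1 + 3n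
    and 1 - n differ by 4n, a multiple of 8, and have the same class. *)
Lemma cov_at_2 n b1 b2 (i j k : bool) : q = 2%N -> n != 0 -> (2 %| n)%Z ->
    sim (b1%:~R : K) (n%:~R ^+ i * (- 3) ^+ j) ->
    sim (b2%:~R : K) ((- n%:~R) ^+ j * (1 - n)%:~R ^+ k) ->
  cov (n%:~R : K) b1%:~R b2%:~R.
Proof.
move=> q2 n0 n2 S1 S2; have Kn : (n%:~R : K) != 0 by rewrite int0.
have n1_odd : ~~ (q%:Z %| 1 - n)%Z by rewrite q2; lia.
have n10 : ((1 - n)%:~R : K) != 0 by rewrite int0 ndvd_neq0.
have C : cov (n%:~R : K) 1 ((1 - n)%:~R ^+ k).
  case: k {S2}; rewrite ?expr0; last exact: cov11.
  rewrite expr1; apply: (cov_point (x := 1)); rewrite ?oner_neq0 //.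
  - exact: sim_refl.
  - by rewrite rmorphB; apply: sim_refl.
  rewrite mul1r; apply: (hensel_2 Kv) => //; rewrite (val_int_unit Kv) //.
  rewrite (_ : _ - _ = (4 * n)%:~R); last by rewrite rmorphB rmorphM /=; ring.
  by apply/(vge_int Kv 3); rewrite q2; lia.
apply: (cov_torsion (i := i) (j := j) _ _ _ _ _ C); rewrite ?oner_neq0 ?mulr1 //.
by rewrite expf_neq0.
Qed.

End LocalInt.

(** * The rows of the Monsky matrix *)

Section MonskyRows.
Variables (t : nat) (p : 'I_t -> nat).
Variable v : 'cV['F_2]_(6 + (t + t)).

(* [vtop 0], [vtop 1], [vtop 2] are xi1, xi2, xi3 and [vtop 3], [vtop 4], [vtop 5]
   are gamma1, gamma2, gamma3. *)
Definition vtop (k : nat) : 'F_2 := usubmx v (inord k) 0.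
Definition vy (i : 'I_t) : 'F_2 := usubmx (dsubmx v) i 0.
Definition vx (i : 'I_t) : 'F_2 := dsubmx (dsubmx v) i 0.

Lemma big_ord6 (f : 'I_6 -> 'F_2) :
  \sum_i f i = f (inord 0) + f (inord 1) + f (inord 2) + f (inord 3)
             + f (inord 4) + f (inord 5).
Proof.
rewrite !big_ord_recl big_ord0 addr0 !addrA.
by do ![congr (_ + _)]; congr f; apply: val_inj; rewrite /= inordK.
Qed.

Lemma row_block_mul m (T : 'M['F_2]_(m, 6)) (U W : 'M['F_2]_(m, t)) i :
  (row_mx T (row_mx U W) *m v) i 0 =
    T i (inord 0) * vtop 0 + T i (inord 1) * vtop 1 + T i (inord 2) * vtop 2
    + T i (inord 3) * vtop 3 + T i (inord 4) * vtop 4 + T i (inord 5) * vtop 5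
    + \sum_j U i j * vy j + \sum_j W i j * vx j.
Proof.
rewrite -[v in LHS]vsubmxK -[dsubmx v in LHS]vsubmxK !mul_row_col !mxE big_ord6.
by rewrite !addrA.
Qed.

Lemma B1_kernel : B1 p *m v = 0 <->
  [/\ vtop 0 + vtop 3 = 0,
      vtop 3 + addlegendre_prod p (-1) * vtop 4 + vtop 5
        + \sum_j addlegendre (-1) (p j) * vx j = 0,
      vtop 1 + addlegendre_prod p 2 * vtop 4 + vtop 5
        + \sum_j addlegendre 2 (p j) * vx j = 0,
      vtop 0 + vtop 1 + addlegendre_prod p (-3) * vtop 5
        + \sum_j addlegendre (-3) (p j) * vy j = 0
    & vtop 2 = 0] /\
  (forall i, addlegendre (-1) (p i) * vtop 3 + addlegendre 2 (p i) * vtop 4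
     + addlegendre 3 (p i) * vtop 5 + addlegendre (-3) (p i) * vy i
     + (\sum_j Amat p i j * vx j + addlegendre 2 (p i) * vx i) = 0) /\
  (forall i, addlegendre (-1) (p i) * vtop 0 + addlegendre 2 (p i) * vtop 1
     + addlegendre 3 (p i) * vtop 2
     + (\sum_j Amat p i j * vy j + addlegendre (-2) (p i) * vy i) = 0).
Proof.
have diagE (d : 'rV['F_2]_t) (w : 'I_t -> 'F_2) i :
    \sum_j diag_mx d i j * w j = d 0 i * w i.
  rewrite (bigD1 i) //= mxE eqxx mulr1n big1 ?addr0 // => j ji.
  by rewrite mxE eq_sym (negPf ji) mulr0n mul0r.
have addE (A B : 'M['F_2]_t) (w : 'I_t -> 'F_2) i :
    \sum_j (A + B) i j * w j = \sum_j A i j * w j + \sum_j B i j * w j.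
  by rewrite -big_split; apply: eq_bigr => j _; rewrite mxE mulrDl.
have zeroE m (w : 'I_t -> 'F_2) (i : 'I_m) : \sum_j (0 : 'M['F_2]_(m, t)) i j * w j = 0.
  by apply: big1 => j _; rewrite mxE mul0r.
have rE d (w : 'I_t -> 'F_2) :
    \sum_j rvec p d 0 j * w j = \sum_j addlegendre d (p j) * w j.
  by apply: eq_bigr => j _; rewrite mxE.
have mul0P m (M : 'M['F_2]_(m, 6 + (t + t))) : M *m v = 0 <-> forall i, (M *m v) i 0 = 0.
  split=> [-> i|M0]; first by rewrite mxE.
  by apply/matrixP => i j; rewrite (ord1 j) M0 mxE.
rewrite /B1 !mul_col_mx.
have col0P m1 m2 (X : 'cV['F_2]_m1) (Y : 'cV['F_2]_m2) : col_mx X Y = 0 <-> X = 0 /\ Y = 0.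
  split=> [E|[-> ->]]; last exact: col_mx0.
  by apply: eq_col_mx; rewrite E col_mx0.
rewrite !col0P !mul0P.
have blockE c1 c2 c3 c4 c5 c6 U W i :
    (block_row c1 c2 c3 c4 c5 c6 U W *m v) i 0 =
    c1 i 0 * vtop 0 + c2 i 0 * vtop 1 + c3 i 0 * vtop 2 + c4 i 0 * vtop 3
    + c5 i 0 * vtop 4 + c6 i 0 * vtop 5 + \sum_j U i j * vy j + \sum_j W i j * vx j.
  by rewrite row_block_mul !mxE !inordK.
have scalE a1 a2 a3 a4 a5 a6 u w :
    (scalar_row a1 a2 a3 a4 a5 a6 u w *m v) 0 0 =
    a1 * vtop 0 + a2 * vtop 1 + a3 * vtop 2 + a4 * vtop 3
    + a5 * vtop 4 + a6 * vtop 5 + \sum_j u 0 j * vy j + \sum_j w 0 j * vx j.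
  by rewrite row_block_mul !mxE !inordK.
have rows5 (s : seq 'rV['F_2]_(6 + (t + t))) :
    (forall i, ((\matrix_(i < 5) s`_i) *m v) i 0 = 0) <->
    [/\ (s`_0 *m v) 0 0 = 0, (s`_1 *m v) 0 0 = 0, (s`_2 *m v) 0 0 = 0,
        (s`_3 *m v) 0 0 = 0 & (s`_4 *m v) 0 0 = 0].
  have rE' i : ((\matrix_(i < 5) s`_i) *m v) i 0 = (s`_i *m v) 0 0.
    transitivity ((row i (\matrix_(i < 5) s`_i) *m v) 0 0).
      by rewrite -row_mul [RHS]mxE.
    by rewrite rowK.
  split=> [H|[H0 H1 H2 H3 H4] i].
    by split; [move: (H (@Ordinal 5 0 isT)) | move: (H (@Ordinal 5 1 isT))
      | move: (H (@Ordinal 5 2 isT)) | move: (H (@Ordinal 5 3 isT))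
      | move: (H (@Ordinal 5 4 isT))]; rewrite rE'.
  rewrite rE'; case: i => -[|[|[|[|[|//]]]]] ?; assumption.
rewrite rows5 /= !scalE !zeroE !rE !mul1r !mul0r !add0r !addr0.
have blk1 i : \sum_j (Amat p + Dmat p 2) i j * vx j
    = \sum_j Amat p i j * vx j + addlegendre 2 (p i) * vx i.
  by rewrite addE diagE mxE.
have blk2 i : \sum_j (Amat p + Dmat p (- 2)) i j * vy j
    = \sum_j Amat p i j * vy j + addlegendre (- 2) (p i) * vy i.
  by rewrite addE diagE mxE.
split=> [[S [H1 H2]]|[S [H1 H2]]]; split=> //; split=> i.
- by move: (H1 i); rewrite blockE !mxE !mul0r !add0r diagE mxE blk1.
- by move: (H2 i); rewrite blockE !mxE !mul0r zeroE !addr0 blk2.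
- by rewrite blockE !mxE !mul0r !add0r diagE mxE blk1.
- by rewrite blockE !mxE !mul0r zeroE !addr0 blk2.
Qed.

End MonskyRows.

(** * Local conditions as linear equations *)

(** Square classes have exponent 2. Comparing a with b thus becomes a triviality test for a b, on
    which additive symbols can be evaluated once the even power of the prime is removed. *)
Lemma sim1E (K : fieldType) (a b : K) : b != 0 -> sim a b <-> sim (a * b) 1.
Proof.
move=> b0; have S2 : sim (b * b) 1 by rewrite -expr2; apply: sim1_sqr.
split=> S; first exact: sim_trans (simM S (sim_refl b)) S2.
by have := sim_div b0 S; rewrite mul1r.
Qed.

Lemma sim_left (K : fieldType) (a b c : K) : sim a b -> sim a c <-> sim b c.
Proof. by move=> S; split; apply: sim_trans => //; apply: sim_sym. Qed.

Lemma eq0_iff (V : nmodType) (a b : V) : a = b -> a = 0 <-> b = 0.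
Proof. by move=> ->. Qed.

Lemma F2_odd (e : 'F_2) : (odd e : nat) = e.
Proof. by case: (F2P e) => ->. Qed.

Lemma ndvdM (q : nat) (a b : int) : prime q ->
  ~~ (q%:Z %| a)%Z -> ~~ (q%:Z %| b)%Z -> ~~ (q%:Z %| a * b)%Z.
Proof.
by move=> q_pr; rewrite !dvdzE abszM /= Euclid_dvdM // negb_or => -> ->.
Qed.

Lemma ndvd1 (q : nat) : prime q -> ~~ (q%:Z %| 1)%Z.
Proof. by move=> q_pr; rewrite dvdzE /= dvdn1 neq_ltn prime_gt1 ?orbT. Qed.

Lemma ndvdX (q : nat) (a : int) k : prime q -> ~~ (q%:Z %| a)%Z -> ~~ (q%:Z %| a ^+ k)%Z.
Proof.
move=> q_pr qa; elim: k => [|k IHk]; last by rewrite exprS ndvdM.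
exact: ndvd1.
Qed.

Lemma ndvd_prod (q : nat) (I : finType) (P : pred I) (c : I -> int) : prime q ->
  (forall i, P i -> ~~ (q%:Z %| c i)%Z) -> ~~ (q%:Z %| \prod_(i | P i) c i)%Z.
Proof.
move=> q_pr qc; apply: (big_ind (fun a => ~~ (q%:Z %| a)%Z)) => //; first exact: ndvd1.
by move=> a b; apply: ndvdM.
Qed.

(** * Additive symbols on the integers prime to q, instantiated by Legendre symbols, [eps] and
    [om] *)

Section Symbol.
Variables (q : nat) (phi : int -> 'F_2).
Hypothesis q_pr : prime q.
Hypothesis phiM : forall a b, ~~ (q%:Z %| a)%Z -> ~~ (q%:Z %| b)%Z ->
  phi (a * b) = phi a + phi b.

Let q1 := ndvd1 q_pr.

Lemma phi1 : phi 1 = 0.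
Proof. by rewrite -[1]mulr1 phiM // F2_addrr. Qed.

Lemma phiX a (e : 'F_2) : ~~ (q%:Z %| a)%Z -> phi (a ^+ e) = phi a * e.
Proof. by move=> qa; case: (F2P e) => ->; rewrite ?mulr0 ?phi1 ?mulr1 ?expr1. Qed.

Lemma phi_prod (I : finType) (P : pred I) (c : I -> int) :
    (forall i, P i -> ~~ (q%:Z %| c i)%Z) ->
  phi (\prod_(i | P i) c i) = \sum_(i | P i) phi (c i).
Proof.
move=> qc; suff [] : phi (\prod_(i | P i) c i) = \sum_(i | P i) phi (c i)
    /\ ~~ (q%:Z %| \prod_(i | P i) c i)%Z by [].
apply: (big_ind2 (fun a b => phi a = b /\ ~~ (q%:Z %| a)%Z)).
- by rewrite phi1.
- by move=> a b a' b' [<- qa] [<- qa']; rewrite phiM // ndvdM.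
- by move=> i /qc.
Qed.

End Symbol.

Ltac ndvd := repeat first [done | apply: ndvdM | apply: ndvdX].

Local Notation Nq q a := (~~ (q%:Z %| (a%R : int))%Z).

Lemma val_form (K : fieldType) q (v : K -> int) (e : 'F_2) (u : int) :
  padic_like q v -> Nq q u -> v (q%:Z ^+ e * u)%:~R = e.
Proof.
move=> Kv qu; have u0 : u != 0 by apply: contraNneq qu => ->; rewrite dvdz0.
have q0 : q%:Z != 0 by have := prime_gt0 (pl_prime Kv); lia.
rewrite rmorphM rmorphXn (pl_valM Kv) ?expf_neq0 ?(pl_int_eq0 Kv) //.
rewrite (pl_valX Kv) ?(pl_int_eq0 Kv) // (val_int_unit Kv qu) addr0.
by rewrite (pl_val_int Kv) //= (logn_prime _ (pl_prime Kv)) eqxx natz.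
Qed.

Lemma par_form (K : fieldType) q (v : K -> int) (e : 'F_2) (u : int) :
  padic_like q v -> Nq q u -> (par v (q%:Z ^+ e * u)%:~R : nat) = e.
Proof. by move=> Kv qu; rewrite /par (val_form _ Kv qu) absz_nat F2_odd. Qed.

Section Main.
Variables (t : nat) (p : 'I_t -> nat).
Hypotheses (p_prime : forall i, prime (p i)) (p_neq2 : forall i, p i != 2%N)
  (p_neq3 : forall i, p i != 3%N) (p_inj : injective p).
Let P : int := \prod_i (p i)%:Z.
Let n : int := 2 * P.

(** The common shape of [decode1] and [decode2], convertible to both; exponents in F_2 are read as
    the naturals 0 and 1. *)
Definition form (e1 e2 e3 : 'F_2) (f : 'I_t -> 'F_2) : int :=
  (-1) ^+ e1 * 2 ^+ e2 * 3 ^+ e3 * \prod_i (p i)%:Z ^+ f i.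

Implicit Types (q : nat) (i j k : 'I_t) (e : 'F_2) (f : 'I_t -> 'F_2).

Lemma nq_prime q q' : prime q -> prime q' -> q' != q -> Nq q q'.
Proof. by move=> *; apply: ndvd_primes. Qed.

Lemma nq_prodX q f : prime q -> (forall i, p i != q) -> Nq q (\prod_i (p i)%:Z ^+ f i).
Proof.
by move=> q_pr pq; apply: ndvd_prod => // i _; apply: ndvdX => //; apply: nq_prime.
Qed.

Lemma nq_prod q : prime q -> (forall i, p i != q) -> Nq q P.
Proof. by move=> q_pr pq; apply: ndvd_prod => // i _; apply: nq_prime. Qed.

(** The cofactors that are units at 2, at 3 and at p_k respectively. *)
Definition form2 e1 e3 f : int := (-1) ^+ e1 * 3 ^+ e3 * \prod_i (p i)%:Z ^+ f i.
Definition form3 e1 e2 f : int := (-1) ^+ e1 * 2 ^+ e2 * \prod_i (p i)%:Z ^+ f i.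
Definition formp k e1 e2 e3 f : int :=
  (-1) ^+ e1 * 2 ^+ e2 * 3 ^+ e3 * \prod_(i | i != k) (p i)%:Z ^+ f i.

Lemma form2E e1 e2 e3 f : form e1 e2 e3 f = 2 ^+ e2 * form2 e1 e3 f.
Proof. by rewrite /form /form2; ring. Qed.
Lemma form3E e1 e2 e3 f : form e1 e2 e3 f = 3 ^+ e3 * form3 e1 e2 f.
Proof. by rewrite /form /form3; ring. Qed.
Lemma formpE k e1 e2 e3 f :
  form e1 e2 e3 f = (p k)%:Z ^+ f k * formp k e1 e2 e3 f.
Proof. by rewrite /form /formp (bigD1 k) //=; ring. Qed.

Lemma nq_form2 e1 e3 f : Nq 2 (form2 e1 e3 f).
Proof.
by apply: ndvdM => //; [apply: ndvdM => //; apply: ndvdX | apply: nq_prodX].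
Qed.
Lemma nq_form3 e1 e2 f : Nq 3 (form3 e1 e2 f).
Proof.
by apply: ndvdM => //; [apply: ndvdM => //; apply: ndvdX | apply: nq_prodX].
Qed.
Lemma nq_formp k e1 e2 e3 f : Nq (p k) (formp k e1 e2 e3 f).
Proof.
have pk := p_prime k; apply: ndvdM => //.
  by do ![apply: ndvdM => //]; apply: ndvdX; rewrite ?ndvdN1 //;
    apply: nq_prime => //; rewrite eq_sym.
apply: ndvd_prod => // i ik; apply: ndvdX => //; apply: nq_prime => //.
by rewrite (inj_eq p_inj).
Qed.
Lemma nq_form q e1 e2 e3 f : prime q -> q != 2%N -> q != 3%N -> (forall i, p i != q) ->
  Nq q (form e1 e2 e3 f).
Proof.
move=> q_pr q2 q3 qp; apply: ndvdM => //; last exact: nq_prodX.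
by do ![apply: ndvdM => //]; apply: ndvdX; rewrite ?ndvdN1 //;
    apply: nq_prime => //; rewrite eq_sym.
Qed.

Lemma form_neq0 e1 e2 e3 f : form e1 e2 e3 f != 0.
Proof.
rewrite form2E mulf_neq0 ?expf_neq0 //; apply: contraNneq (nq_form2 e1 e3 f) => ->.
exact: dvdz0.
Qed.

Lemma P_neq0 : P != 0.
Proof. by apply: contraNneq (nq_prod (q := 2) isT p_neq2) => ->; rewrite dvdz0. Qed.

Lemma P_gt0 : 0 < P.
Proof. by apply: prodr_gt0 => i _; rewrite ltz_nat prime_gt0. Qed.

Section Places.
Variables (g1 g2 g3 s1 s2 s3 : 'F_2) (x y : 'I_t -> 'F_2).
Let D1 := form g1 g2 g3 x.
Let D2 := form s1 s2 s3 y.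

(** * The place p_k: the two block rows of the matrix *)

Section PlaceP.
Variables (k : 'I_t) (K : fieldType) (v : K -> int).
Hypothesis Kv : padic_like (p k) v.
Local Notation L a := (addlegendre a (p k)).
Let mk : int := 2 * \prod_(i | i != k) (p i)%:Z.

Let nE : n = (p k)%:Z * mk.
Proof. by rewrite /n /P /mk (bigD1 k) //=; ring. Qed.

Let LM := addlegendreM (p_prime k) (p_neq2 k).
Let nq2 : Nq (p k) 2. Proof. by apply: nq_prime; rewrite // eq_sym. Qed.
Let nq3 : Nq (p k) 3. Proof. by apply: nq_prime; rewrite // eq_sym. Qed.
Let nqN1 : Nq (p k) (-1). Proof. exact: ndvdN1. Qed.
Let nqp i : i != k -> Nq (p k) (p i).
Proof. by move=> ik; apply: nq_prime; rewrite // (inj_eq p_inj). Qed.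
Let nqmk : Nq (p k) mk.
Proof. by apply: ndvdM => //; apply: ndvd_prod. Qed.
Let nqN3 : Nq (p k) (-3).
Proof. by rewrite (_ : -3 = -1 * 3) // ndvdM. Qed.
Let nqNmk : Nq (p k) (- mk).
Proof. by rewrite -mulN1r ndvdM. Qed.

Lemma addlegendre_formp e1 e2 e3 f :
  L (formp k e1 e2 e3 f) =
  L (-1) * e1 + L 2 * e2 + L 3 * e3 + \sum_(j | j != k) L (p j) * f j.
Proof.
have LX := phiX (p_prime k) LM.
have nqp' i : i != k -> Nq (p k) ((p i)%:Z ^+ f i) by move/nqp; ndvd.
have nq' : Nq (p k) (\prod_(i | i != k) (p i)%:Z ^+ f i) by apply: ndvd_prod.
rewrite /formp LM; [|by ndvd..]; rewrite LM; [|by ndvd..]; rewrite LM; [|by ndvd..].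
rewrite !LX // (phi_prod (p_prime k) LM) //; congr (_ + _).
by apply: eq_bigr => i ik; apply: LX; apply: nqp.
Qed.

Let Lmk : L mk = L 2 + \sum_(j | j != k) L (p j).
Proof. by rewrite LM //; [rewrite (phi_prod (p_prime k) LM) | apply: ndvd_prod]. Qed.

Lemma Amat_row f :
  \sum_j Amat p k j * f j =
  (\sum_(j | j != k) L (p j)) * f k + \sum_(j | j != k) L (p j) * f j.
Proof.
rewrite (bigD1 k) //= mxE eqxx; congr (_ + _); apply: eq_bigr => j jk.
by rewrite mxE eq_sym (negPf jk).
Qed.

Definition rowA := L (-1) * g1 + L 2 * g2 + L 3 * g3 + L (-3) * y k
  + (\sum_j Amat p k j * x j + L 2 * x k).
Definition rowB := L (-1) * s1 + L 2 * s2 + L 3 * s3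
  + (\sum_j Amat p k j * y j + L (-2) * y k).

Let p2 := p_neq2 k.
Let pK : ((p k)%:Z%:~R : K) != 0.
Proof. by rewrite (pl_int_eq0 Kv); have := prime_gt0 (p_prime k); lia. Qed.
Let nK : (n%:~R : K) != 0.
Proof. by rewrite (pl_int_eq0 Kv) mulf_neq0 // P_neq0. Qed.
Let three0 : (3 : K) != 0. Proof. by rewrite (pl_nat_eq0 Kv). Qed.
Let two0 : (2 : K) != 0. Proof. by rewrite (pl_nat_eq0 Kv). Qed.

(** The factor n^(x k) makes the valuation even and leaves the unit U, whose Legendre symbol is the
    row. The cofactor [mk] of n contributes the diagonal entry of A and that of D_2, and (-3)^(y k)
    contributes D_{-3}. *)
Lemma rowA_sim : sim (D1%:~R : K) (n%:~R ^+ x k * (- 3) ^+ y k) <-> rowA = 0.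
Proof.
rewrite sim1E ?mulf_neq0 ?expf_neq0 ?oppr_eq0 //.
pose U : int := formp k g1 g2 g3 x * mk ^+ x k * (-3) ^+ y k.
have nqF := nq_formp k g1 g2 g3 x.
have nqU : Nq (p k) U by rewrite /U; ndvd.
have -> : D1%:~R * (n%:~R ^+ x k * (- 3) ^+ y k)
    = U%:~R * ((p k)%:Z%:~R ^+ x k) ^+ 2 :> K.
  by rewrite /D1 (formpE k) nE /U !(rmorphM, rmorphXn, rmorphN) /= exprMn; ring.
have S : sim (U%:~R * ((p k)%:Z%:~R ^+ x k) ^+ 2) (U%:~R : K).
  by apply: sim_sqr; rewrite expf_neq0.
rewrite (sim_left 1 S) (sim1_addlegendre Kv) //.
have LX := phiX (p_prime k) LM.
rewrite /rowA Amat_row LM; [|by ndvd..]; rewrite LM; [|by ndvd..].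
rewrite !LX // addlegendre_formp Lmk.
by apply: eq0_iff; ring.
Qed.

Lemma rowB_sim : sim (D2%:~R : K) ((- n%:~R) ^+ y k) <-> rowB = 0.
Proof.
rewrite sim1E ?expf_neq0 ?oppr_eq0 //.
pose U : int := formp k s1 s2 s3 y * (- mk) ^+ y k.
have nqF := nq_formp k s1 s2 s3 y.
have nqU : Nq (p k) U by rewrite /U; ndvd.
have -> : D2%:~R * (- n%:~R) ^+ y k = U%:~R * ((p k)%:Z%:~R ^+ y k) ^+ 2 :> K.
  have E : D2 * (- n) ^+ y k = U * ((p k)%:Z ^+ y k) ^+ 2.
    rewrite /D2 (formpE k) nE /U -mulrN exprMn.
    by move: (formp _ _ _ _ _) ((- mk) ^+ _) ((p k)%:Z ^+ _) => F A B; ring.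
  by rewrite -rmorphN -!(rmorphXn intr) -!(rmorphM intr) E.
have S : sim (U%:~R * ((p k)%:Z%:~R ^+ y k) ^+ 2) (U%:~R : K).
  by apply: sim_sqr; rewrite expf_neq0.
rewrite (sim_left 1 S) (sim1_addlegendre Kv) //.
have LX := phiX (p_prime k) LM.
rewrite /rowB Amat_row LM; [|by ndvd..]; rewrite !LX //.
rewrite addlegendre_formp -(mulN1r mk) LM // Lmk (_ : -2 = -1 * 2) // LM //.
by apply: eq0_iff; ring.
Qed.

(** The local image is the torsion image. As n has valuation 1 and -3 is a unit, the valuations of
    D1 and D2 leave a single candidate, with exponents [x k] and [y k]. *)
Lemma place_p : cov (n%:~R : K) D1%:~R D2%:~R <-> rowA = 0 /\ rowB = 0.
Proof.
have D10 : (D1%:~R : K) != 0 by rewrite (pl_int_eq0 Kv) form_neq0.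
have D20 : (D2%:~R : K) != 0 by rewrite (pl_int_eq0 Kv) form_neq0.
rewrite -rowA_sim -rowB_sim; split=> [C|[S1 S2]]; last first.
  apply: (@cov_torsion _ _ _ _ 1 1 (odd (x k)) (odd (y k))); rewrite ?oner_neq0 //.
  - exact: cov11.
  - by rewrite !F2_odd mulr1.
  - by rewrite !F2_odd mulr1.
have v3 : v 3 = 0 by have := val_int_unit Kv nq3.
have vn : v n%:~R = 1.
  rewrite nE rmorphM (pl_valM Kv) // ?(pl_int_eq0 Kv) ?(ndvd_neq0 nqmk) //.
  rewrite (val_int_unit Kv nqmk) addr0 (pl_val_int Kv) /=; last first.
    by rewrite -(pl_int_eq0 Kv).
  by rewrite logn_prime // eqxx.
have [i [j [S1 S2]]] := local_image_additive Kv p2 v3 nK vn D10 D20 C.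
have vN3 : v (-3) = 0 by rewrite (pl_valN Kv).
have y_j : y k = j :> nat.
  have := par_form (y k) Kv (nq_formp k s1 s2 s3 y).
  rewrite -formpE (par_sim Kv _ S2) ?expf_neq0 ?oppr_eq0 // => <-.
  by case: (j); rewrite /par ?expr0 ?(pl_val1 Kv) // expr1 (pl_valN Kv) vn.
have x_i : x k = i :> nat.
  have := par_form (x k) Kv (nq_formp k g1 g2 g3 x).
  rewrite -formpE (par_sim Kv _ S1) ?mulf_neq0 ?expf_neq0 ?oppr_eq0 // => <-.
  rewrite (parM Kv) ?expf_neq0 ?oppr_eq0 // [par v (_ ^+ j)]par_unit ?addbF.
    by case: (i); rewrite /par ?expr0 ?(pl_val1 Kv) // expr1 vn.
  by rewrite (pl_valX Kv) ?oppr_eq0 // vN3 mul0rn.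
by rewrite y_j x_i.
Qed.

End PlaceP.

(** * The place 3: rows 4 and 5 *)

Section Place3.
Variables (K : fieldType) (v : K -> int).
Hypothesis Kv : padic_like 3 v.
Local Notation L a := (addlegendre a 3).

Definition row4 := s1 + s2 + addlegendre_prod p (-3) * g3
  + \sum_j addlegendre (-3) (p j) * y j.

Let pr3 : prime 3. Proof. by []. Qed.
Let LM := @addlegendreM 3 isT isT.

Lemma addlegendre_form3 e1 e2 f :
  L (form3 e1 e2 f) = e1 + e2 + \sum_j addlegendre (-3) (p j) * f j.
Proof.
have LX := phiX pr3 LM.
have nqp i : Nq 3 (p i) by apply: nq_prime.
have nqpX i : Nq 3 ((p i)%:Z ^+ f i) by have ? := nqp i; ndvd.
have nqprod : Nq 3 (\prod_i (p i)%:Z ^+ f i).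
  by apply: ndvd_prod => // i _; apply: nqpX.
rewrite /form3 LM; [|by ndvd..]; rewrite LM; [|by ndvd..].
rewrite !LX // (phi_prod pr3 LM); last by move=> i _; apply: nqpX.
have -> : L (-1) = 1 by rewrite addlegendreN1 //; apply: val_inj.
have -> : L 2 = 1 by rewrite addlegendre2 //; apply: val_inj.
rewrite !mul1r; congr (_ + _); apply: eq_bigr => i _.
by rewrite LX ?addlegendreN3 //; apply: nqp.
Qed.

Let n3 : Nq 3 n.
Proof. by apply: ndvdM => //; apply: nq_prod. Qed.
Let nK : (n%:~R : K) != 0.
Proof. by rewrite (pl_int_eq0 Kv) mulf_neq0 // P_neq0. Qed.
Let three0 : (3 : K) != 0. Proof. by rewrite (pl_nat_eq0 Kv). Qed.

Lemma addlegendre3_oppn : L (- n) = addlegendre_prod p (-3).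
Proof.
have nP : Nq 3 P by apply: nq_prod.
rewrite (_ : - n = -1 * 2 * P); last by rewrite /n; ring.
(* Modulo 3, -2 is 1, so -n = -2P has the symbol of P. *)
rewrite LM // (_ : L (-1 * 2) = 0) ?add0r; last first.
  by rewrite LM // addlegendreN1 // addlegendre2 //; apply: val_inj.
rewrite /P (phi_prod pr3 LM) => [|i _]; last by apply: nq_prime.
by apply: eq_bigr => i _; rewrite addlegendreN3.
Qed.

Lemma row4_sim : s3 = 0 ->
  sim (D2%:~R : K) ((- n%:~R) ^+ g3) <-> row4 = 0.
Proof.
move=> s30; rewrite sim1E ?expf_neq0 ?oppr_eq0 //.
have nqF := nq_form3 s1 s2 y.
have Nn3 : Nq 3 (- n) by rewrite -mulN1r; ndvd.
rewrite -rmorphN -!(rmorphXn intr) -!(rmorphM intr) (sim1_addlegendre Kv) //; last first.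
  by rewrite /D2 form3E s30 expr0 mul1r; ndvd.
rewrite /D2 form3E s30 expr0 mul1r LM; [|by ndvd..].
rewrite (phiX pr3 LM) // addlegendre_form3 addlegendre3_oppn /row4.
by apply: eq0_iff; ring.
Qed.

Lemma place_3 : cov (n%:~R : K) D1%:~R D2%:~R <-> s3 = 0 /\ row4 = 0.
Proof.
have D10 : (D1%:~R : K) != 0 by rewrite (pl_int_eq0 Kv) form_neq0.
have D20 : (D2%:~R : K) != 0 by rewrite (pl_int_eq0 Kv) form_neq0.
have vn : v n%:~R = 0 by apply: (val_int_unit Kv).
split=> [C|[s30 R4]]; last first.
  (* The sign turns the factor 3^g3 of D1 into (-3)^g3, the first component of the torsion class. *)
  pose c : int := (-1) ^+ g3 * form3 g1 g2 x.
  have nqF := nq_form3 g1 g2 x.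
  have nqc : Nq 3 c by rewrite /c; ndvd.
  apply: (cov_at_3 (c := c) (j := odd g3) Kv) => //; rewrite F2_odd.
    suff -> : D1 = (-3) ^+ g3 * c by rewrite rmorphM rmorphXn; apply: sim_refl.
    rewrite /D1 form3E /c mulrA -exprMn; congr (_ ^+ _ * _).
  exact/row4_sim.
have [p2 S2] := local_image_3 Kv erefl nK vn D10 D20 C.
have s30 : s3 = 0.
  have := par_form s3 Kv (nq_form3 s1 s2 y); rewrite -form3E p2 => E.
  by apply: val_inj.
split=> //; apply/(row4_sim s30); suff <- : par v D1%:~R = g3 :> nat by [].
by rewrite /D1 form3E (par_form _ Kv) ?nq_form3.
Qed.

End Place3.

(** * The place 2: rows 2 and 3, and the role of reciprocity *)

Section Place2.
Variables (K : fieldType) (v : K -> int).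
Hypothesis Kv : padic_like 2 v.

Definition row2 := g1 + addlegendre_prod p (-1) * g2 + g3
  + \sum_j addlegendre (-1) (p j) * x j.
Definition row3 := s2 + addlegendre_prod p 2 * g2 + g3
  + \sum_j addlegendre 2 (p j) * x j.

Let pr2 : prime 2. Proof. by []. Qed.
Let nqp i : Nq 2 (p i). Proof. exact: nq_prime. Qed.
Let nqP : Nq 2 P. Proof. exact: nq_prod. Qed.
Let nK : (n%:~R : K) != 0.
Proof. by rewrite (pl_int_eq0 Kv) mulf_neq0 // P_neq0. Qed.
Let two0 : (2 : K) != 0. Proof. by rewrite (pl_nat_eq0 Kv). Qed.
Let three0 : (3 : K) != 0. Proof. by rewrite (pl_nat_eq0 Kv). Qed.

Lemma eps_P : eps P = addlegendre_prod p (-1).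
Proof.
rewrite /P (phi_prod pr2 epsM) => [|i _]; last exact: nqp.
apply: eq_bigr => i _.
by rewrite addlegendreN1.
Qed.

Lemma om_P : om P = addlegendre_prod p 2.
Proof.
rewrite /P (phi_prod pr2 omM) => [|i _]; last exact: nqp.
apply: eq_bigr => i _.
by rewrite addlegendre2.
Qed.

Lemma symbol_form2 (phi : int -> 'F_2) e1 e3 f :
    (forall a b, ~~ (2 %| a)%Z -> ~~ (2 %| b)%Z -> phi (a * b) = phi a + phi b) ->
  phi (form2 e1 e3 f) = phi (-1) * e1 + phi 3 * e3 + \sum_j phi (p j) * f j.
Proof.
move=> phiM; have LX := phiX pr2 phiM.
have nqpX i : Nq 2 ((p i)%:Z ^+ f i) by have ? := nqp i; ndvd.
have nqprod : Nq 2 (\prod_i (p i)%:Z ^+ f i).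
  by apply: ndvd_prod => // i _; apply: nqpX.
rewrite /form2 phiM; [|by ndvd..]; rewrite phiM; [|by ndvd..].
rewrite !LX // (phi_prod pr2 phiM); last by move=> i _; apply: nqpX.
congr (_ + _).
by apply: eq_bigr => i _; apply: LX; apply: nqp.
Qed.

Lemma eps_form2 e1 e3 f :
  eps (form2 e1 e3 f) = e1 + e3 + \sum_j addlegendre (-1) (p j) * f j.
Proof.
have eN1 : eps (-1) = 1 by apply: val_inj.
have e3' : eps 3 = 1 by apply: val_inj.
rewrite (symbol_form2 _ _ _ epsM) eN1 e3' !mul1r.
by congr (_ + _); apply: eq_bigr => i _; rewrite addlegendreN1.
Qed.

Lemma om_form2 e1 e3 f :
  om (form2 e1 e3 f) = e3 + \sum_j addlegendre 2 (p j) * f j.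
Proof.
have oN1 : om (-1) = 0 by apply: val_inj.
have o3 : om 3 = 1 by apply: val_inj.
rewrite (symbol_form2 _ _ _ omM) oN1 o3 mul0r add0r mul1r.
by congr (_ + _); apply: eq_bigr => i _; rewrite addlegendre2.
Qed.

(** The unit part U is a square when it is 1 modulo 8, that is, when [eps] and [om] vanish on it:
    these are rows 2 and 3 in this order. As -3 is 5 modulo 8, s2 enters the second equation
    only. *)
Lemma row23_sim : sim (D1%:~R : K) (n%:~R ^+ g2 * (- 3) ^+ s2) <->
  row2 = 0 /\ row3 = 0.
Proof.
rewrite sim1E ?mulf_neq0 ?expf_neq0 ?oppr_eq0 //.
pose U : int := form2 g1 g3 x * P ^+ g2 * (-3) ^+ s2.
have nqF := nq_form2 g1 g3 x.
have nqU : Nq 2 U by rewrite /U; ndvd.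
have -> : D1%:~R * (n%:~R ^+ g2 * (- 3) ^+ s2) = U%:~R * (2 ^+ g2) ^+ 2 :> K.
  have E : D1 * (n ^+ g2 * (-3) ^+ s2) = U * (2 ^+ g2) ^+ 2.
    rewrite /D1 form2E /U /n exprMn.
    by move: (form2 _ _ _) (P ^+ _) (2 ^+ _) ((-3) ^+ _) => F A B C; ring.
  transitivity ((D1 * (n ^+ g2 * (-3) ^+ s2))%:~R : K).
    by rewrite (rmorphM intr D1) (rmorphM intr (n ^+ _)) !(rmorphXn intr).
  by rewrite E (rmorphM intr U) !(rmorphXn intr).
have S : sim (U%:~R * (2 ^+ g2) ^+ 2) (U%:~R : K).
  by apply: sim_sqr; rewrite expf_neq0.
rewrite (sim_left 1 S) (sim1_eps_om Kv) //.
rewrite /U epsM; [|by ndvd..]; rewrite epsM; [|by ndvd..].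
rewrite omM; [|by ndvd..]; rewrite omM; [|by ndvd..].
rewrite !(phiX pr2 epsM) // !(phiX pr2 omM) // eps_form2 om_form2 eps_P om_P.
have -> : eps (-3) = 0 by apply: val_inj.
have -> : om (-3) = 1 by apply: val_inj.
rewrite mul0r addr0 mul1r /row2 /row3.
have eqs (a b c d : 'F_2) : a = c -> b = d -> (a = 0 /\ b = 0 <-> c = 0 /\ d = 0).
  by move=> -> ->.
by apply: eqs; ring.
Qed.

Lemma place_2_necessary :
  cov (n%:~R : K) D1%:~R D2%:~R -> row2 = 0 /\ row3 = 0.
Proof.
move=> C; apply/row23_sim.
have D10 : (D1%:~R : K) != 0 by rewrite (pl_int_eq0 Kv) form_neq0.
have D20 : (D2%:~R : K) != 0 by rewrite (pl_int_eq0 Kv) form_neq0.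
have vn : v n%:~R = 1 by have := val_form 1 Kv nqP; rewrite expr1.
have := local_image_2 Kv erefl nK vn D10 D20 C.
have -> : par v D1%:~R = g2 :> nat by rewrite /D1 form2E (par_form _ Kv) ?nq_form2.
by have -> : par v D2%:~R = s2 :> nat by rewrite /D2 form2E (par_form _ Kv) ?nq_form2.
Qed.

(* Quadratic reciprocity enters only here: the third local condition at 2 is
   the sum over k of the conditions [rowB k]. *)
Lemma product_formula : s3 = 0 -> (forall k, rowB k = 0) ->
  om (form2 s1 s3 y * (- P) ^+ s2) + eps (form2 s1 s3 y * (- P) ^+ s2) * eps P = 0.
Proof.
move=> s30 RB; have nqF := nq_form2 s1 s3 y.
have nqN1 : Nq 2 (-1) by [].
have nqNP : Nq 2 (- P) by rewrite -mulN1r; ndvd.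
have eN1 : eps (-1) = 1 by apply: val_inj.
have oN1 : om (-1) = 0 by apply: val_inj.
have eNP : eps (- P) = 1 + eps P by rewrite -mulN1r epsM // eN1.
have oNP : om (- P) = om P by rewrite -mulN1r omM // oN1 add0r.
rewrite epsM; [|by ndvd..]; rewrite omM; [|by ndvd..].
rewrite (phiX pr2 epsM) // (phiX pr2 omM) // eNP oNP eps_form2 om_form2 s30.
(* The diagonal entry is the sum of its row, so in the column sum each entry meets its transpose.
   Reciprocity makes every such pair eps (p j) * eps (p k), and the sum over k other than j is that
   of P with the factor p j removed. *)
have colA j : \sum_k Amat p k j = eps (p j) * eps P + eps (p j).
  rewrite (bigD1 j) //= mxE eqxx -big_split /=.
  rewrite (eq_bigr (fun i => eps (p j) * addlegendre (-1) (p i))); last first.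
    move=> i ij; rewrite mxE (negPf ij) addlegendreN1 // mulrC.
    by apply: addlegendre_reciprocity; rewrite // (inj_eq p_inj).
  rewrite -mulr_sumr eps_P /addlegendre_prod [in RHS](bigD1 j) //= addlegendreN1 //.
  have ee : eps (p j) * eps (p j) = eps (p j).
    by case: (F2P (eps (p j))) => ->; rewrite ?mulr0 ?mulr1.
  by rewrite mulrDr ee addrAC F2_addrr add0r.
have colS : \sum_k \sum_j Amat p k j * y j
    = eps P * (\sum_j addlegendre (-1) (p j) * y j)
      + \sum_j addlegendre (-1) (p j) * y j.
  rewrite exchange_big /= mulr_sumr -big_split; apply: eq_bigr => j _ /=.
  by rewrite -mulr_suml colA addlegendreN1 //; ring.
have rowS : \sum_j addlegendre (-2) (p j) * y j
    = \sum_j addlegendre (-1) (p j) * y j + \sum_j addlegendre 2 (p j) * y j.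
  rewrite -big_split; apply: eq_bigr => j _ /=.
  rewrite (_ : -2 = -1 * 2) // addlegendreM //; first by ring.
    exact: ndvdN1.
  by apply: nq_prime; rewrite // eq_sym.
have : \sum_k rowB k = 0 by rewrite big1.
rewrite /rowB !big_split /= -!mulr_suml -/(addlegendre_prod p (-1)) -/(addlegendre_prod p 2).
rewrite colS rowS -eps_P -om_P s30 mulr0.
move: (\sum_i addlegendre (-1) _ * _) (\sum_i addlegendre 2 _ * _) => A B.
move: (eps P) (om P) => e o.
case: (F2P s1) => ->; case: (F2P s2) => ->; case: (F2P A) => ->; case: (F2P B) => ->;
  case: (F2P e) => ->; case: (F2P o) => ->; move=> /eqP H; apply/eqP; exact: H.
Qed.

(** Among the unit classes whose Hilbert symbol with n is trivial, 1 - n is thus the nontrivial one,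
    and [eps] tells it from 1. *)
Lemma symbols_1n : eps (1 - n) = 1 /\ om (1 - n) = eps P.
Proof.
have := res8_odd nqP; rewrite /eps /om !inE => /or4P[] /eqP P8.
- have -> : res8 (1 - n) = 7 by move: P8; rewrite /n /res8; lia.
  by rewrite P8.
- have -> : res8 (1 - n) = 3 by move: P8; rewrite /n /res8; lia.
  by rewrite P8.
- have -> : res8 (1 - n) = 7 by move: P8; rewrite /n /res8; lia.
  by rewrite P8.
- have -> : res8 (1 - n) = 3 by move: P8; rewrite /n /res8; lia.
  by rewrite P8.
Qed.

Lemma place_2_sufficient : s3 = 0 -> row2 = 0 -> row3 = 0 ->
  (forall k, rowB k = 0) -> cov (n%:~R : K) D1%:~R D2%:~R.
Proof.
move=> s30 R2 R3 RB; have PF := product_formula s30 RB.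
have nqF := nq_form2 s1 s3 y.
have nqNP : Nq 2 (- P) by rewrite -mulN1r; ndvd.
pose U : int := form2 s1 s3 y * (- P) ^+ s2; rewrite -/U in PF.
have nqU : Nq 2 U by rewrite /U; ndvd.
have nq1 : Nq 2 (1 - n).
  by rewrite /n; clear; lia.
have n10 : ((1 - n)%:~R : K) != 0 by rewrite (pl_int_eq0 Kv) (ndvd_neq0 nq1).
(* The valuations of b1 and b2 dictate the torsion exponents. The exponent of 1 - n is chosen to
   kill [eps] of the unit part; [product_formula] then says that [om] vanishes too. *)
apply: (cov_at_2 (i := odd g2) (j := odd s2) (k := odd (eps U)) Kv) => //.
- by rewrite mulf_neq0 // P_neq0.
- by rewrite dvdz_mulr.
- by rewrite !F2_odd; apply/row23_sim.
rewrite !F2_odd sim1E ?mulf_neq0 ?expf_neq0 ?oppr_eq0 //.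
pose W : int := U * (1 - n) ^+ eps U.
have nqW : Nq 2 W by rewrite /W; ndvd.
have -> : D2%:~R * ((- n%:~R) ^+ s2 * (1 - n)%:~R ^+ eps U)
    = W%:~R * (2 ^+ s2) ^+ 2 :> K.
  have E : D2 * ((- n) ^+ s2 * (1 - n) ^+ eps U) = W * (2 ^+ s2) ^+ 2.
    rewrite /D2 form2E /W; move: ((1 - n) ^+ _) => C.
    rewrite /U /n -mulrN exprMn.
    by move: (form2 _ _ _) ((- P) ^+ _) (2 ^+ _) => F A B; ring.
  transitivity ((D2 * ((- n) ^+ s2 * (1 - n) ^+ eps U))%:~R : K).
    rewrite (rmorphM intr D2) (rmorphM intr ((- n) ^+ _)) !(rmorphXn intr).
    by rewrite (rmorphN intr n).
  by rewrite E (rmorphM intr W) !(rmorphXn intr).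
have S : sim (W%:~R * (2 ^+ s2) ^+ 2) (W%:~R : K).
  by apply: sim_sqr; rewrite expf_neq0.
rewrite (sim_left 1 S) (sim1_eps_om Kv) // /W.
have [e1n o1n] := symbols_1n.
rewrite epsM; [|by ndvd..]; rewrite omM; [|by ndvd..].
rewrite (phiX pr2 epsM) // (phiX pr2 omM) // e1n o1n mul1r F2_addrr.
by rewrite mulrC PF.
Qed.

End Place2.
End Places.

End Main.

(** * The Selmer group *)

(** For opposite signs one of the two quadrics is definite: the second if b1 > 0, the first if b1 <
    0. Two negative signs are those of the torsion class (-3, -n). *)
Lemma cov_real (R : rcfType) (n b1 b2 : R) : 0 < n -> b1 != 0 -> b2 != 0 ->
  cov n b1 b2 <-> (0 < b1) = (0 < b2).
Proof.
move=> n_gt0 b10 b20.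
have simP (a b : R) : b != 0 -> 0 < a / b -> sim a b.
  move=> b0 ab; exists (Num.sqrt (a / b)); first by rewrite sqrtr_eq0 -ltNge.
  by rewrite sqr_sqrtr ?ltW // mulrC divfK.
have sum0 (a b c x y z : R) : 0 < a -> 0 < b -> 0 < c ->
    a * x ^+ 2 + b * y ^+ 2 + c * z ^+ 2 = 0 -> [/\ x = 0, y = 0 & z = 0].
  move=> a0 b0 c0 /eqP; have pos (d u : R) : 0 < d -> 0 <= d * u ^+ 2.
    by move=> d0; rewrite mulr_ge0 ?sqr_ge0 // ltW.
  rewrite !paddr_eq0 ?addr_ge0 ?pos //.
  rewrite (mulf_eq0 a) (mulf_eq0 b) (mulf_eq0 c) (gt_eqF a0) (gt_eqF b0) (gt_eqF c0).
  rewrite !sqrf_eq0 /=.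
  by move=> /andP[/andP[/eqP-> /eqP->] /eqP->].
split=> [[z0 [z1 [z2 [z3 [nz E1 E2]]]]]|].
  have E2' : b1 * z1 ^+ 2 + (- (b1 * b2)) * z3 ^+ 2 + (3 * n) * z0 ^+ 2 = 0.
    by rewrite mulNr E2; ring.
  have E1' : (- b1) * z1 ^+ 2 + b2 * z2 ^+ 2 + n * z0 ^+ 2 = 0.
    by rewrite -E1; ring.
  have n3_gt0 : 0 < 3 * n by rewrite mulr_gt0 // ltr0n.
  have [b1p|b1n] := ltP 0 b1; have [b2p|b2n] := ltP 0 b2 => //; exfalso.
    have b12 : 0 < - (b1 * b2) by rewrite -mulrN mulr_gt0 // oppr_gt0 lt_neqAle b20.
    have [z10 z30 z00] := sum0 _ _ _ _ _ _ b1p b12 n3_gt0 E2'.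
    move: E1' nz; rewrite z10 z30 z00 eqxx !expr0n /= !mulr0 add0r addr0 orbF => /eqP.
    by rewrite mulf_eq0 (negPf b20) sqrf_eq0 /= => ->.
  have Nb1 : 0 < - b1 by rewrite oppr_gt0 lt_neqAle b10.
  have [z10 z20 z00] := sum0 _ _ _ _ _ _ Nb1 b2p n_gt0 E1'.
  move: E2' nz; rewrite z10 z20 z00 eqxx !expr0n /= !mulr0 add0r addr0 => /eqP.
  by rewrite mulf_eq0 oppr_eq0 mulf_eq0 (negPf b10) (negPf b20) sqrf_eq0 /= => ->.
have [b1p b2p|b1n] := ltP 0 b1.
  apply: (@cov_torsion _ _ _ _ 1 1 false false); rewrite ?pnatr_eq0 ?oner_neq0 ?gt_eqF //.
  - exact: cov11.
  - by rewrite !expr0 !mulr1; apply: simP; rewrite ?oner_neq0 ?divr1.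
  - by rewrite expr0 mulr1; apply: simP; rewrite ?oner_neq0 ?divr1.
move/esym/negbT; rewrite -leNgt => b2n.
have {}b1n : b1 < 0 by rewrite lt_neqAle b10.
have {}b2n : b2 < 0 by rewrite lt_neqAle b20.
apply: (@cov_torsion _ _ _ _ 1 1 false true); rewrite ?pnatr_eq0 ?oner_neq0 ?gt_eqF //.
- exact: cov11.
- rewrite expr0 expr1 mul1r mulr1; apply: simP; rewrite ?oppr_eq0 ?pnatr_eq0 //.
  by rewrite -mulrNN -invrN opprK divr_gt0 ?oppr_gt0 // ltr0n.
- rewrite expr1 mulr1; apply: simP; rewrite ?oppr_eq0 ?gt_eqF //.
  by rewrite -mulrNN -invrN opprK divr_gt0 ?oppr_gt0.
Qed.

(** * Passage from rational representatives to integer ones over a field of characteristic 0 *)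

Section RatTransfer.
Variable K : fieldType.
Hypothesis K0 : forall m : int, (m%:~R == 0 :> K) = (m == 0).

Lemma ratrM_char0 (x y : rat) : ratr (x * y) = ratr x * ratr y :> K.
Proof.
have d0 (z : rat) : (denq z)%:~R != 0 :> K by rewrite K0 denq_neq0.
have E : numq (x * y) * (denq x * denq y) = numq x * numq y * denq (x * y).
  apply/eqP; rewrite -(eqr_int rat) !rmorphM /= !numqE; apply/eqP.
  by move: (_%:~R) (_%:~R) (_%:~R) => a b c; ring.
apply: (mulIf (mulf_neq0 (mulf_neq0 (d0 x) (d0 y)) (d0 (x * y)))).
rewrite /ratr; move: E (d0 x) (d0 y) (d0 (x * y)) => /(congr1 (fun z => z%:~R : K)).
rewrite !rmorphM /=; move: (numq _)%:~R (denq (x * y))%:~R => a b.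
move: (numq x)%:~R (denq x)%:~R (numq y)%:~R (denq y)%:~R => c d e f E d0' f0 b0.
have -> : a / b * (d * f * b) = a * (d * f) by field.
by rewrite E; field; nonzero.
Qed.

Lemma ratr_eq0_char0 (x : rat) : x != 0 -> (ratr x : K) != 0.
Proof. by move=> x0; rewrite mulf_neq0 ?invr_eq0 ?K0 ?denq_neq0 ?numq_eq0. Qed.

Lemma sim_ratr (x y : rat) : sim x y -> sim (ratr x : K) (ratr y).
Proof.
move=> [s s0 ->]; exists (ratr s); first exact: ratr_eq0_char0.
by rewrite expr2 !ratrM_char0.
Qed.

Lemma covering_cov (n : int) (b1 b2 : rat) (m1 m2 : int) :
    sim b1 m1%:~R -> sim b2 m2%:~R ->
  covering_has_point K 0 n%:~R (- 3 * n%:~R) b1 b2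
    <-> cov (n%:~R : K) m1%:~R m2%:~R.
Proof.
move=> /sim_ratr; rewrite ratr_int => S1 /sim_ratr; rewrite ratr_int => S2.
have -> : covering_has_point K 0 n%:~R (- 3 * n%:~R) b1 b2
    = cov (n%:~R : K) (ratr b1) (ratr b2).
  rewrite /covering_has_point /cov !subr0 ratrM_char0 ratr_int.
  have -> : -3 * n%:~R = (-3 * n)%:~R :> rat by rewrite rmorphM.
  by rewrite ratr_int rmorphM.
by split; apply: cov_sim => //; apply: sim_sym.
Qed.

End RatTransfer.

Lemma sqclass_eq (b c : rat) : sqclass b = sqclass c <-> sim b c.
Proof.
have sqE (a : rat) : sqclass a = [set d | sim d a]%classic by [].
split=> [E|S]; last first.
  rewrite !sqE; apply/seteqP; split=> d /=; first by move=> /sim_trans; apply.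
  by move=> /sim_trans; apply; apply: sim_sym.
have : sqclass b b by exists 1; rewrite ?oner_neq0 // expr1n mulr1.
by rewrite E.
Qed.

(** Halving the exponents in the factorization of a b gives r with a b = r^2, whence a = b (r /
    b)^2. *)
Lemma sim_rat_int (a b : int) : b != 0 -> 0 < a * b ->
  (forall q, prime q -> ~~ odd (logn q `|a * b|)) -> sim (a%:~R : rat) b%:~R.
Proof.
move=> b0 ab_gt0 ev; have M_gt0 : (0 < `|(a * b)%R|)%N by rewrite absz_gt0 gt_eqF.
pose r : nat := (\prod_(q <- primes `|(a * b)%R|) q ^ (logn q `|(a * b)%R|)./2)%N.
have rE : (a * b)%:~R = (r%:R : rat) ^+ 2.
  rewrite -(gtz0_abs ab_gt0) -pmulrn -natrX; congr (_%:R).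
  rewrite {1}(prod_prime_decomp M_gt0) prime_decompE big_map /r -mulnn -big_split /=.
  rewrite big_seq [RHS]big_seq; apply: eq_bigr => q /=.
  rewrite mem_primes => /and3P[q_pr _ _].
  by rewrite -expnD addnn even_halfK // ev.
have b0' : (b%:~R : rat) != 0 by rewrite intr_eq0.
exists (r%:R / b%:~R).
  rewrite mulf_neq0 ?invr_eq0 // -sqrf_eq0 -rE intr_eq0 gt_eqF //.
by rewrite expr_div_n -rE rmorphM; field.
Qed.

(** * Assembling the places: local solvability as the kernel of the matrix *)

Section Descent.
Variables (R : realType) (t : nat) (p : 'I_t -> nat).
Hypotheses (p_prime : forall i, prime (p i)) (p_neq2 : forall i, p i != 2%N)
  (p_neq3 : forall i, p i != 3%N) (p_inj : injective p).
Local Notation n := (2 * \prod_i (p i)%:Z : int).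

Definition locally_solvable (m1 m2 : int) :=
  cov (n%:~R : R) m1%:~R m2%:~R
  /\ forall q : primeT, cov (n%:~R : padic q) m1%:~R m2%:~R.

Lemma Sel2P (b1 b2 : rat) (m1 m2 : int) :
    b1 != 0 -> b2 != 0 -> sim b1 m1%:~R -> sim b2 m2%:~R ->
  Sel2 R n (sqclass b1, sqclass b2) <-> locally_solvable m1 m2.
Proof.
move=> b10 b20 S1 S2.
have R0 (m : int) : (m%:~R == 0 :> R) = (m == 0) by rewrite intr_eq0.
split=> [[c1 [c2 [c10 c20 [E1 E2] CR Cq]]]|[CR Cq]].
  have {}S1 := sim_trans (sim_sym ((sqclass_eq _ _).1 E1)) S1.
  have {}S2 := sim_trans (sim_sym ((sqclass_eq _ _).1 E2)) S2.
  split=> [|q]; first exact/(covering_cov R0 n S1 S2).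
  exact/(covering_cov (@padic_int_eq0 q) n S1 S2).
exists b1, b2; split=> // [|q]; first exact/(covering_cov R0 n S1 S2).
exact/(covering_cov (@padic_int_eq0 q) n S1 S2).
Qed.

Variable v : 'cV['F_2]_(6 + (t + t)).

Lemma decode1E : decode1 p v = form p (vtop v 3) (vtop v 4) (vtop v 5) (vx v).
Proof. by []. Qed.

Lemma decode2E : decode2 p v = form p (vtop v 0) (vtop v 1) (vtop v 2) (vy v).
Proof. by []. Qed.

Lemma form_gt0 e1 e2 e3 f : (0 < form p e1 e2 e3 f) = (e1 == 0).
Proof.
have pos : 0 < 2 ^+ e2 * 3 ^+ e3 * \prod_i (p i)%:Z ^+ f i :> int.
  rewrite !mulr_gt0 ?exprn_gt0 // prodr_gt0 // => i _.
  by rewrite exprn_gt0 // ltz_nat prime_gt0.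
rewrite /form -!mulrA; rewrite !mulrA -(mulrA _ (2 ^+ _)) -mulrA.
case: (F2P e1) => ->; first by rewrite mul1r pos.
by rewrite expr1 mulN1r oppr_gt0 ltNge ltW.
Qed.

(** The real place gives row 1, the place 2 rows 2 and 3, the place 3 rows 4 and 5, and p_k one row
    in each block. In the converse direction solvability at 2 also draws on row 5 and on the lower
    block rows of all the p_k. *)
Lemma decode_locally_solvable :
  locally_solvable (decode1 p v) (decode2 p v) <-> B1 p *m v = 0.
Proof.
have nR : 0 < n%:~R :> R.
  by rewrite ltr0z mulr_gt0 // (P_gt0 p_prime).
have P2 := padic_padic_like (exist _ 2 isT : primeT).
have P3 := padic_padic_like (exist _ 3 isT : primeT).
have D10 : decode1 p v != 0 by rewrite decode1E form_neq0.
have D20 : decode2 p v != 0 by rewrite decode2E form_neq0.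
have realE : cov (n%:~R : R) (decode1 p v)%:~R (decode2 p v)%:~R <-> vtop v 0 + vtop v 3 = 0.
  rewrite cov_real ?intr_eq0 // !ltr0z decode1E decode2E !form_gt0.
  rewrite F2_addr_eq0.
  by case: (F2P (vtop v 0)) => ->; case: (F2P (vtop v 3)) => ->; split=> // /eqP.
rewrite B1_kernel /locally_solvable realE; split=> [[R1 Cq]|[[R1 R2 R3 R4 s30] [RA RB]]].
  have [s30 R4] := (place_3 p_prime p_neq2 p_neq3 _ _ _ _ _ _ _ _ P3).1 (Cq _).
  have [R2 R3] := place_2_necessary p_prime p_neq2 P2 (Cq _).
  split; first by split.
  have Pk k := (place_p p_prime p_neq2 p_neq3 p_inj _ _ _ _ _ _ _ _
     (padic_padic_like (exist _ (p k) (p_prime k) : primeT))).1 (Cq _).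
  by split=> k; have [] := Pk k.
split=> // q; have Kq := padic_padic_like q.
have [q2|q2] := eqVneq (val q) 2%N.
  rewrite q2 in Kq; rewrite decode1E decode2E.
  exact: (place_2_sufficient p_prime p_neq2 p_inj Kq s30 R2 R3 RB).
have [q3|q3] := eqVneq (val q) 3%N.
  by rewrite q3 in Kq; apply/(place_3 p_prime p_neq2 p_neq3 _ _ _ _ _ _ _ _ Kq).
have [/existsP[k /eqP pk]|/existsPn qp] := boolP [exists k, p k == val q].
  rewrite -pk in Kq.
  apply/(place_p p_prime p_neq2 p_neq3 p_inj _ _ _ _ _ _ _ _ Kq); split.
    exact: RA.
  exact: RB.
have q_pr := valP q; apply: (cov_good Kq) => //.
- apply: ndvdM => //; first by apply: nq_prime => //; rewrite eq_sym.
  exact: nq_prod.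
- exact: nq_form.
- exact: nq_form.
Qed.

End Descent.

(** * Injectivity and surjectivity of the decoding *)

Section Bijection.
Variables (R : realType) (t : nat) (p : 'I_t -> nat).
Hypotheses (p_prime : forall i, prime (p i)) (p_neq2 : forall i, p i != 2%N)
  (p_neq3 : forall i, p i != 3%N) (p_inj : injective p).
Local Notation n := (2 * \prod_i (p i)%:Z : int).

Lemma par_int (K : fieldType) (q : nat) (v : K -> int) (m : int) :
  padic_like q v -> m != 0 -> par v m%:~R = odd (logn q `|m|).
Proof. by move=> Kv m0; rewrite /par (pl_val_int Kv). Qed.

Lemma padic_like_exists (q : nat) : prime q ->
  exists (K : fieldType) (v : K -> int), padic_like q v.
Proof.
move=> q_pr; exists (padic (exist _ q q_pr)), (@pval _).
exact: padic_padic_like.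
Qed.

Lemma odd_logn_form2 e1 e2 e3 f : odd (logn 2 `|form p e1 e2 e3 f|) = e2 :> nat.
Proof.
have [K [v Kv]] := @padic_like_exists 2 isT.
by rewrite -(par_int Kv) ?form_neq0 // form2E (par_form _ Kv) ?nq_form2.
Qed.

Lemma odd_logn_form3 e1 e2 e3 f : odd (logn 3 `|form p e1 e2 e3 f|) = e3 :> nat.
Proof.
have [K [v Kv]] := @padic_like_exists 3 isT.
by rewrite -(par_int Kv) ?form_neq0 // form3E (par_form _ Kv) ?nq_form3.
Qed.

Lemma odd_logn_formp k e1 e2 e3 f : odd (logn (p k) `|form p e1 e2 e3 f|) = f k :> nat.
Proof.
have [K [v Kv]] := padic_like_exists (p_prime k).
by rewrite -(par_int Kv) ?form_neq0 // (formpE p k) (par_form _ Kv) ?nq_formp.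
Qed.

Lemma sim_rat_odd_logn (a b : int) (q : nat) : prime q -> a != 0 -> b != 0 ->
  sim (a%:~R : rat) b%:~R -> odd (logn q `|a|) = odd (logn q `|b|).
Proof.
move=> q_pr a0 b0 S; have [K [v Kv]] := padic_like_exists q_pr.
rewrite -!(par_int Kv) //; apply: (par_sim Kv); first by rewrite (pl_int_eq0 Kv).
by have := sim_ratr (pl_int_eq0 Kv) S; rewrite !ratr_int.
Qed.

(** The sign and the parities of the valuations at 2, 3 and p_k are invariants of the square class,
    and they determine exponents in F_2. *)
Lemma form_inj e1 e2 e3 f e1' e2' e3' f' :
    sim ((form p e1 e2 e3 f)%:~R : rat) (form p e1' e2' e3' f')%:~R ->
  [/\ e1 = e1', e2 = e2', e3 = e3' & f =1 f'].
Proof.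
move=> S; have F0 := form_neq0 p_prime p_neq2; split.
- have : (0 < form p e1 e2 e3 f) = (0 < form p e1' e2' e3' f').
    rewrite -!(ltr0z rat); case: S => s s0 ->.
    by rewrite pmulr_lgt0 // lt_neqAle eq_sym sqr_ge0 andbT sqrf_eq0.
  by rewrite !form_gt0 //; case: (F2P e1) => ->; case: (F2P e1') => ->.
- apply: val_inj; rewrite /= -(odd_logn_form2 e1 e2 e3 f).
  by rewrite (sim_rat_odd_logn _ _ _ S) ?odd_logn_form2.
- apply: val_inj; rewrite /= -(odd_logn_form3 e1 e2 e3 f).
  by rewrite (sim_rat_odd_logn _ _ _ S) ?odd_logn_form3.
move=> k; apply: val_inj; rewrite /= -(odd_logn_formp k e1 e2 e3 f).
by rewrite (sim_rat_odd_logn _ _ _ S) ?odd_logn_formp.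
Qed.

Lemma decode_inj : injective (decode p).
Proof.
move=> v w [/sqclass_eq S1 /sqclass_eq S2].
have [v3 v4 v5 vxw] := form_inj S1; have [v0 v1 v2 vyw] := form_inj S2.
rewrite -[v]vsubmxK -[w]vsubmxK -[dsubmx v]vsubmxK -[dsubmx w]vsubmxK.
congr (col_mx _ (col_mx _ _)); apply/matrixP => i j; rewrite (ord1 j).
- suff top k : (k < 6)%N -> usubmx v (inord k) 0 = usubmx w (inord k) 0.
    by have := top i (ltn_ord i); rewrite inord_val.
  by case: k => [|[|[|[|[|[|//]]]]]] _.
- exact: vyw.
- exact: vxw.
Qed.

(** This confines Selmer classes to the primes 2, 3 and p_i, so that every one of them is in the
    range of [decode]. *)
Lemma local_solvable_good (m1 m2 : int) (q : nat) : prime q -> q != 2%N -> q != 3%N ->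
    (forall i, p i != q) -> m1 != 0 -> m2 != 0 -> locally_solvable R p m1 m2 ->
  ~~ odd (logn q `|m1|) /\ ~~ odd (logn q `|m2|).
Proof.
move=> q_pr q2 q3 qp m10 m20 [_ /(_ (exist _ q q_pr))].
move: (padic _) (@pval _) (padic_padic_like (exist _ q q_pr)) => K v Kq.
have nq3 : ~~ (q%:Z %| 3)%Z by apply: nq_prime; rewrite // eq_sym.
have nqn : ~~ (q%:Z %| n)%Z.
  by apply: ndvdM => //; [apply: nq_prime; rewrite // eq_sym | apply: nq_prod].
have int0 (m : int) : m != 0 -> (m%:~R : K) != 0 by rewrite (pl_int_eq0 Kq).
have v3 := val_int_unit Kq nq3; have vn := val_int_unit Kq nqn.
have n0 := int0 _ (ndvd_neq0 nqn).
move/(local_image_good Kq q2 v3 n0 vn (int0 _ m10) (int0 _ m20)).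
by rewrite !(par_int Kq) // => -[-> ->].
Qed.

Definition sign_exp (m : int) : 'F_2 := (m < 0)%R%:R.
Definition val_exp (q : nat) (m : int) : 'F_2 := (odd (logn q `|m|))%:R.

(** The squarefree part of m with all primes other than 2, 3 and the p_i dropped; it keeps the class
    of m when those occur to even powers. *)
Definition squarefree_form (m : int) :=
  form p (sign_exp m) (val_exp 2 m) (val_exp 3 m) (fun i => val_exp (p i) m).

Lemma squarefree_form_sim (m : int) : m != 0 ->
    (forall q, prime q -> q != 2%N -> q != 3%N -> (forall i, p i != q) ->
       ~~ odd (logn q `|m|)) ->
  sim (m%:~R : rat) (squarefree_form m)%:~R.
Proof.
move=> m0 m_good; have F0 : squarefree_form m != 0 by rewrite form_neq0.
have oddE (b : bool) : (b%:R : 'F_2) = b :> nat by case: b.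
apply: sim_rat_int => // [|q q_pr].
  have := form_gt0 p_prime (sign_exp m) (val_exp 2 m) (val_exp 3 m) (fun i => val_exp (p i) m).
  rewrite -/(squarefree_form m) /sign_exp; case: (ltP m 0) => [m_lt0|m_ge0] E.
    have sf_lt0 : squarefree_form m < 0 by rewrite ltNge le_eqVlt E eq_sym (negPf F0).
    by rewrite nmulr_rgt0.
  have m_gt0 : 0 < m by rewrite lt_neqAle eq_sym m0.
  by rewrite mulr_gt0 // E.
rewrite abszM lognM ?absz_gt0 // oddD.
suff -> : odd (logn q `|squarefree_form m|) = odd (logn q `|m|) by rewrite addbb.
have natb (b c : bool) : b = c :> nat -> b = c by case: b; case: c.
have [->|q2] := eqVneq q 2%N.
  by apply: natb; rewrite odd_logn_form2 oddE.
have [->|q3] := eqVneq q 3%N.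
  by apply: natb; rewrite odd_logn_form3 oddE.
have [/existsP[k /eqP <-]|/existsPn qp] := boolP [exists k, p k == q].
  by apply: natb; rewrite odd_logn_formp oddE.
rewrite (negPf (m_good q q_pr q2 q3 qp)) lognE.
have := nq_form p_prime (sign_exp m) (val_exp 2 m) (val_exp 3 m)
  (fun i => val_exp (p i) m) q_pr q2 q3 qp.
by rewrite dvdzE /= -/(squarefree_form m) => /negPf ->; rewrite !andbF.
Qed.

Definition encode (m1 m2 : int) : 'cV['F_2]_(6 + (t + t)) :=
  col_mx (\col_(i < 6) [:: sign_exp m2; val_exp 2 m2; val_exp 3 m2;
                            sign_exp m1; val_exp 2 m1; val_exp 3 m1]`_i)
    (col_mx (\col_i val_exp (p i) m2) (\col_i val_exp (p i) m1)).

Lemma decode_encode (m1 m2 : int) :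
  decode1 p (encode m1 m2) = squarefree_form m1
  /\ decode2 p (encode m1 m2) = squarefree_form m2.
Proof.
have topE k : (k < 6)%N -> vtop (encode m1 m2) k = [:: sign_exp m2; val_exp 2 m2;
    val_exp 3 m2; sign_exp m1; val_exp 2 m1; val_exp 3 m1]`_k.
  by move=> k6; rewrite /vtop col_mxKu mxE inordK.
have xE i : vx (encode m1 m2) i = val_exp (p i) m1 by rewrite /vx !col_mxKd mxE.
have yE i : vy (encode m1 m2) i = val_exp (p i) m2.
  by rewrite /vy col_mxKd col_mxKu mxE.
rewrite decode1E decode2E !topE //= /squarefree_form /form.
by split; congr (_ * _); apply: eq_bigr => i _; rewrite ?xE ?yE.
Qed.

Lemma decode_bij : is_Monsky_matrix p R n (B1 p).
Proof.
split.
- move=> v /= v0; rewrite /decode.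
  apply/(Sel2P R p (m1 := decode1 p v) (m2 := decode2 p v)).
  + by rewrite intr_eq0 form_neq0.
  + by rewrite intr_eq0 form_neq0.
  + exact: sim_refl.
  + exact: sim_refl.
  exact/decode_locally_solvable.
- by move=> v w _ _; apply: decode_inj.
move=> c [b1 [b2 [b10 b20 cE CR Cq]]].
(* Numerator over denominator and numerator times denominator differ by the square of the
   denominator. *)
have toint (b : rat) : b != 0 -> exists2 m : int, m != 0 & sim b m%:~R.
  move=> b0; exists (numq b * denq b).
    by rewrite mulf_neq0 ?numq_eq0 ?denq_neq0.
  exists (denq b)%:~R^-1; first by rewrite invr_eq0 intr_eq0 denq_neq0.
  rewrite rmorphM /= numqE; field.
  by rewrite intr_eq0 denq_neq0.
have [m1 m10 S1] := toint b1 b10; have [m2 m20 S2] := toint b2 b20.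
have LS : locally_solvable R p m1 m2.
  by apply/(Sel2P R p b10 b20 S1 S2); exists b1, b2.
have good q q_pr q2 q3 qp := @local_solvable_good m1 m2 q q_pr q2 q3 qp m10 m20 LS.
have T1 : sim (m1%:~R : rat) (squarefree_form m1)%:~R.
  by apply: squarefree_form_sim => // q q_pr q2 q3 qp; have [] := good q q_pr q2 q3 qp.
have T2 : sim (m2%:~R : rat) (squarefree_form m2)%:~R.
  by apply: squarefree_form_sim => // q q_pr q2 q3 qp; have [] := good q q_pr q2 q3 qp.
have [E1 E2] := decode_encode m1 m2.
have S1' := sim_trans S1 T1; have S2' := sim_trans S2 T2.
exists (encode m1 m2); last first.
  by rewrite cE /decode E1 E2; congr (_, _); apply/sqclass_eq; apply: sim_sym.
apply/(decode_locally_solvable R p_prime p_neq2 p_neq3 p_inj); rewrite E1 E2.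
by apply/(Sel2P R p b10 b20 S1' S2'); exists b1, b2.
Qed.

End Bijection.

Theorem theorem6p7 (R : realType) (t : nat) (p : 'I_t -> nat) (n : int)
  (p_prime : forall i, prime (p i))
  (p_neq2 : forall i, p i <> 2%N)
  (p_neq3 : forall i, p i <> 3%N)
  (p_inj : injective p)
  (n_def : n = 2 * \prod_i (p i)%:Z) :
  is_Monsky_matrix p R n (B1 p).
Proof.
by rewrite n_def; apply: decode_bij => // i; apply/eqP.
Qed.
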